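(* There is a deterministic algorithm for the $(1+\epsilon)$-approximate incremental single-source shortest paths problem in directed weighted graphs (defined in the context) with total update time $\tilde{O}(m^{3/2}\log(W)/\epsilon)$. Distance queries are answered in time $O(1)$, and for any queried vertex $x$ an approximate shortest path $\pi_{s,x}$ (an $s$–$x$ path whose length is at most the reported estimate) is reported in time $O(|\pi_{s,x}|)$, where $|\pi_{s,x}|$ is its number of edges.
   Context: Incremental $(1+\epsilon)$-approximate SSSP problem: a directed graph $G=(V,E)$ with $n=|V|$ vertices and a dedicated source $s\in V$ undergoes a sequence of edge insertions (never deletions); every edge $(u,v)$ has an integer weight $\omega(u,v)\in\{1,\dots,W\}$, and $m$ denotes the total number of edges ever present (initial edges plus inserted ones). The distance $d(s,v)$ is the minimum total weight of a directed $s$–$v$ path ($\infty$ if none exists). After processing each insertion, the algorithm must be able to answer, for every $v\in V$, a query returning an estimate $\hat d(v)$ with $d(s,v)\le \hat d(v)<(1+\epsilon)d(s,v)$. Total update time means the total time spent processing the initial graph and the entire insertion sequence. $\tilde O(\cdot)$ hides polylogarithmic factors in $n$.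
   Formalization: In the update bound 1/ε is read as 1/min(1,ε), log W as 1+log W and m as max(m,1), since the literal bound fails for huge ε, W=1 or m=0; ε is a rational input; at distance 0 or ∞ the estimate equals the distance; path time is O(max(|π|,1)). *)

(* Defs.v *)
From mathcomp Require Import all_boot all_order all_algebra.
From mathcomp Require Import all_classical all_reals all_analysis.
From Stdlib Require List.

Set Implicit Arguments.
Unset Strict Implicit.
Unset Printing Implicit Defensive.

Import Order.TTheory GRing.Theory Num.Theory.

(** * Word RAM

    A program is a finite command of a structured imperative language over
    finitely many registers and a random-access memory of words.  Every
    instruction, operator and operand costs one unit of time.  Words are the
    naturals below a bound [B] (so a word has log2 B bits); an operation whose
    result is not below [B] does not wrap around: it has no execution. *)

Inductive binop := OpAdd | OpSub | OpMul | OpDiv | OpMod | OpEq | OpLt.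

Definition binop_sem (o : binop) (x y : nat) : nat :=
  match o with
  | OpAdd => x + y
  | OpSub => x - y
  | OpMul => x * y
  | OpDiv => x %/ y
  | OpMod => x %% y
  | OpEq => x == y
  | OpLt => x < y
  end.

Inductive expr :=
  | Cst of nat
  | Reg of nat
  | Fetch of expr
  | Bin of binop & expr & expr.

Inductive cmd :=
  | Skip
  | Assign of nat & expr
  | Store of expr & expr (* address, value *)
  | Read of nat          (* next word of the input, into a register *)
  | Write of expr        (* append a word to the output *)
  | Seq of cmd & cmd
  | If of expr & cmd & cmd
  | While of expr & cmd.

Record state := State {
  memory : nat -> nat;
  registers : nat -> nat;
  intape : seq nat;
  outtape : seq nat }.

Definition upd (f : nat -> nat) (x v : nat) : nat -> nat :=
  fun y => if y == x then v else f y.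

Fixpoint cost (e : expr) : nat :=
  match e with
  | Cst _ | Reg _ => 1
  | Fetch e1 => (cost e1).+1
  | Bin _ e1 e2 => (cost e1 + cost e2).+1
  end.

Definition word (B v : nat) : option nat := if v < B then Some v else None.

Fixpoint eval (B : nat) (st : state) (e : expr) : option nat :=
  match e with
  | Cst k => word B k
  | Reg x => word B (registers st x)
  | Fetch e1 => if eval B st e1 is Some a then word B (memory st a) else None
  | Bin o e1 e2 =>
      match eval B st e1, eval B st e2 with
      | Some v1, Some v2 => word B (binop_sem o v1 v2)
      | _, _ => None
      end
  end.

(** [exec B c st t st']: started in [st], the command [c] halts in [st'] after
    [t] units of time. *)
Inductive exec (B : nat) : cmd -> state -> nat -> state -> Prop :=
  | ExSkip st : exec B Skip st 1 st
  | ExAssign x e st v : eval B st e = Some v ->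
      exec B (Assign x e) st (cost e).+1
        (State (memory st) (upd (registers st) x v) (intape st) (outtape st))
  | ExStore e1 e2 st a v : eval B st e1 = Some a -> eval B st e2 = Some v ->
      exec B (Store e1 e2) st (cost e1 + cost e2).+1
        (State (upd (memory st) a v) (registers st) (intape st) (outtape st))
  | ExRead x st v i : intape st = v :: i -> v < B ->
      exec B (Read x) st 1 (State (memory st) (upd (registers st) x v) i (outtape st))
  | ExWrite e st v : eval B st e = Some v ->
      exec B (Write e) st (cost e).+1
        (State (memory st) (registers st) (intape st) (rcons (outtape st) v))
  | ExSeq c1 c2 st st1 st2 t1 t2 :
      exec B c1 st t1 st1 -> exec B c2 st1 t2 st2 ->
      exec B (Seq c1 c2) st (t1 + t2) st2
  | ExIf e c1 c2 st v t st' : eval B st e = Some v ->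
      exec B (if v != 0 then c1 else c2) st t st' ->
      exec B (If e c1 c2) st ((cost e).+1 + t) st'
  | ExWhileF e c st : eval B st e = Some 0 ->
      exec B (While e c) st (cost e).+1 st
  | ExWhileT e c st v t1 st1 t2 st2 : eval B st e = Some v -> v != 0 ->
      exec B c st t1 st1 -> exec B (While e c) st1 t2 st2 ->
      exec B (While e c) st ((cost e).+1 + t1 + t2) st2.

Lemma exec_det B c st t1 st1 t2 st2 :
  exec B c st t1 st1 -> exec B c st t2 st2 -> t1 = t2 /\ st1 = st2.
Proof.
move=> H; elim: H t2 st2 => {c st t1 st1};
  intros; match goal with H : exec _ _ _ _ _ |- _ =>
    inversion H; subst; clear H end;
  repeat match goal with
  | H1 : eval ?B ?st ?e = Some _, H2 : eval ?B ?st ?e = Some _ |- _ =>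
      rewrite H1 in H2; case: H2 => H2; subst
  | H1 : intape _ = _, H2 : intape _ = _ |- _ =>
      rewrite H1 in H2; case: H2 => ? ?; subst
  | IH : forall t st, exec ?B ?c ?st0 t st -> _, H : exec ?B ?c ?st0 _ _ |- _ =>
      have [? ?] := IH _ _ H; clear H; subst
  end; by [].
Qed.

(** One procedure call: registers and output start cleared, only the memory
    persists from one call to the next. *)
Definition call (B : nat) (c : cmd) (M : nat -> nat) (input : seq nat)
    (t : nat) (M' : nat -> nat) (output : seq nat) : Prop :=
  exists st', [/\ exec B c (State M (fun=> 0) input [::]) t st',
                  memory st' = M' & outtape st' = output].

(** * Incremental single-source shortest paths *)

Section Graph.
Variable n : nat.
Implicit Types (w : 'I_n -> 'I_n -> nat) (E : seq ('I_n * 'I_n)).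

(** The vertex sequence [s :: p] is a (simple) path from [s] to [v]; its number
    of edges is [size p]. *)
Definition is_path E (s : 'I_n) (p : seq 'I_n) (v : 'I_n) : bool :=
  [&& path (fun x y => (x, y) \in E) s p, last s p == v & uniq (s :: p)].

Definition path_length w (s : 'I_n) (p : seq 'I_n) : nat :=
  \sum_(e <- zip (s :: p) p) w e.1 e.2.

Local Open Scope classical_set_scope.
Local Open Scope ring_scope.
Local Open Scope ereal_scope.

(** The infimum of the empty set is [+oo]. *)
Definition dist (R : realType) w E (s v : 'I_n) : \bar R :=
  ereal_inf [set (path_length w s p)%:R%:E | p in [set p | is_path E s p v]].

(** [d <= dh < (1 + eps) d]; the strict inequality is unsatisfiable when [d] is
    [0] or [+oo], where the condition reads [dh = d]. *)
Definition approximates (R : realType) (eps : R) (d dh : \bar R) : Prop :=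
  [/\ d <= dh, dh <= (1 + eps)%:E * d
    & 0 < d -> d < +oo -> dh < (1 + eps)%:E * d].

End Graph.

(** A reported estimate is a pair of words, numerator and denominator;
    denominator [0] stands for [+oo]. *)
Definition estimate (R : realType) (a b : nat) : \bar R :=
  if b == 0 then +oo%E else (a%:R / b%:R)%R%:E.

Inductive request (n : nat) :=
  | Insert of 'I_n & 'I_n
  | QueryDist of 'I_n
  | QueryPath of 'I_n.

Arguments Insert {n}.
Arguments QueryDist {n}.
Arguments QueryPath {n}.

Definition is_insert n (r : request n) : bool :=
  if r is Insert _ _ then true else false.

Definition inserted n (rs : seq (request n)) : seq ('I_n * 'I_n) :=
  pmap (fun r => if r is Insert u v then Some (u, v) else None) rs.

Record algorithm := Algorithm {
  init_proc : cmd;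
  insert_proc : cmd;
  dist_proc : cmd;
  path_proc : cmd }.

(** The accuracy is the rational number [a / b]. *)
Definition init_input n (w : 'I_n -> 'I_n -> nat) (s : 'I_n) (W a b : nat)
    (E0 : seq ('I_n * 'I_n)) : seq nat :=
  [:: n; nat_of_ord s; W; a; b; size E0]
  ++ flatten [seq [:: nat_of_ord e.1; nat_of_ord e.2; w e.1 e.2] | e <- E0].

Definition request_proc n (A : algorithm) (r : request n) : cmd :=
  match r with
  | Insert _ _ => insert_proc A
  | QueryDist _ => dist_proc A
  | QueryPath _ => path_proc A
  end.

Definition request_input n (w : 'I_n -> 'I_n -> nat) (r : request n) : seq nat :=
  match r with
  | Insert u v => [:: nat_of_ord u; nat_of_ord v; w u v]
  | QueryDist v | QueryPath v => [:: nat_of_ord v]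
  end.

(** [stage] is the number of insertions processed before the request. *)
Record entry (n : nat) := Entry {
  stage : nat;
  req : request n;
  time : nat;
  answer : seq nat }.

(** The requests are served online, in order; a call only sees the current
    request and the memory left by the previous call. *)
Inductive session (B n : nat) (A : algorithm) (w : 'I_n -> 'I_n -> nat) :
    nat -> (nat -> nat) -> seq (request n) -> seq (entry n) -> Prop :=
  | SessionNil i M : session B A w i M [::] [::]
  | SessionCons i M r rs t M' o log :
      call B (request_proc A r) M (request_input w r) t M' o ->
      session B A w (i + is_insert r) M' rs log ->
      session B A w i M (r :: rs) (Entry i r t o :: log).

(** Time spent in initialization ([t0]) and insertions. *)
Definition update_time n (t0 : nat) (log : seq (entry n)) : nat :=
  t0 + \sum_(x <- log | is_insert (req x)) time x.

(* Main.v *)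
(** Time is the number [g] of edges inserted so far. Inserting an edge relaxes
    that edge only; the consequences are propagated lazily, along dyadic blocks
    of times. If [2 ^ v] is the largest power of two dividing [g], then at time
    [g] Dijkstra's algorithm is started from the vertices whose estimate dropped
    by a factor [q / (q + 1)] or more during the block [(g - 2 ^ v, g]]; a
    journal of all changes gives access to the estimates at time [g - 2 ^ v].
    At the multiples of [K = 2 ^ k], about [sqrt m], all edges are relaxed
    instead (a rebuild); this costs [O~(m)] at each of [O(sqrt m)] times.

    Let [2 ^ v] divide [g]. By induction on [g], the estimates at time [g]
    stretch a walk of edges older than the last rebuild by at most
    [(1 + 1 / q) ^ (k - v)]: edges leaving a vertex that dropped are tight, and
    at the first vertex that did not drop, one factor [1 + 1 / q] pays for going
    back to the time [g - 2 ^ v], which is divisible by [2 ^ v.+1]. A simple path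
    has fewer than [K] newer edges, which cut it into at most [K] such walks; its
    stretch is at most [(1 + 1 / q) ^ N] with [N = O(K k)], which is less than
    [1 + eps] when [q] is a suitable multiple of [N * (1 + 1 / eps)].

    For each [v], a vertex is explored at times of exact 2-adic valuation [v]
    only after its estimate has dropped by the factor [q / (q + 1)], hence
    [O(q log (n W))] times. Since a time lies in [O(log m)] blocks, all
    explorations cost [O~(m q log W) = O~(m ^ (3/2) log W / eps)]. *)

(* Machine and analysis meet only in the function [hist]: [Consistent] says that the memory encodes
   it, [Step] records what one insertion guarantees about it, and both the stretch and the sum of
   the [cost_at] are deduced from [Step] and the initial values, with no reference to the memory.
   Infinity is replaced in [hist] by the number [U], so that becoming finite is an ordinary drop by
   a factor. The price is a separate argument that a reachable vertex never keeps the value [U]; for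
   this the stretch is kept below 2 even when [eps] is large. The source has estimate 0 and can
   never drop by a factor. It is exempt throughout: its edges are tight because they are relaxed
   when inserted and its estimate never changes. The period [K], and with it [q], changes only at
   rebuilds, and no block reaches behind the last rebuild. Hence the journal can be emptied there,
   and one value of [q] governs each induction. Stretch bounds are inequalities in [nat] with powers
   of [q] and [q + 1] on opposite sides; logarithms enter only in the final time bound. *)
Require Import Defs.
From mathcomp Require Import all_boot all_order all_algebra.
From mathcomp Require Import all_classical all_reals all_analysis.
From mathcomp Require Import zify ring lra.
From Stdlib Require List.
Import Order.TTheory GRing.Theory Num.Theory.
Set Implicit Arguments.
Unset Strict Implicit.
Unset Printing Implicit Defensive.

(** * Programs on the word RAM *)

Notation "a ;; b" := (Seq a b) (at level 100, right associativity).

(* The memory is used as sixteen interleaved arrays. *)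
Definition fld (M : nat -> nat) (f : nat) : nat -> nat := fun x => M (x * 16 + f).
Definition addr (f : nat) (e : expr) := Bin OpAdd (Bin OpMul e (Cst 16)) (Cst f).
Definition Arr f e := Fetch (addr f e).
Definition SArr f e v := Store (addr f e) v.

Fixpoint vale (M R : nat -> nat) (e : expr) : nat :=
  match e with
  | Cst k => k
  | Reg x => R x
  | Fetch e1 => M (vale M R e1)
  | Bin o e1 e2 => binop_sem o (vale M R e1) (vale M R e2)
  end.

(* If all cells and registers are below [H], then [e] evaluates below
   [H ^ deg e]. *)
Fixpoint deg (e : expr) : nat :=
  match e with
  | Bin OpAdd e1 e2 => (maxn (deg e1) (deg e2)).+1
  | Bin OpMul e1 e2 => deg e1 + deg e2
  | Bin (OpSub | OpDiv | OpMod) e1 _ => deg e1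
  | _ => 1
  end.

(** Constants up to 16 are below [H] because [17 <= H]. The sum of the degrees is tested for every
    operator since it dominates the degree of each result; staying below 8 keeps all values under
    [H ^ 8 <= B]. *)
Fixpoint okx (e : expr) : bool :=
  match e with
  | Cst k => k <= 16
  | Reg _ => true
  | Fetch e1 => okx e1
  | Bin _ e1 e2 => [&& okx e1, okx e2 & deg (Bin OpMul e1 e2) < 8]
  end.

Lemma updE f x v y : upd f x v y = if y == x then v else f y.
Proof. by []. Qed.

Lemma fld_same M f x v : fld (upd M (x * 16 + f) v) f = upd (fld M f) x v.
Proof.
apply: funext => y; rewrite /fld /upd.
by rewrite eqn_add2r eqn_pmul2r.
Qed.

Lemma fld_other M f g x v : f < 16 -> g < 16 -> g != f ->
  fld (upd M (x * 16 + f) v) g = fld M g.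
Proof.
move=> hf hg hfg; apply: funext => y; rewrite /fld /upd.
case: eqP => // h; exfalso; move/eqP: hfg; apply.
have := congr1 (modn^~ 16) h.
by rewrite !modnMDl !modn_small.
Qed.

Section Wp.
Variables B H : nat.
Hypothesis H17 : 17 <= H.
Hypothesis HB : H ^ 8 <= B.
Implicit Types (M R : nat -> nat) (i o : seq nat) (c : cmd) (e : expr).

Definition bd (M : nat -> nat) := forall x, M x < H.

Lemma bd_upd M x v : bd M -> v < H -> bd (upd M x v).
Proof. by move=> hM hv y; rewrite /upd; case: eqP. Qed.

Lemma deg_gt0 e : 0 < deg e.
Proof.
elim: e => //= o e1 h1 e2 h2; case: o => //=; lia.
Qed.

Lemma deg_lt e1 e2 (o : binop) : deg (Bin OpMul e1 e2) < 8 -> deg (Bin o e1 e2) <= 8.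
Proof.
have := deg_gt0 e1; have := deg_gt0 e2.
by case: o => /=; lia.
Qed.

Lemma eval_val M R i o e : bd M -> bd R -> okx e ->
  Defs.eval B (State M R i o) e = Some (vale M R e) /\ vale M R e < H ^ deg e.
Proof.
move=> bM bR.
have H0 : 0 < H by lia.
have HB1 : H <= B.
  by apply: leq_trans HB; rewrite -[X in X <= _]expn1 leq_exp2l //; lia.
have wd v : v < H -> word B v = Some v.
  by move=> hv; rewrite /word (leq_trans hv HB1).
elim: e => [k|x|e1 IH|op e1 IH1 e2 IH2] /=.
- move=> hk; have hkH : k < H by lia.
  by rewrite wd ?expn1.
- by move=> _; rewrite wd ?expn1 //; apply: bR.
- by move=> /IH [-> _]; rewrite wd ?expn1 //; apply: bM.
- case/and3P => /IH1 [-> h1] /IH2 [-> h2] hd.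
  have hdeg : deg (Bin op e1 e2) <= 8 by apply: deg_lt.
  suff hv : binop_sem op (vale M R e1) (vale M R e2) < H ^ deg (Bin op e1 e2).
    split => //; rewrite /word.
    by rewrite (leq_trans hv) // (leq_trans _ HB) // leq_exp2l //; lia.
  have hexp p r : p <= r -> H ^ p <= H ^ r by move=> ?; rewrite leq_exp2l //; lia.
  have hb (bb : bool) : bb < H ^ 1 by case: bb; rewrite expn1; lia.
  move: {hdeg hd} h1 h2; case: op => /= h1 h2.
  + rewrite expnS.
    have k1 := leq_trans h1 (hexp _ _ (leq_maxl (deg e1) (deg e2))).
    have k2 := leq_trans h2 (hexp _ _ (leq_maxr (deg e1) (deg e2))).
    have := leq_mul (_ : 2 <= H) (leqnn (H ^ maxn (deg e1) (deg e2))); lia.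
  + by apply: leq_ltn_trans h1; apply: leq_subr.
  + by rewrite expnD; apply: ltn_mul.
  + by apply: leq_ltn_trans h1; apply: leq_div.
  + by apply: leq_ltn_trans h1; apply: leq_mod.
  + exact: hb.
  + exact: hb.
Qed.

Definition post := nat -> (nat -> nat) -> (nat -> nat) -> seq nat -> seq nat -> Prop.

(* The bound [H] on all cells and registers is an invariant; by [eval_val] it
   prevents overflow in expressions accepted by [okx]. *)
Definition wp (c : cmd) M R i o (Q : post) : Prop :=
  bd M -> bd R ->
  exists t M' R' i' o',
    [/\ exec B c (State M R i o) t (State M' R' i' o'), bd M', bd R'
      & Q t M' R' i' o'].

Lemma wp_mono c M R i o (Q Q' : post) :
  wp c M R i o Q ->
  (forall t M' R' i' o', bd M' -> bd R' -> Q t M' R' i' o' -> Q' t M' R' i' o') ->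
  wp c M R i o Q'.
Proof.
move=> h hQ bM bR; have [t [M' [R' [i' [ o' [? ? ? ?]]]]]] := h bM bR.
by exists t, M', R', i', o'; split => //; apply: hQ.
Qed.

Lemma wp_skip M R i o (Q : post) : Q 1 M R i o -> wp Skip M R i o Q.
Proof. by move=> hQ bM bR; exists 1, M, R, i, o; split => //; constructor. Qed.

Lemma wp_asg x e M R i o (Q : post) : okx e ->
  (bd M -> bd R -> vale M R e < H) ->
  Q (cost e).+1 M (upd R x (vale M R e)) i o -> wp (Assign x e) M R i o Q.
Proof.
move=> he hv hQ bM bR.
have [ev _] := eval_val i o bM bR he.
exists (cost e).+1, M, (upd R x (vale M R e)), i, o; split => //.
- exact: (ExAssign x ev).
- by apply: bd_upd => //; apply: hv.
Qed.

Lemma wp_store f a e M R i o (Q : post) : okx (addr f a) -> okx e ->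
  (bd M -> bd R -> vale M R e < H) ->
  Q (cost (addr f a) + cost e).+1 (upd M (vale M R a * 16 + f) (vale M R e)) R i o ->
  wp (SArr f a e) M R i o Q.
Proof.
move=> ha he hv hQ bM bR.
have [ea _] := eval_val i o bM bR ha.
have [ev _] := eval_val i o bM bR he.
exists (cost (addr f a) + cost e).+1, (upd M (vale M R a * 16 + f) (vale M R e)), R, i, o.
split => //.
- exact: (ExStore ea ev).
- by apply: bd_upd => //; apply: hv.
Qed.

Lemma wp_seq c1 c2 M R i o (Q : post) :
  wp c1 M R i o (fun t1 M1 R1 i1 o1 =>
    wp c2 M1 R1 i1 o1 (fun t2 => Q (t1 + t2))) ->
  wp (c1 ;; c2) M R i o Q.
Proof.
move=> h bM bR.
have [t1 [M1 [R1 [i1 [ o1 [e1 bM1 bR1 h2]]]]]] := h bM bR.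
have [t2 [M2 [R2 [i2 [ o2 [e2 bM2 bR2 hQ]]]]]] := h2 bM1 bR1.
exists (t1 + t2), M2, R2, i2, o2; split => //.
exact: ExSeq e1 e2.
Qed.

Lemma wp_if e c1 c2 M R i o (Q : post) : okx e ->
  (vale M R e != 0 -> wp c1 M R i o (fun t => Q ((cost e).+1 + t))) ->
  (vale M R e = 0 -> wp c2 M R i o (fun t => Q ((cost e).+1 + t))) ->
  wp (If e c1 c2) M R i o Q.
Proof.
move=> he h1 h2 bM bR.
have [ev _] := eval_val i o bM bR he.
have hw : wp (if vale M R e != 0 then c1 else c2) M R i o (fun t => Q ((cost e).+1 + t)).
  by case: eqP => /= h; [apply: h2 | apply: h1; apply/eqP].
have [t [M' [R' [i' [ o' [ex ? ? ?]]]]]] := hw bM bR.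
exists ((cost e).+1 + t), M', R', i', o'; split => //.
exact: ExIf ev ex.
Qed.

(** Lets the branches assume the meaning [b] of the test instead of its compiled arithmetic. *)
Lemma wp_ifb e c1 c2 M R i o (Q : post) b : okx e -> (vale M R e != 0) = b ->
  (b -> wp c1 M R i o (fun t => Q ((cost e).+1 + t))) ->
  (~~ b -> wp c2 M R i o (fun t => Q ((cost e).+1 + t))) ->
  wp (If e c1 c2) M R i o Q.
Proof. by move=> he hb h1 h2; apply: wp_if => // h; [apply: h1 | apply: h2]; rewrite -hb ?h. Qed.

(** The first argument of [I] is a decreasing variant and the second is the time spent so far, so
    that termination and running time come out of the same invariant. *)
Lemma wp_while (I : nat -> post) e c M R i o (Q : post) k0 : okx e ->
  I k0 0 M R i o ->
  (forall k t M R i o, I k t M R i o -> vale M R e != 0 ->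
     wp c M R i o (fun t' M' R' i' o' =>
       exists2 k', k' < k & I k' (t + ((cost e).+1 + t')) M' R' i' o')) ->
  (forall k t M R i o, I k t M R i o -> vale M R e = 0 ->
     Q (t + (cost e).+1) M R i o) ->
  wp (While e c) M R i o Q.
Proof.
move=> he h0 hS hQ.
suff gen k t M1 R1 i1 o1 : I k t M1 R1 i1 o1 ->
    wp (While e c) M1 R1 i1 o1 (fun t' => Q (t + t')) by exact: gen h0.
elim/ltn_ind: k t M1 R1 i1 o1 => k IH t M1 R1 i1 o1 hI bM bR.
have [ev _] := eval_val i1 o1 bM bR he.
case: (eqVneq (vale M1 R1 e) 0) => hv.
  exists (cost e).+1, M1, R1, i1, o1; split => //; last exact: hQ hI hv.
  by rewrite hv in ev; apply: ExWhileF.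
have [t2 [M2 [R2 [i2 [ o2 [ex bM2 bR2 [k' hk hI2]]]]]]] := hS _ _ _ _ _ _ hI hv bM bR.
have [t3 [M3 [R3 [i3 [ o3 [ex3 bM3 bR3 h3]]]]]] := IH _ hk _ _ _ _ _ hI2 bM2 bR2.
exists ((cost e).+1 + t2 + t3), M3, R3, i3, o3; split => //.
- by apply: (ExWhileT ev hv ex ex3).
- by rewrite addnA.
Qed.

Lemma wp_read x v M R i o (Q : post) : v < H ->
  Q 1 M (upd R x v) i o -> wp (Read x) M R (v :: i) o Q.
Proof.
move=> hv hQ bM bR; exists 1, M, (upd R x v), i, o; split => //; last exact: bd_upd.
apply: (@ExRead _ _ (State M R (v :: i) o)) => //.
by apply: leq_trans hv _; apply: leq_trans HB; rewrite -[X in X <= _]expn1 leq_exp2l //; lia.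
Qed.

Lemma wp_write e M R i o (Q : post) : okx e ->
  Q (cost e).+1 M R i (rcons o (vale M R e)) -> wp (Write e) M R i o Q.
Proof.
move=> he hQ bM bR.
have [ev _] := eval_val i o bM bR he.
exists (cost e).+1, M, R, i, (rcons o (vale M R e)); split => //.
exact: (ExWrite ev).
Qed.

End Wp.

(** * Tournament trees *)

(* The nodes are numbered in heap order: the parent of [j] is [j %/ 2]. *)
Definition anc (i j : nat) : Prop := exists k, j %/ 2 ^ k = i.

Lemma anc_refl i : anc i i.
Proof. by exists 0; rewrite divn1. Qed.

Lemma anc_le i j : anc i j -> i <= j.
Proof. by case=> k <-; apply: leq_div. Qed.

Lemma anc_half i j : anc i j -> anc (i %/ 2) j.
Proof. by case=> k <-; exists k.+1; rewrite -divnMA expnSr. Qed.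

Lemma anc_split i j : anc i j -> i = j \/ anc i (j %/ 2).
Proof.
case=> [[|k]] <-; first by left; rewrite divn1.
by right; exists k; rewrite -divnMA expnS.
Qed.

Lemma anc_child i j : anc i j -> i = j \/ anc (2 * i) j \/ anc (2 * i).+1 j.
Proof.
case=> [[|k]] <-; first by left; rewrite divn1.
right; rewrite expnSr divnMA; set q := j %/ 2 ^ k.
have hq : anc q j by exists k.
have := modn2 q; have := divn_eq q 2; case: (odd q) => /= h1 h2.
- by right; rewrite (_ : (2 * _).+1 = q) //; lia.
- by left; rewrite (_ : 2 * _ = q) //; lia.
Qed.

(** Half of [n + y < 2 * n] is already below [n], so proper ancestors of a leaf are inner nodes. *)
Lemma anc_leaf n i y : n <= i -> y < n -> anc i (n + y) -> i = n + y.
Proof. by move=> hi hy /anc_split [//|/anc_le]; lia. Qed.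

Lemma anc1 j : 0 < j -> anc 1 j.
Proof.
move=> hj; exists (trunc_log 2 j).
have /andP [h1 h2] := trunc_log_bounds (isT : 1 < 2) hj.
by apply/eqP; rewrite eqn_leq -ltnS ltn_divLR ?expn_gt0 // -expnS h2 leq_divRL ?expn_gt0 // mul1n.
Qed.

Section Tournament.
Variable n : nat.
Implicit Types (D T : nat -> nat) (S : pred nat) (i x y : nat).

(* The leaf of the vertex [x] is [n + x]; a node holds [y.+1] for a key-minimal
   [y] among the members of [S] below it, or [0] if there is none. *)
Definition node D T S i : Prop :=
  match T i with
  | 0 => forall y, y < n -> S y -> ~ anc i (n + y)
  | z.+1 => [/\ z < n, S z, anc i (n + z) &
              forall y, y < n -> S y -> anc i (n + y) -> D z <= D y]
  end.

Definition pq D T S : Prop := forall i, 0 < i < 2 * n -> node D T S i.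

Lemma pq_empty D T : (forall i, 0 < i < 2 * n -> T i = 0) -> pq D T pred0.
Proof. by move=> h i /h hi; rewrite /node hi. Qed.

Lemma pq0_tree D T : pq D T pred0 -> forall i, 0 < i < 2 * n -> T i = 0.
Proof. by move=> h i /h; rewrite /node; case: (T i) => // z []. Qed.

Lemma pq_top0 D T S : pq D T S -> 0 < n -> T 1 = 0 -> forall y, y < n -> ~~ S y.
Proof.
move=> h hn h1 y hy; apply/negP => hS.
have : node D T S 1 by apply: h; lia.
by rewrite /node h1 => /(_ y hy hS); apply; apply: anc1; lia.
Qed.

Lemma pq_topS D T S z : pq D T S -> 0 < n -> T 1 = z.+1 ->
  [/\ z < n, S z & forall y, y < n -> S y -> D z <= D y].
Proof.
move=> h hn h1.
have : node D T S 1 by apply: h; lia.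
rewrite /node h1 => [[h2 h3 _ h4]]; split => // y hy hS.
by apply: h4 => //; apply: anc1; lia.
Qed.

(** A new key or membership at [x] matters only on the path from the leaf of [x] to the root. *)
Lemma node_ext D T S D' T' S' i x :
  node D T S i -> T' i = T i -> ~ anc i (n + x) ->
  (forall y, y < n -> y != x -> D' y = D y /\ S' y = S y) ->
  node D' T' S' i.
Proof.
move=> + ht hx hE; rewrite /node ht.
have hne y : anc i (n + y) -> y != x by move=> ha; apply/eqP => e; apply: hx; rewrite -e.
case: (T i) => [|z].
  move=> h y hy hS ha; have [_ eS] := hE _ hy (hne _ ha).
  by apply: (h y) => //; rewrite -eS.
case=> hz hSz haz hmin.
have [eD eS] := hE _ hz (hne _ haz).
split => //; first by rewrite eS.
move=> y hy hSy ha; have [eD' eS'] := hE _ hy (hne _ ha).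
by rewrite eD eD'; apply: hmin => //; rewrite -eS'.
Qed.

(** Written in the arithmetic of the instruction set, so that it is the value of [eWin]: the sum is
    a disjunction, the product a conjunction. Ties go to the left child. *)
Definition winner D l r :=
  if (l == 0) + (0 < r) * (D (r - 1) < D (l - 1)) != 0 then r else l.

Lemma node_winner D T T' S i : 0 < i < n ->
  node D T S (2 * i) -> node D T S (2 * i).+1 ->
  T' i = winner D (T (2 * i)) (T (2 * i).+1) ->
  node D T' S i.
Proof.
move=> hi hl hr hT.
have up1 y : anc (2 * i) (n + y) -> anc i (n + y).
  by move/anc_half; rewrite (_ : 2 * i %/ 2 = i) //; lia.
have up2 y : anc (2 * i).+1 (n + y) -> anc i (n + y).
  by move/anc_half; rewrite (_ : (2 * i).+1 %/ 2 = i) //; lia.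
have dn y : anc i (n + y) -> anc (2 * i) (n + y) \/ anc (2 * i).+1 (n + y).
  by move/anc_child => [|//]; lia.
move: hl hr; rewrite /node hT /winner.
case: (T (2 * i)) => [|l]; case: (T (2 * i).+1) => [|r] //=.
- by move=> h1 h2 y hy hS /dn [/(h1 y hy hS)|/(h2 y hy hS)].
- move=> h1 [h2 h3 h4 h5]; split => //; first exact: up2.
  by move=> y hy hS /dn [/(h1 y hy hS)//|/(h5 y hy hS)].
- move=> [h2 h3 h4 h5] h1; split => //; first exact: up1.
  by move=> y hy hS /dn [/(h5 y hy hS)|/(h1 y hy hS)].
- rewrite !subn1 /= => [[h1 h2 h3 h4] [k1 k2 k3 k4]].
  case: ltnP => hlt /=.
  + split => //; first exact: up2.
    move=> y hy hS /dn [/(h4 y hy hS)|/(k4 y hy hS)] //; lia.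
  + split => //; first exact: up1.
    move=> y hy hS /dn [/(h4 y hy hS)|/(k4 y hy hS)] //; lia.
Qed.

End Tournament.

Notation eAdd := (Bin OpAdd).
Notation eSub := (Bin OpSub).
Notation eMul := (Bin OpMul).
Notation eDiv := (Bin OpDiv).
Notation eMod := (Bin OpMod).
Notation eEq := (Bin OpEq).
Notation eLt := (Bin OpLt).

(** Frame conditions: [l] lists the registers, or the memory fields, that may change. *)
Definition eqR (l : seq nat) (R R' : nat -> nat) := forall r, r \notin l -> R' r = R r.
Definition eqF (l : seq nat) (M M' : nat -> nat) :=
  forall f, f < 16 -> f \notin l -> fld M' f = fld M f.

Lemma eqR_upd l R R' x v : x \in l -> eqR l R R' -> eqR l R (upd R' x v).
Proof.
move=> hx h r hr; rewrite updE; case: eqP => [e|_]; last exact: h.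
by rewrite e hx in hr.
Qed.

Lemma eqR_trans l1 l2 l R1 R2 R3 : eqR l1 R1 R2 -> eqR l2 R2 R3 ->
  all (mem l) l1 -> all (mem l) l2 -> eqR l R1 R3.
Proof.
move=> h1 h2 /allP s1 /allP s2 r hr; rewrite h2; last by apply: contra hr => /s2.
by rewrite h1 //; apply: contra hr => /s1.
Qed.

Lemma eqF_store l M M' f x v : f < 16 -> f \in l -> eqF l M M' ->
  eqF l M (upd M' (x * 16 + f) v).
Proof.
move=> hf hfl h f' hf' hl; rewrite fld_other //; first exact: h.
by apply: contraNneq hl => ->.
Qed.

Lemma eqF_trans l1 l2 l M1 M2 M3 : eqF l1 M1 M2 -> eqF l2 M2 M3 ->
  all (mem l) l1 -> all (mem l) l2 -> eqF l M1 M3.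
Proof.
move=> h1 h2 /allP s1 /allP s2 r h hr; rewrite h2 //; last by apply: contra hr => /s2.
by rewrite h1 //; apply: contra hr => /s1.
Qed.

Lemma cell_neq f g x y : f < 16 -> g < 16 -> f != g -> (x * 16 + f == y * 16 + g) = false.
Proof. lia. Qed.

Ltac flds := repeat first [ rewrite fld_same | rewrite fld_other; [ | done | done | done ] ].

Lemma fldE M f x : M (x * 16 + f) = fld M f x. Proof. by []. Qed.

(* Registers: 0 n, 1 q, 2 journal length J, 3 edge count g, 4 K, 5 log2 K,
   6 start of the journal block, 7 u, 8 v, 9 weight, 19 a, 20 b.
   Fields: 0 distance + 1 (0 for infinity), 1 parent, 2 base distance, 3 head of
   the adjacency list, 4 tournament tree, 5 scratch, 6 target, 7 weight, 8 next,
   9 journal vertex, 10 journal old distance, 11 journal length at each time,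
   12 saved registers. *)
Definition eWin : expr :=
  eAdd (eEq (Reg 13) (Cst 0))
    (eMul (eLt (Cst 0) (Reg 14))
       (eLt (Arr 0 (eSub (Reg 14) (Cst 1))) (Arr 0 (eSub (Reg 13) (Cst 1))))).

Definition pq_climb : cmd :=
  Assign 13 (Arr 4 (eMul (Cst 2) (Reg 12))) ;;
  Assign 14 (Arr 4 (eAdd (eMul (Cst 2) (Reg 12)) (Cst 1))) ;;
  If eWin (SArr 4 (Reg 12) (Reg 14)) (SArr 4 (Reg 12) (Reg 13)) ;;
  Assign 12 (eDiv (Reg 12) (Cst 2)).

(** Serves insertion, decrease of a key and removal alike: register 10 holds the vertex, register 11
    the new content of its leaf. *)
Definition pq_set : cmd :=
  SArr 4 (eAdd (Reg 0) (Reg 10)) (Reg 11) ;;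
  Assign 12 (eDiv (eAdd (Reg 0) (Reg 10)) (Cst 2)) ;;
  While (Reg 12) pq_climb.

Section PqSet.
Variables B H : nat.
Hypothesis H17 : 17 <= H.
Hypothesis HB : H ^ 8 <= B.
Variables n Lam : nat.
Hypothesis hLam : 2 * n <= 2 ^ Lam.
Hypothesis hnH : 2 * n < H.
Local Notation wp := (wp B H).

Ltac asg := apply: (wp_asg H17 HB) => //.
Ltac sto := apply: (wp_store H17 HB) => //.
Ltac sq := apply: wp_seq.
Ltac reg := rewrite /=; repeat (rewrite updE /=).

Lemma pq_climb_spec M R i o D S (Q : post) :
  fld M 0 = D -> 0 < R 12 < n ->
  node n D (fld M 4) S (2 * R 12) -> node n D (fld M 4) S (2 * R 12).+1 ->
  (forall t M' R', t <= 60 -> eqR [:: 12; 13; 14] R R' ->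
     R' 12 = R 12 %/ 2 -> eqF [:: 4] M M' ->
     (forall j, j != R 12 -> fld M' 4 j = fld M 4 j) ->
     node n D (fld M' 4) S (R 12) -> Q t M' R' i o) ->
  wp pq_climb M R i o Q.
Proof.
move=> hD hi nl nr hQ.
sq; asg; first by move=> bM bR; apply: bM.
sq; asg; first by move=> bM bR; apply: bM.
reg; rewrite !fldE addn1.
set l := fld M 4 (2 * R 12); set r := fld M 4 (2 * R 12).+1.
have fin (f : nat -> nat) z : z = winner D l r -> f 4 <= 60 ->
    wp (Assign 12 (eDiv (Reg 12) (Cst 2))) (upd M (R 12 * 16 + 4) z)
      (upd (upd R 13 l) 14 r) i o (fun t' => Q (f t')).
  move=> hz ht; asg; reg.
    by move=> bM bR; apply: leq_ltn_trans (leq_div _ _) _; lia.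
  apply: hQ; rewrite ?updE //.
  - by do !apply: eqR_upd.
  - by apply: eqF_store.
  - by move=> j hj; rewrite fld_same updE (negbTE hj).
  - by apply: (@node_winner n D (fld M 4)) => //; rewrite fld_same updE eqxx.
sq; apply: (wp_if H17 HB) => //=; reg; rewrite !fldE hD => hc.
- sto; first by move=> bM bR; apply: bM.
  by reg; apply: (fin (fun t => _ (_ (_ t)))); rewrite /winner ?hc //=.
- sto; first by move=> bM bR; apply: bM.
  by reg; apply: (fin (fun t => _ (_ (_ t)))); rewrite /winner ?hc //=.
Qed.

Lemma pq_set_spec M R i o D S x (Q : post) :
  fld M 0 = D -> R 0 = n -> R 10 = x -> x < n -> R 11 = (if S x then x.+1 else 0) ->
  (forall j, 0 < j < 2 * n -> ~ anc j (n + x) -> node n D (fld M 4) S j) ->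
  (forall t M' R', t <= 100 * Lam -> eqR [:: 12; 13; 14] R R' -> eqF [:: 4] M M' ->
     pq n D (fld M' 4) S -> Q t M' R' i o) ->
  wp pq_set M R i o Q.
Proof.
move=> hD h0 h10 hx h11 hN hQ.
have hL : 0 < Lam by case: (Lam) hLam => //; lia.
sq; sto; first by move=> bM bR; apply: bR.
sq; asg; reg; first by move=> _ _; rewrite h0 h10; lia.
rewrite h0 h10 h11; set M0 := upd M _ _.
have hleaf j : 0 < j < 2 * n -> ~ anc j ((n + x) %/ 2) -> node n D (fld M0 4) S j.
  move=> hj ha; rewrite /M0 fld_same.
  case: (eqVneq j (n + x)) => [->|hne].
    rewrite /node updE eqxx; case: ifP => hS.
      split => //; first exact: anc_refl.
      by move=> y hy _ /(anc_leaf (leq_addr _ _) hy); have [->|] := eqVneq y x; lia.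
    move=> y hy hSy /(anc_leaf (leq_addr _ _) hy) e.
    by move: hS hSy; rewrite (_ : x = y) ?(addnI e) // => ->.
  have hna : ~ anc j (n + x) by move/anc_split => [e|//]; rewrite e eqxx in hne.
  apply: (@node_ext n D (fld M 4) S D _ S j x) => //; first exact: hN.
  by rewrite updE (negbTE hne).
(* Only the ancestors of the current node [R1 12] may be wrong; its children are larger, hence not
   among them. The node is below [2 ^ k], which limits the climb to [Lam] rounds. *)
pose I k t (M1 R1 : nat -> nat) (i1 o1 : seq nat) := i1 = i /\ o1 = o /\
  (R1 12 < 2 ^ k /\ R1 12 < n /\ t + 62 * k <= 62 * Lam /\
  eqR [:: 12; 13; 14] R R1 /\ eqF [:: 4] M M1 /\
  forall j, 0 < j < 2 * n -> ~ anc j (R1 12) -> node n D (fld M1 4) S j).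
apply: (wp_while H17 HB (I := I) (k0 := Lam)) => //.
- do 2!split => //; rewrite updE /=; split; first by lia.
  split; first by lia.
  do 2!split => //; first exact: eqR_upd.
  by split => //; apply: eqF_store.
- move=> k t M1 R1 i1 o1 [-> [-> [h1 [h2 [h3 [h4 [h5 h6]]]]]]] /= hne.
  have hi : 0 < R1 12 < n by rewrite lt0n hne.
  have hc j : 0 < j < 2 * n -> R1 12 < j -> node n D (fld M1 4) S j.
    by move=> hj hlt; apply: h6 => // /anc_le; lia.
  case: k h1 h3 => [|k] h1 h3; first by lia.
  apply: (pq_climb_spec (D := D) (S := S)) => //.
  - by rewrite h5.
  - by apply: hc; lia.
  - by apply: hc; lia.
  move=> t1 M2 R2 ht1 r1 r12 m1 m2 nn; exists k => //.
  have hk : R2 12 < 2 ^ k by rewrite r12 ltn_divLR // -expnSr.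
  do 2!split => //; split => //; split; first by lia.
  split; first by lia.
  split; first by apply: (eqR_trans h4 r1).
  split; first by apply: (eqF_trans h5 m1).
  move=> j hj ha; case: (eqVneq j (R1 12)) => [-> //|hne2].
  rewrite /node m2 //; apply: h6 => //; rewrite r12 in ha.
  by move/anc_split => [e|//]; rewrite e eqxx in hne2.
- move=> k t M1 R1 i1 o1 [-> [-> [h1 [h2 [h3 [h4 [h5 h6]]]]]]] /= e.
  apply: hQ => //; first by lia.
  by move=> j hj; apply: h6 => //; rewrite e => /anc_le; lia.
Qed.

End PqSet.

(** * Distance estimates and the journal *)

(** Pointers are shifted by one, so that [0], the content of fresh memory, ends a list. *)
Fixpoint chain (nx : nat -> nat) (p : nat) (l : seq nat) : Prop :=
  if l is e :: l' then p = e.+1 /\ chain nx (nx e) l' else p = 0.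

Lemma chain_ext nx nx' p l : (forall e, e \in l -> nx' e = nx e) ->
  chain nx p l -> chain nx' p l.
Proof.
elim: l p => //= e l IH p h [-> hc]; split => //.
rewrite h ?mem_head //; apply: IH hc => e' he'; apply: h.
by rewrite inE he' orbT.
Qed.

(* A block [p, p + len) of the journal may record several changes of the same
   vertex; the first record holds the value before the block. *)
Fixpoint jfirst (jv jo : nat -> nat) (p len d x : nat) : nat :=
  if len is l.+1 then if jv p == x then jo p else jfirst jv jo p.+1 l d x else d.

Lemma jfirst_ext jv jo jv' jo' p len d x :
  (forall i, p <= i < p + len -> jv' i = jv i /\ jo' i = jo i) ->
  jfirst jv' jo' p len d x = jfirst jv jo p len d x.
Proof.
elim: len p => //= len IH p h.
have [-> ->] := h p ltac:(lia); rewrite IH // => i hi; apply: h; lia.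
Qed.

Lemma jfirst_cat jv jo p l1 l2 d x :
  jfirst jv jo p (l1 + l2) d x = jfirst jv jo p l1 (jfirst jv jo (p + l1) l2 d x) x.
Proof.
elim: l1 p => [|l1 IH] p /=; first by rewrite addn0.
by rewrite IH addSnnS.
Qed.

Lemma jfirst_snoc jv jo p l d x :
  jfirst jv jo p l.+1 d x =
  jfirst jv jo p l (if jv (p + l) == x then jo (p + l) else d) x.
Proof. by rewrite -addn1 jfirst_cat. Qed.

Lemma jfirst_notin jv jo p l d x :
  (forall i, p <= i < p + l -> jv i != x) -> jfirst jv jo p l d x = d.
Proof.
elim: l p => //= l IH p h; rewrite (negbTE (h p _)); last by lia.
by apply: IH => i hi; apply: h; lia.
Qed.

Lemma jfirst_in jv jo p l d d' x :
  (exists2 i, p <= i < p + l & jv i = x) ->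
  jfirst jv jo p l d x = jfirst jv jo p l d' x.
Proof.
elim: l p => [|l IH] p /= [i hi e]; first by lia.
case: eqP => // hne; apply: IH; exists i => //.
by case: (eqVneq i p) => [ei|]; [rewrite ei in e | lia].
Qed.

Lemma jfirst_const jv jo p l d x c : (forall i, p <= i < p + l -> jo i = c) ->
  (exists2 i, p <= i < p + l & jv i = x) -> jfirst jv jo p l d x = c.
Proof.
elim: l p => [|l IH] p h [i hi e] /=; first by lia.
case: eqP => hne; first by apply: h; lia.
apply: IH => [j hj|]; first by apply: h; lia.
by exists i => //; case: (eqVneq i p) => [ei|]; [rewrite ei in e | lia].
Qed.

(* An estimate [d] is stored as [d + 1]; [0] stands for infinity. *)
Definition leD e1 e2 := (e2 == 0) || (0 < e1 <= e2).
(** [1 < D] excludes infinity, stored as 0, and the source, stored as 1. A vertex that was infinite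
    and is now finite always counts as dropped. *)
Definition sigb q b D := (1 < D) && ((b == 0) || ((D - 1) * (q + 1) <= (b - 1) * q)).

Lemma leD_refl x : leD x x. Proof. rewrite /leD; lia. Qed.
Lemma leD_trans y x z : leD x y -> leD y z -> leD x z.
Proof. rewrite /leD; lia. Qed.

(** Ensures that a queued vertex stays in the queue when its estimate drops further. *)
Lemma sigb_mono q b D D' : 1 < D' -> leD D' D -> sigb q b D -> sigb q b D'.
Proof.
rewrite /sigb => -> /= h /andP [h1 /orP [->//|h2]]; rewrite orbC.
rewrite (leq_trans _ h2) //; apply: leq_mul => //; move: h; rewrite /leD; lia.
Qed.

(** * Graphs as edge lists, and the invariant of the distance estimates *)

Section Graph.
Variables n s W : nat.
Variable Es : seq (nat * nat * nat).
Definition src e := (nth (0, 0, 0) Es e).1.1.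
Definition dst e := (nth (0, 0, 0) Es e).1.2.
Definition wgt e := (nth (0, 0, 0) Es e).2.
Hypothesis hs : s < n.
Hypothesis hEs : forall e, e < size Es -> [/\ src e < n, dst e < n & 1 <= wgt e <= W].

(** The reversal matches insertion at the front of the linked adjacency lists. *)
Definition out g x := rev [seq e <- iota 0 g | src e == x].

Lemma outS g x : out g.+1 x = if src g == x then g :: out g x else out g x.
Proof.
rewrite /out -addn1 iotaD filter_cat /= add0n.
by case: ifP => _; rewrite ?cats0 // cats1 rev_rcons.
Qed.

Lemma mem_out g x e : (e \in out g x) = (e < g) && (src e == x).
Proof. by rewrite mem_rev mem_filter mem_iota add0n andbC. Qed.

Lemma out_uniq g x : uniq (out g x).
Proof. by rewrite rev_uniq filter_uniq // iota_uniq. Qed.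

Definition adjOK (hd nx : nat -> nat) g := forall x, x < n -> chain nx (hd x) (out g x).

Lemma adjOK_add hd nx g : adjOK hd nx g ->
  adjOK (upd hd (src g) g.+1) (upd nx g (hd (src g))) g.+1.
Proof.
move=> h x hx; rewrite outS updE [src g == x]eq_sym.
have hc : chain (upd nx g (hd (src g))) (hd x) (out g x).
  apply: chain_ext (h x hx) => e; rewrite mem_out => /andP [he _].
  by rewrite updE ltn_eqF.
case: eqP => [e|//] /=; split => //; rewrite updE eqxx.
by move: hc; have -> : hd x = hd (src g) by rewrite e.
Qed.

Definition fin (D : nat -> nat) := \sum_(0 <= x < n) (D x != 0).

(** [d_par] is an inequality because the estimate of a parent may drop later without its children
    being touched. [d_max] bounds the estimates without speaking of paths: each vertex that becomes
    finite raises the bound by [W]. *)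
Record distOK (g : nat) (D par : nat -> nat) : Prop := DistOK {
  d_src : D s = 1;
  d_par : forall x, x < n -> x != s -> D x != 0 ->
    exists e, [/\ e < g, dst e = x, src e = par x, 0 < D (src e) & D (src e) + wgt e <= D x];
  d_max : forall x, x < n -> D x <= 1 + W * (fin D - 1) }.

Lemma fin_gt0 D : D s = 1 -> 0 < fin D.
Proof.
move=> h; rewrite /fin (bigD1_seq s) ?iota_uniq //=; last by rewrite mem_index_iota.
by rewrite h; lia.
Qed.

Lemma fin_le D : fin D <= n.
Proof.
rewrite /fin (leq_trans (n := \sum_(0 <= x < n) 1)) //; last by rewrite sum_nat_const_nat muln1 subn0.
by apply: leq_sum => x _; case: (_ != _).
Qed.

Lemma fin_upd D y c : y < n -> c != 0 -> fin (upd D y c) = fin D + (D y == 0).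
Proof.
move=> hy hc; rewrite /fin !(bigD1_seq y) ?iota_uniq ?mem_index_iota //=.
rewrite updE eqxx hc (eq_bigr (fun x => (D x != 0) : nat)); last first.
  by move=> x hx; rewrite updE (negbTE hx).
case: (D y == 0) => /=; lia.
Qed.

Lemma distOK_bound g D par x : distOK g D par -> x < n -> D x <= 1 + W * (n - 1).
Proof.
move=> [_ _ h] hx; apply: leq_trans (h x hx) _.
by rewrite leq_add2l leq_mul2l leq_sub2r ?fin_le ?orbT.
Qed.

Lemma distOK_le g g' D par : g <= g' -> distOK g D par -> distOK g' D par.
Proof.
move=> hg [h1 h2 h3]; split => // x hx hxs hD.
by have [e [he ? ? ? ?]] := h2 x hx hxs hD; exists e; split => //; lia.
Qed.

Lemma distOK_gt1 g D par x : distOK g D par -> g <= size Es -> x < n -> x != s ->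
  D x != 0 -> 1 < D x.
Proof.
move=> [_ h _] hg hx hxs hD.
have [e [he _ _ h1 h2]] := h x hx hxs hD.
have [_ _ h3] := hEs (leq_trans he hg); lia.
Qed.

(** Weights are positive, so the head of an improving edge is neither the source, whose stored value
    1 is minimal, nor the tail of that edge. *)
Lemma distOK_improve g D par e c : g <= size Es -> distOK g D par ->
  e < g -> 0 < D (src e) -> c = D (src e) + wgt e ->
  (D (dst e) == 0) || (c < D (dst e)) ->
  [/\ dst e != s, distOK g (upd D (dst e) c) (upd par (dst e) (src e))
    & forall x, leD (upd D (dst e) c x) (D x)].
Proof.
move=> hg hD he hsrc hc himp.
have [hsn hdn hw] := hEs (leq_trans he hg).
have hds : dst e != s.
  by apply/eqP => eds; move: himp; rewrite eds (d_src hD); lia.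
have hsd : src e != dst e.
  by apply/eqP => esd; move: himp; rewrite -esd; lia.
split => //; last first.
  move=> x; rewrite updE /leD; case: (x =P dst e) => [->|_]; last lia.
  by move: himp hc hsrc hw; clear; lia.
split.
- by rewrite updE eq_sym (negbTE hds); apply: d_src hD.
- move=> x hx hxs; rewrite updE; case: (x =P dst e) => [-> _|hxd hDx].
    by exists e; rewrite !updE eqxx (negbTE hsd) -hc; split.
  have [e' [h1 h2 h3 h4 h5]] := d_par hD hx hxs hDx.
  exists e'; rewrite !updE (_ : (x == dst e) = false); last by apply/eqP.
  by split => //; case: (src e' =P dst e) => [e1|//]; rewrite e1 in h4 h5; lia.
- move=> x hx; rewrite fin_upd //; last by lia.
  have h1 := d_max hD hsn; have h2 := d_max hD hx.
  have h3 := fin_gt0 (d_src hD).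
  rewrite updE; case: (x =P dst e) => [ex|_].
    case: eqP himp => /= [e0 _|_ hlt].
      rewrite addnK.
      have -> : fin D = (fin D - 1) + 1 by lia.
      by rewrite mulnDr muln1; lia.
    by rewrite addn0 -ex in hlt *; lia.
  apply: leq_trans h2 _; rewrite leq_add2l leq_mul2l leq_sub2r ?orbT //; lia.
Qed.

Definition relaxed (D : nat -> nat) e := 0 < D (dst e) <= D (src e) + wgt e.

End Graph.

(** Rewinds the estimate of [x] to the moment when the journal had length [p]. *)
Definition jr M p J x := jfirst (fld M 9) (fld M 10) p (J - p) (fld M 0 x) x.

(** The change appends a record of the old value, so every earlier state remains readable. *)
Lemma jr_improve M M' J y c p x : p <= J ->
  fld M' 0 = upd (fld M 0) y c ->
  fld M' 9 = upd (fld M 9) J y -> fld M' 10 = upd (fld M 10) J (fld M 0 y) ->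
  jr M' p J.+1 x = jr M p J x.
Proof.
move=> hp h0 h9 h10; rewrite /jr subSn // jfirst_snoc.
rewrite h9 h10 h0 !updE subnKC // eqxx.
rewrite (jfirst_ext (jv := fld M 9) (jo := fld M 10)).
  congr jfirst; rewrite [x == y]eq_sym.
  by case: eqP => // ->.
by move=> i hi; rewrite !updE !ltn_eqF //; lia.
Qed.

Section Dec.
Variables n s W : nat.
Hypothesis hs : s < n.

(* [U] encodes infinity. It exceeds twice any finite estimate, so that becoming
   finite counts as a significant drop. *)
Definition U := 2 * n * W.
Definition dec e := if e == 0 then U else e.-1.

Lemma bound_U e : e <= 1 + W * (n - 1) -> 2 * e.-1 <= U.
Proof.
rewrite /U => h; have : W * (n - 1) + W = W * n by rewrite -mulnSr; congr (_ * _); lia.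
by rewrite -mulnA [n * W]mulnC; lia.
Qed.

Lemma dec_leU e : e <= 1 + W * (n - 1) -> dec e <= U.
Proof. by rewrite /dec => /bound_U; case: eqP => // _; lia. Qed.

Lemma dec_leD e1 e2 : leD e1 e2 -> e1 <= 1 + W * (n - 1) -> dec e1 <= dec e2.
Proof.
rewrite /leD => /orP [/eqP ->|h] hb; first by apply: dec_leU.
by rewrite /dec; case: eqP; case: eqP; lia.
Qed.

Lemma dec0 : dec 0 = U. Proof. by []. Qed.

Lemma dec_pos e : 0 < e -> dec e = e.-1. Proof. by rewrite /dec; case: e. Qed.

Hypothesis hW : 0 < W.

(** The encoded side needs no case for infinity. Coming down from [U] at least halves the value,
    which is as good as a factor [q / (q + 1)] for [q >= 1]; an estimate still equal to [U] fails
    the test because [U] is the maximum. *)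
Lemma sigb_dec q d D : 0 < q -> D != 1 -> D <= 1 + W * (n - 1) -> dec d <= U ->
  sigb q d D = ((q + 1) * dec D <= q * dec d).
Proof.
move=> hq hD1 hDb hd; have hU := bound_U hDb.
have U0 : 0 < U by rewrite /U !muln_gt0 /= hW andbT; lia.
have hqU : q * dec d <= q * U by rewrite leq_mul2l hd orbT.
rewrite /sigb !addn1 mulSn.
case: (posnP D) => [->|hD0]; first by rewrite dec0 /=; lia.
rewrite (dec_pos hD0) (_ : 1 < D = true); last by lia.
move: {hDb} hU; rewrite !subn1; set x := D.-1 => hU.
case: (posnP d) => [->|hd0].
  rewrite dec0 /=; have : q * (2 * x) <= q * U by rewrite leq_mul2l hU orbT.
  have : x <= q * x by rewrite leq_pmull.
  by rewrite mulnCA; lia.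
rewrite (dec_pos hd0) /=.
by rewrite mulnS [x * q]mulnC [_ * q]mulnC.
Qed.

End Dec.

(** * Synchronisation *)

(** The compiled [sigb]: product for conjunction, sum for disjunction, and [x < y + 1] for
    [x <= y]. *)
Definition eSig r : expr :=
  eMul (eLt (Cst 1) (Arr 0 (Reg r)))
    (eAdd (eEq (Arr 2 (Reg r)) (Cst 0))
       (eLt (eMul (eSub (Arr 0 (Reg r)) (Cst 1)) (eAdd (Reg 1) (Cst 1)))
          (eAdd (eMul (eSub (Arr 2 (Reg r)) (Cst 1)) (Reg 1)) (Cst 1)))).

Definition improve : cmd :=
  SArr 9 (Reg 2) (Reg 8) ;;
  SArr 10 (Reg 2) (Arr 0 (Reg 8)) ;;
  Assign 2 (eAdd (Reg 2) (Cst 1)) ;;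
  SArr 0 (Reg 8) (Reg 17) ;;
  SArr 1 (Reg 8) (Reg 7).

Definition pq_push : cmd :=
  If (eSig 10) (Assign 11 (eAdd (Reg 10) (Cst 1)) ;; pq_set) Skip.

Definition eImp : expr :=
  eAdd (eEq (Arr 0 (Reg 8)) (Cst 0)) (eLt (Reg 17) (Arr 0 (Reg 8))).

Definition scan : cmd :=
  Assign 8 (Arr 6 (eSub (Reg 16) (Cst 1))) ;;
  Assign 9 (Arr 7 (eSub (Reg 16) (Cst 1))) ;;
  Assign 16 (Arr 8 (eSub (Reg 16) (Cst 1))) ;;
  Assign 17 (eAdd (Arr 0 (Reg 7)) (Reg 9)) ;;
  If eImp (improve ;; Assign 10 (Reg 8) ;; pq_push) Skip.

Definition pop : cmd :=
  Assign 7 (eSub (Arr 4 (Cst 1)) (Cst 1)) ;;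
  Assign 10 (Reg 7) ;;
  Assign 11 (Cst 0) ;;
  pq_set ;;
  Assign 16 (Arr 3 (Reg 7)) ;;
  While (Reg 16) scan.

(** The journal is read backwards, so the oldest record of a vertex is written last and the base
    array ends with the estimates from before the block. *)
Definition load_base : cmd :=
  Assign 15 (Reg 2) ;;
  While (eLt (Reg 6) (Reg 15))
    (Assign 15 (eSub (Reg 15) (Cst 1)) ;; SArr 2 (Arr 9 (Reg 15)) (Arr 10 (Reg 15))).

Definition fill : cmd :=
  Assign 15 (Reg 6) ;;
  While (eLt (Reg 15) (Reg 2))
    (Assign 10 (Arr 9 (Reg 15)) ;; pq_push ;; Assign 15 (eAdd (Reg 15) (Cst 1))).

Definition store_base : cmd :=
  Assign 15 (Reg 6) ;;
  While (eLt (Reg 15) (Reg 2))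
    (SArr 2 (Arr 9 (Reg 15)) (Arr 0 (Arr 9 (Reg 15))) ;;
     Assign 15 (eAdd (Reg 15) (Cst 1))).

(** Between calls the base array equals the current estimates wherever the block has no record.
    Loading and restoring it therefore touches recorded vertices only, at a cost proportional to the
    block and not to [n]. *)
Definition sync : cmd :=
  load_base ;; fill ;; While (Arr 4 (Cst 1)) pop ;; store_base.

Definition jmem (M : nat -> nat) st r x := x \in [seq fld M 9 k | k <- iota st (r - st)].

Lemma jmemP M st r x : reflect (exists2 k, st <= k < r & fld M 9 k = x) (jmem M st r x).
Proof.
apply: (iffP mapP) => [[k]|[k hk e]].
  by rewrite mem_iota => hk ->; exists k => //; lia.
by exists k => //; rewrite mem_iota; lia.
Qed.

Lemma jmemS M st r x : st <= r -> jmem M st r.+1 x = jmem M st r x || (x == fld M 9 r).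
Proof.
move=> h; rewrite /jmem subSn // -[(r - st).+1]addn1 iotaD map_cat mem_cat /= inE.
by rewrite subnKC.
Qed.

Lemma jmem0 M st x : jmem M st st x = false.
Proof. by rewrite /jmem subnn. Qed.

(** * Correctness and cost of one synchronisation *)

Section Sync.
Variables B H : nat.
Hypothesis H17 : 17 <= H.
Hypothesis HB : H ^ 8 <= B.
Variables n s W Lam : nat.
Hypothesis hs : s < n.
Hypothesis hLam : 2 * n <= 2 ^ Lam.
Hypothesis hnH : 2 * n < H.
Hypothesis hWH : 1 + W * n < H.
Variable Es : seq (nat * nat * nat).
Local Notation src := (src Es).
Local Notation dst := (dst Es).
Local Notation wgt := (wgt Es).
Local Notation out := (out Es).
Local Notation distOK := (distOK n s W Es).
Local Notation relaxed := (relaxed Es).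
Hypothesis hEs : forall e, e < size Es -> [/\ src e < n, dst e < n & 1 <= wgt e <= W].
Local Notation wp := (wp B H).

Ltac asg := apply: (wp_asg H17 HB) => //.
Ltac sto := apply: (wp_store H17 HB) => //.
Ltac sq := apply: wp_seq.
Ltac reg := rewrite /=; repeat (rewrite updE /=).

Lemma Lam_gt0 : 0 < Lam.
Proof. by case: (Lam) hLam => //; lia. Qed.

Lemma val_eSig M R r : (vale M R (eSig r) != 0) = sigb (R 1) (fld M 2 (R r)) (fld M 0 (R r)).
Proof.
rewrite /sigb /= !fldE; case: (1 < _) => //=.
case: (fld M 2 (R r) == 0) => //=.
by rewrite [_ * R 1 + 1]addn1 ltnS; case: (_ <= _).
Qed.

Lemma val_eImp M R : (vale M R eImp != 0) = (fld M 0 (R 8) == 0) || (R 17 < fld M 0 (R 8)).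
Proof. by rewrite /= !fldE; case: (fld M 0 (R 8) == 0); case: (_ < _). Qed.

Lemma improve_spec M R i o (Q : post) : R 2 + 1 < H ->
  (forall t M', t <= 60 ->
     fld M' 0 = upd (fld M 0) (R 8) (R 17) -> fld M' 1 = upd (fld M 1) (R 8) (R 7) ->
     fld M' 9 = upd (fld M 9) (R 2) (R 8) ->
     fld M' 10 = upd (fld M 10) (R 2) (fld M 0 (R 8)) ->
     eqF [:: 0; 1; 9; 10] M M' -> Q t M' (upd R 2 (R 2).+1) i o) ->
  wp improve M R i o Q.
Proof.
move=> hJ hQ.
sq; sto; first by move=> bM bR; apply: bR.
sq; sto; first by move=> bM bR; apply: bM.
sq; asg.
sq; sto; first by move=> bM bR; apply: bR.
sto; first by move=> bM bR; apply: bR.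
reg; rewrite [R 2 + 1]addn1 !fldE cell_neq //.
apply: hQ => //; flds => //.
by do !apply: eqF_store.
Qed.

Definition memG M g :=
  (forall e, e < g -> fld M 6 e = dst e /\ fld M 7 e = wgt e) /\
  adjOK n Es (fld M 3) (fld M 8) g.

(* Invariant of the Dijkstra loop started in memory [M0] with journal length
   [J0]: [X] lists the extracted vertices, [S] is the queue, and [l] lists the
   edges of the vertex being scanned that are not yet relaxed. *)
Record SI (M0 : nat -> nat) (J0 g q : nat) (X : seq nat) (S : pred nat) (l : seq nat)
    (M : nat -> nat) (J : nat) : Prop := mkSI {
  si_fr : eqF [:: 0; 1; 4; 9; 10] M0 M;
  si_dist : distOK g (fld M 0) (fld M 1);
  si_mono : forall x, leD (fld M 0 x) (fld M0 0 x);
  si_pq : pq n (fld M 0) (fld M 4) S;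
  si_sig : forall x, x < n -> sigb q (fld M0 2 x) (fld M 0 x) = S x || (x \in X);
  si_uniq : uniq X;
  si_ltn : forall x, x \in X -> x < n /\ S x = false;
  si_ord : forall x y, x \in X -> y < n -> S y -> fld M 0 x <= fld M 0 y;
  si_rel : forall x e, x \in X -> e < g -> src e = x -> e \notin l -> relaxed (fld M 0) e;
  si_jr : forall p x, p <= J0 -> jr M p J x = jr M0 p J0 x;
  si_jv : forall k, k < J -> fld M 9 k < n;
  si_J : J0 <= J /\ J + size l <= J0 + \sum_(x <- X) size (out g x) }.

(** Double counting: an edge has one tail, which occurs at most once in [X]. *)
Lemma sum_out g X : uniq X -> \sum_(x <- X) size (out g x) <= g.
Proof.
move=> hX.
rewrite (eq_bigr (fun x => \sum_(0 <= e < g) (src e == x))); last first.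
  by move=> x _; rewrite /out size_rev size_filter -sum1_count big_mkcond /= /index_iota subn0.
rewrite exchange_big /= (leq_trans (n := \sum_(0 <= e < g) 1)) //; last first.
  by rewrite sum_nat_const_nat muln1 subn0.
apply: leq_sum => e _.
rewrite (eq_bigr (fun x => if x == src e then 1 else 0)); last first.
  by move=> x _; rewrite eq_sym; case: eqP.
by rewrite -big_mkcond sum1_count count_uniq_mem //; case: (_ \in _).
Qed.

(** Keys of vertices outside the queue are never compared. *)
Lemma pq_ext D T (S : pred nat) D' (S' : pred nat) y : S y = false -> S' y = false ->
  (forall x, x != y -> D' x = D x /\ S' x = S x) -> pq n D T S -> pq n D' T S'.
Proof.
move=> hS hS' hE h j /h; rewrite /node.
have eS x : S' x = S x by case: (eqVneq x y) => [->|/hE []//]; rewrite hS hS'.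
have eD x : S x -> D' x = D x by case: (eqVneq x y) => [->|/hE []//]; rewrite hS.
case: (T j) => [h1 x hx|z [h1 h2 h3 h4]]; first by rewrite eS; apply: h1.
split; rewrite ?eS //.
by move=> x hx; rewrite eS => hx1 hx2; rewrite !eD //; apply: h4.
Qed.

(** An extracted vertex is never improved: its estimate is at most that of the scanned vertex by
    assumption, and weights are positive. Edges already relaxed therefore stay relaxed, as their
    tails are fixed and their heads only decrease. *)
Lemma SI_improve M0 J0 g q X S l M J e c M2 S' : g <= size Es ->
  SI M0 J0 g q X S (e :: l) M J -> e < g -> src e \in X ->
  (forall z, z \in X -> fld M 0 z <= fld M 0 (src e)) ->
  c = fld M 0 (src e) + wgt e ->
  (fld M 0 (dst e) == 0) || (c < fld M 0 (dst e)) ->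
  fld M2 0 = upd (fld M 0) (dst e) c -> fld M2 1 = upd (fld M 1) (dst e) (src e) ->
  fld M2 9 = upd (fld M 9) J (dst e) ->
  fld M2 10 = upd (fld M 10) J (fld M 0 (dst e)) ->
  eqF [:: 0; 1; 4; 9; 10] M M2 ->
  (forall x, S' x = if x == dst e then sigb q (fld M0 2 (dst e)) c else S x) ->
  pq n (fld M2 0) (fld M2 4) S' ->
  [/\ SI M0 J0 g q X S' l M2 J.+1,
      fld M2 0 (src e) = fld M 0 (src e) & forall z, z \in X -> fld M2 0 z = fld M 0 z].
Proof.
move=> hg h he hX hmin hc himp h0 h1 h9 h10 hF hS' hpq.
have [hsn hdn hw] := hEs (leq_trans he hg).
have hsig := si_sig h.
have hpos z : z \in X -> 0 < fld M 0 z.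
  move=> hz; have [hzn hSz] := si_ltn h hz.
  by have := hsig z hzn; rewrite hz orbT /sigb => /andP [hz1 _]; lia.
have [hds hD hle] := distOK_improve hs hEs hg (si_dist h) he (hpos _ hX) hc himp.
have hdX z : z \in X -> (z == dst e) = false.
  move=> hz; apply/eqP => ez; have := hmin z hz; have := hpos z hz.
  by move: himp; rewrite -ez; lia.
have hold z : z \in X -> fld M2 0 z = fld M 0 z.
  by move=> hz; rewrite h0 updE hdX.
split; last exact: hold.
2: exact: hold.
have [hJ0 hJ1] := si_J h.
split.
- exact: (eqF_trans (si_fr h) hF).
- by rewrite h0 h1.
- by move=> x; rewrite h0; apply: leD_trans (hle x) (si_mono h x).
- by [].
- move=> x hx; rewrite hS' h0 updE; case: eqP => [->|_]; last exact: hsig.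
  by case: (boolP (dst e \in X)) => [/hdX|_]; rewrite ?eqxx ?orbF.
- exact: si_uniq h.
- by move=> x hx; have [? ?] := si_ltn h hx; rewrite hS' hdX.
- move=> x y hx hy; rewrite hold // hS' h0 updE.
  case: eqP => _; first by have := hmin x hx; lia.
  by apply: (si_ord h).
- move=> x e' hx he' hse' hl; rewrite /relaxed h0 !updE hse' (hdX x hx).
  case: (eqVneq e' e) => [ee|hne].
    by rewrite -hse' ee eqxx; have := hpos _ hX; lia.
  have := si_rel h hx he' hse'; rewrite inE (negbTE hne) => /(_ hl).
  rewrite /relaxed hse'; case: eqP => // ee.
  by rewrite ee; move: himp; lia.
- move=> p x hp; rewrite -(si_jr h) //; apply: (jr_improve _ _ h0 h9 h10); lia.
- move=> k hk; rewrite h9 updE; case: eqP => // hkJ; apply: (si_jv h); lia.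
- by move: hJ1 => /=; split; lia.
Qed.

(** By [S x -> S' x], a failing test means that [x] was not queued before, so nothing has to be
    removed. *)
Lemma pq_push_spec M R i o q x D0 (S S' : pred nat) (Q : post) :
  R 0 = n -> R 10 = x -> x < n -> R 1 = q -> pq n D0 (fld M 4) S ->
  (forall y, y != x -> fld M 0 y = D0 y /\ S' y = S y) ->
  S' x = sigb q (fld M 2 x) (fld M 0 x) -> (S x -> S' x) ->
  (forall t M' R', t <= 200 * Lam -> eqR [:: 11; 12; 13; 14] R R' -> eqF [:: 4] M M' ->
     pq n (fld M' 0) (fld M' 4) S' -> Q t M' R' i o) ->
  wp pq_push M R i o Q.
Proof.
move=> h0 h10 hx h1 hpq hE hS' hSS hQ.
have hL := Lam_gt0.
apply: (wp_ifb (b := S' x) H17 HB) => // [|hc|hc]; first by rewrite val_eSig h10 h1 -hS'.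
  sq; asg; reg; rewrite h10; first by move=> _ _; lia.
  apply: (pq_set_spec H17 HB hLam hnH (D := fld M 0) (S := S') (x := x)); rewrite ?updE ?hc ?addn1 //.
    move=> j hj ha; apply: (node_ext (hpq j hj) _ ha) => // y _ hy; exact: hE.
  move=> t M' R' ht r1 m1 hp; apply: hQ => //.
  - by lia.
  - by apply: (eqR_trans (l1 := [:: 11]) _ r1) => //; apply: eqR_upd.
  - by rewrite m1.
apply: wp_skip; apply: hQ => //; first by reg; lia.
have hSx : S x = false by apply/negP => /hSS; rewrite (negbTE hc).
by apply: (pq_ext hSx (negbTE hc)) hpq.
Qed.

Definition sregs := [:: 2; 7; 8; 9; 10; 11; 12; 13; 14; 15; 16; 17].

Lemma scan_spec M0 J0 g q X S l M J R i o cur (Q : post) : g <= size Es ->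
  memG M0 g -> SI M0 J0 g q X S l M J -> J0 + g < H ->
  R 0 = n -> R 1 = q -> R 2 = J -> R 7 = cur -> chain (fld M0 8) (R 16) l ->
  (forall e, e \in l -> e < g /\ src e = cur) -> cur \in X ->
  (forall z, z \in X -> fld M 0 z <= fld M 0 cur) ->
  (forall t M' R' S' J', t <= 320 * Lam * (size l).+1 -> eqR sregs R R' -> R' 2 = J' ->
     SI M0 J0 g q X S' [::] M' J' -> Q t M' R' i o) ->
  wp (While (Reg 16) scan) M R i o Q.
Proof.
move=> hg [hE _] hSI hJH h0 h1 h2 h7 hch hl hcur hmin hQ.
have hL := Lam_gt0.
pose I k t (M1 R1 : nat -> nat) (i1 o1 : seq nat) := i1 = i /\ o1 = o /\
  exists l1 S1 J1, [/\ k = size l1, SI M0 J0 g q X S1 l1 M1 J1,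
   [/\ R1 2 = J1, R1 7 = cur, chain (fld M0 8) (R1 16) l1 & eqR sregs R R1],
   [/\ forall e, e \in l1 -> e < g /\ src e = cur &
       forall z, z \in X -> fld M1 0 z <= fld M1 0 cur] &
   t + 320 * Lam * size l1 <= 320 * Lam * size l].
apply: (wp_while H17 HB (I := I) (k0 := size l)) => //.
- by do 2!split => //; exists l, S, J; split => //; split.
- move=> k t M1 R1 i1 o1 [-> [-> [l1 [S1 [J1 [hk hI [r2 r7 hc hr] [hl1 hm1] ht]]]]]] /= hne.
  case: l1 hk hI hc hl1 ht => [|e l1] hk hI /= hc hl1 ht; first by rewrite hc in hne.
  have [r16 hc'] := hc.
  have [heg hesrc] := hl1 e (mem_head _ _).
  have [e6 e7] := hE _ heg.
  have [hsn hdn hw] := hEs (leq_trans heg hg).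
  have f6 : fld M1 6 e = dst e by rewrite (si_fr hI).
  have f7 : fld M1 7 e = wgt e by rewrite (si_fr hI).
  have f8 : fld M1 8 = fld M0 8 by rewrite (si_fr hI).
  have f2 : fld M1 2 = fld M0 2 by rewrite (si_fr hI).
  have hr0 : R1 0 = n by rewrite hr.
  have hr1 : R1 1 = q by rewrite hr.
  have hDb := distOK_bound (si_dist hI) hsn.
  have hWn : W * n = W * (n - 1) + W by rewrite -mulnSr; congr (_ * _); lia.
  (* Each edge leaving an extracted vertex adds at most one record, and extracted vertices are
     distinct, so the journal grows by at most [g]. *)
  have hJlt : J1 + 1 < H.
    have [_ hJ1] := si_J hI; have := sum_out g (si_uniq hI).
    by move: hJ1 => /=; lia.
  sq; asg; first by move=> bM bR; apply: bM.
  sq; asg; first by move=> bM bR; apply: bM.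
  sq; asg; first by move=> bM bR; apply: bM.
  reg; rewrite !r16 !fldE subn1 /= f6 f7 f8.
  sq; asg; reg; rewrite !fldE r7 -hesrc.
    by move=> _ _; lia.
  set c := _ + wgt e.
  set R2 := upd _ 17 c.
  have hlS e' : e' \in l1 -> e' < g /\ src e' = cur.
    by move=> he'; apply: hl1; rewrite inE he' orbT.
  have hlS2 : size l1 < k by rewrite hk.
  have srcX : src e \in X by rewrite hesrc.
  apply: (wp_ifb (b := (fld M1 0 (dst e) == 0) || (c < fld M1 0 (dst e))) H17 HB) => // [|himp|himp].
    by rewrite val_eImp /R2 !updE.
  + sq; apply: (improve_spec) => [|t1 M2 ht1 g0 g1 g9 g10 gF]; first by rewrite /R2 !updE /= r2.
    sq; asg; first by move=> bM bR; apply: bR.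
    move: g0 g1 g9 g10; rewrite /R2 !updE /= r2 r7 => g0 g1 g9 g10.
    pose S2 : pred nat := fun x => if x == dst e then sigb q (fld M0 2 (dst e)) c else S1 x.
    apply: (pq_push_spec (q := q) (x := dst e) (D0 := fld M1 0) (S := S1) (S' := S2)) => //.
    * by rewrite gF //; apply: si_pq hI.
    * by move=> y hy; rewrite g0 updE /S2 (negbTE hy).
    * by rewrite /S2 eqxx gF // f2 g0 updE eqxx.
    (* A queued head was significant before this drop; [sigb_mono] keeps it so, because the new
       value exceeds the estimate of the scanned vertex, which is itself above 1. *)
    * rewrite /S2 eqxx => hS1.
      have := si_sig hI hdn; rewrite hS1 /= => /[dup] hsg.
      apply: sigb_mono; last by rewrite /leD; move: himp; rewrite /c; lia.
      have := si_ord hI srcX hdn hS1.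
      have [hxn hSx] := si_ltn hI srcX.
      have := si_sig hI hxn; rewrite srcX orbT /sigb => /andP [h _].
      by rewrite /c; lia.
    move=> t2 M3 R3 ht2 r3 m3 hpq3.
    have [hI3 hcu3 hX3] : [/\ SI M0 J0 g q X S2 l1 M3 J1.+1,
       fld M3 0 (src e) = fld M1 0 (src e) & forall z, z \in X -> fld M3 0 z = fld M1 0 z].
      apply: (SI_improve hg hI heg srcX _ (erefl c) himp) => //; rewrite ?m3 //.
      - by rewrite hesrc.
      - by rewrite hesrc.
      - by apply: (eqF_trans gF m3).
    exists (size l1) => //; do 2!split => //; exists l1, S2, J1.+1; split => //.
    * rewrite !r3 // !updE /= ?r2 ?r7; split => //.
      apply: (eqR_trans (l1 := sregs) _ r3) => //.
      by rewrite /R2; do !apply: eqR_upd.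
    * by split => // z hz; rewrite !hX3 //; apply: hm1.
    * have -> : 320 * Lam * size l1 = 320 * Lam * (size l1).+1 - 320 * Lam by rewrite mulnSr addnK.
      have : 320 * Lam <= 320 * Lam * (size l1).+1 by rewrite leq_pmulr.
      by move: ht => /=; lia.
  + apply: wp_skip; exists (size l1) => //; do 2!split => //; exists l1, S1, J1; split => //.
    * case: hI => a1 a2 a3 a4 a5 a6 a7 a8 a9 a10 a11 [a12 a13]; split => //.
        move=> x e' hx he' hse' hl'; case: (eqVneq e' e) => [->|hne2].
          by rewrite /relaxed; move: himp; rewrite /c; lia.
        by apply: (a9 x) => //; rewrite inE negb_or hne2.
      by move: a13 => /=; split; lia.
    * rewrite /R2 !updE /= ?r2 ?r7; split => //.
      by do !apply: eqR_upd.
    * have -> : 320 * Lam * size l1 = 320 * Lam * (size l1).+1 - 320 * Lam by rewrite mulnSr addnK.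
      have : 320 * Lam <= 320 * Lam * (size l1).+1 by rewrite leq_pmulr.
      by move: ht => /=; lia.
- move=> k t M1 R1 i1 o1 [-> [-> [l1 [S1 [J1 [hk hI [r2 r7 hc hr] [hl1 hm1] ht]]]]]] /= e0.
  case: l1 hk hI hc hl1 ht => [|e l1] hk hI /= hc hl1 ht; last by move: hc; rewrite e0 => [[]].
  apply: hQ hI => //.
  by rewrite mulnSr; lia.
Qed.

Lemma SI_pop M0 J0 g q X S M J z M2 S' :
  SI M0 J0 g q X S [::] M J -> z < n -> S z ->
  (forall y, y < n -> S y -> fld M 0 z <= fld M 0 y) ->
  S' =1 (fun x => (x != z) && S x) -> eqF [:: 4] M M2 -> pq n (fld M2 0) (fld M2 4) S' ->
  SI M0 J0 g q (z :: X) S' (out g z) M2 J.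
Proof.
move=> h hz hSz hmin hS' hF hpq.
have f0 : fld M2 0 = fld M 0 by rewrite hF.
have f1 : fld M2 1 = fld M 1 by rewrite hF.
have f9 : fld M2 9 = fld M 9 by rewrite hF.
have f10 : fld M2 10 = fld M 10 by rewrite hF.
have hzX : z \notin X by apply/negP => /(si_ltn h) []; rewrite hSz.
case: h => a1 a2 a3 a4 a5 a6 a7 a8 a9 a10 a11 [a12 a13]; split => //.
- by apply: (eqF_trans a1 hF).
- by rewrite f0 f1.
- by move=> x; rewrite f0.
- move=> x hx; rewrite f0 a5 // hS' inE; case: eqP => [->|_] //=.
  by rewrite hSz.
- by rewrite /= hzX.
- move=> x; rewrite inE hS' => /orP [/eqP ->|hx]; first by rewrite eqxx.
  by have [? ->] := a7 x hx; rewrite andbF.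
- move=> x y; rewrite inE f0 hS' => /orP [/eqP ->|hx] hy /andP [_ hSy]; first exact: hmin.
  exact: a8.
- move=> x e; rewrite inE f0 => /orP [/eqP ->|hx] he hse; first by rewrite mem_out he hse eqxx.
  by move=> _; apply: (a9 x).
- by move=> p x hp; rewrite -a10 // /jr f9 f10 f0.
- by move=> k hk; rewrite f9; apply: a11.
- by rewrite big_cons; move: a13 => /=; split; lia.
Qed.

Lemma dijkstra_spec M0 J0 g q S M J R i o (Q : post) : g <= size Es ->
  memG M0 g -> SI M0 J0 g q [::] S [::] M J -> J0 + g < H ->
  R 0 = n -> R 1 = q -> R 2 = J ->
  (forall t M' R' X J' S',
     t <= 600 * Lam * (1 + \sum_(x <- X) (size (out g x)).+1) -> eqR sregs R R' -> R' 2 = J' ->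
     SI M0 J0 g q X S' [::] M' J' -> (forall x, x < n -> S' x = false) -> Q t M' R' i o) ->
  wp (While (Arr 4 (Cst 1)) pop) M R i o Q.
Proof.
move=> hg hG hSI hJH h0 h1 h2 hQ.
have hL := Lam_gt0.
have hn : 0 < n by lia.
pose I k t (M1 R1 : nat -> nat) (i1 o1 : seq nat) := i1 = i /\ o1 = o /\
  exists X S1 J1, [/\ k = n - size X, SI M0 J0 g q X S1 [::] M1 J1,
   R1 2 = J1, eqR sregs R R1 &
   t <= 600 * Lam * \sum_(x <- X) (size (out g x)).+1].
apply: (wp_while H17 HB (I := I) (k0 := n)) => //.
- do 2!split => //; exists [::], S, J; split => //=; first by rewrite subn0.
- move=> k t M1 R1 i1 o1 [-> [-> [X [S1 [J1 [hk hI r2 hr ht]]]]]].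
  rewrite /= fldE => hne.
  case eT: (fld M1 4 1) hne => [//|z] _.
  have [hz hSz hmin] := pq_topS (si_pq hI) hn eT.
  have hzX : z \notin X by apply/negP => /(si_ltn hI) []; rewrite hSz.
  (* Extracted vertices are distinct, so the variant [n - size X] really decreases. *)
  have hsz : size (z :: X) <= n.
    rewrite -(size_iota 0 n); apply: uniq_leq_size.
      by rewrite /= hzX (si_uniq hI).
    move=> x; rewrite inE mem_iota add0n => /orP [/eqP ->|/(si_ltn hI) []] //.
  pose S2 : pred nat := fun x => (x != z) && S1 x.
  sq; asg; reg; rewrite !fldE eT subn1 /=; first by move=> _ _; lia.
  sq; asg; reg; first by move=> _ _; lia.
  sq; asg; first by move=> _ _ /=; lia.
  sq; reg.
  have hr0 : R1 0 = n by rewrite hr.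
  have hr1 : R1 1 = q by rewrite hr.
  apply: (pq_set_spec H17 HB hLam hnH (D := fld M1 0) (S := S2) (x := z)) => //.
    by rewrite /S2 eqxx.
    move=> j hj ha; apply: (node_ext (si_pq hI hj) _ ha) => // y _ hy.
    by rewrite /S2 hy.
  move=> t1 M2 R2 ht1 r12 m12 hpq2.
  have f0 : fld M2 0 = fld M1 0 by rewrite m12.
  have f3 : fld M2 3 = fld M0 3 by rewrite m12 // (si_fr hI).
  have hI2 : SI M0 J0 g q (z :: X) S2 (out g z) M2 J1.
    by apply: (SI_pop hI hz hSz hmin) => //; rewrite f0.
  have s7 : R2 7 = z by rewrite r12.
  sq; asg; first by move=> bM bR; apply: bM.
  rewrite /= fldE s7 f3.
  apply: (scan_spec (M0 := M0) (J0 := J0) (g := g) (q := q) (X := z :: X) (S := S2)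
    (l := out g z) (J := J1) (cur := z)) => //.
  + by rewrite updE /= r12.
  + by rewrite updE /= r12.
  + by rewrite updE /= r12.
  + by rewrite updE /=; case: hG => _; apply.
  + by move=> e; rewrite mem_out => /andP [? /eqP].
  + exact: mem_head.
  + move=> x; rewrite inE f0 => /orP [/eqP -> //|hx].
    by apply: (si_ord hI).
  move=> t2 M3 R3 S3 J3 ht2 r23 r3J hI3.
  exists (n - size (z :: X)); first by rewrite hk /=; move: hsz => /=; lia.
  do 2!split => //; exists (z :: X), S3, J3; split => //.
  + apply: (eqR_trans (l1 := sregs) _ r23) => //; apply: eqR_upd => //.
    by apply: (eqR_trans (l1 := sregs) _ r12) => //; do !apply: eqR_upd.
  + rewrite big_cons mulnDr.
    set A := (size (out g z)).+1 in ht2 *.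
    have hA : Lam <= Lam * A by rewrite leq_pmulr.
    by rewrite -!mulnA in ht2 *; rewrite -mulnA in ht; lia.
- move=> k t M1 R1 i1 o1 [-> [-> [X [S1 [J1 [hk hI r2 hr ht]]]]]].
  rewrite /= fldE => e0.
  apply: (hQ _ _ _ X J1 S1) => //.
  + by rewrite mulnDr /=; lia.
  + move=> x hx; apply/negbTE; exact: (pq_top0 (si_pq hI) hn e0).
Qed.

Lemma load_base_spec M R i o st J (Q : post) :
  R 2 = J -> R 6 = st -> st <= J -> J < H ->
  (forall t M' R', t <= 40 * (1 + (J - st)) -> eqR sregs R R' -> R' 2 = J -> eqF [:: 2] M M' ->
     (forall x, fld M' 2 x = jfirst (fld M 9) (fld M 10) st (J - st) (fld M 2 x) x) ->
     Q t M' R' i o) ->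
  wp load_base M R i o Q.
Proof.
move=> h2 h6 hst hJ hQ.
sq; asg; first by move=> bM bR; apply: bR.
reg; rewrite h2.
pose I k t (M1 R1 : nat -> nat) (i1 o1 : seq nat) := i1 = i /\ o1 = o /\
  [/\ R1 15 = st + k, k <= J - st, eqF [:: 2] M M1 /\ eqR [:: 15] R R1,
   forall x, fld M1 2 x = jfirst (fld M 9) (fld M 10) (st + k) (J - (st + k)) (fld M 2 x) x &
   t + 40 * k <= 40 * (J - st)].
apply: (wp_while H17 HB (I := I) (k0 := J - st)) => //.
- do 2!split => //; split => //; rewrite ?updE /=.
  + by rewrite subnKC.
  + by split => //; apply: eqR_upd.
  + by move=> x; rewrite subnKC // subnn.
- move=> k t M1 R1 i1 o1 [-> [-> [r15 hk [hF hR] hb ht]]].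
  rewrite /= r15 hR // h6 => hne.
  case: k r15 hk hb ht hne => [|k] r15 hk hb ht hne; first by rewrite addn0 ltnn in hne.
  sq; asg; reg; first by move=> _ _; lia.
  rewrite r15 addnS subn1 /=.
  sto; first by move=> bM bR; apply: bM.
  reg; rewrite !fldE !hF //.
  exists k => //; do 2!split => //; split.
  + by rewrite updE.
  + by lia.
  + split; first by apply: eqF_store.
    by apply: eqR_upd.
  + move=> x; rewrite fld_same updE hb.
    have -> : J - (st + k) = (J - (st + k.+1)).+1 by lia.
    by rewrite addnS /= eq_sym.
  + by lia.
- move=> k t M1 R1 i1 o1 [-> [-> [r15 hk [hF hR] hb ht]]].
  rewrite /= r15 hR // h6 => he.
  have k0 : k = 0 by move: he; case: (k) => // k'; rewrite -addSnnS ltn_addr.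
  rewrite k0 addn0 in hb; apply: hQ => //; last by rewrite hR.
  + by lia.
  + by apply: (eqR_trans (l1 := [:: 15]) (l2 := [::]) hR).
Qed.

Lemma fill_spec M R i o st J q (Q : post) :
  R 0 = n -> R 1 = q -> R 2 = J -> R 6 = st -> st <= J -> J < H ->
  (forall k, k < J -> fld M 9 k < n) -> pq n (fld M 0) (fld M 4) pred0 ->
  (forall t M' R', t <= 300 * Lam * (1 + (J - st)) -> eqR sregs R R' -> R' 2 = J ->
     eqF [:: 4] M M' ->
     pq n (fld M 0) (fld M' 4)
       (fun x => sigb q (fld M 2 x) (fld M 0 x) && jmem M st J x) ->
     Q t M' R' i o) ->
  wp fill M R i o Q.
Proof.
move=> h0 h1 h2 h6 hst hJ hjv hpq hQ.
have hL := Lam_gt0.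
sq; asg; first by move=> bM bR; apply: bR.
reg; rewrite h6.
pose S r : pred nat := fun x => sigb q (fld M 2 x) (fld M 0 x) && jmem M st r x.
pose I k t (M1 R1 : nat -> nat) (i1 o1 : seq nat) := i1 = i /\ o1 = o /\
  [/\ R1 15 = J - k, k <= J - st, eqF [:: 4] M M1 /\ eqR [:: 10; 11; 12; 13; 14; 15] R R1,
   pq n (fld M 0) (fld M1 4) (S (J - k)) &
   t + 300 * Lam * k <= 300 * Lam * (J - st)].
apply: (wp_while H17 HB (I := I) (k0 := J - st)) => //.
- do 2!split => //; split => //; rewrite ?updE /=.
  + by rewrite subKn.
  + by split => //; apply: eqR_upd.
  + rewrite subKn //; move=> j /hpq; rewrite /node.
    have eS x : S st x = false by rewrite /S jmem0 andbF.
    by case: (fld M 4 j) => [h x _|z []] //; rewrite eS.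
- move=> k t M1 R1 i1 o1 [-> [-> [r15 hk [hF hR] hp ht]]].
  rewrite /= r15 hR // h2 => hne.
  case: k r15 hk hp ht hne => [|k] r15 hk hp ht hne; first by rewrite subn0 ltnn in hne.
  have hr : J - k.+1 < J by lia.
  have hr' : J - k = (J - k.+1).+1 by lia.
  sq; asg; first by move=> bM bR; apply: bM.
  rewrite /= fldE r15 hF //; set x := fld M 9 _.
  have hx : x < n by apply: hjv.
  sq; apply: (pq_push_spec (q := q) (x := x) (D0 := fld M 0) (S := S (J - k.+1))
    (S' := S (J - k))) => //.
  + by rewrite updE /= hR.
  + by rewrite updE /= hR.
  + move=> y hy; rewrite hF //; split => //.
    by rewrite /S hr' jmemS; [rewrite -/x (negbTE hy) orbF | lia].
  + by rewrite /S hr' jmemS ?eqxx ?orbT ?andbT ?hF //; lia.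
  + by rewrite /S hr' jmemS => [/andP [-> ->]//|]; lia.
  move=> t2 M2 R2 ht2 r12 m12 hp2.
  asg; reg; rewrite r12 // updE /= r15; first by move=> _ _; lia.
  exists k => //; do 2!split => //; split.
  + by rewrite updE /= addn1 hr'.
  + by lia.
  + split; first by apply: (eqF_trans hF m12).
    apply: eqR_upd => //; apply: (eqR_trans (l1 := [:: 10; 11; 12; 13; 14; 15]) _ r12) => //.
    by apply: eqR_upd.
  + by rewrite m12 // hF // in hp2.
  + by rewrite -!mulnA mulnSr in ht *; lia.
- move=> k t M1 R1 i1 o1 [-> [-> [r15 hk [hF hR] hp ht]]].
  rewrite /= r15 hR // h2 => he.
  have k0 : k = 0 by move: he; case: (k) hk => // k' hk'; case: ltnP => //; lia.
  rewrite k0 subn0 in hp; apply: hQ => //; last by rewrite hR.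
  + by rewrite mulnDr; lia.
  + by apply: (eqR_trans (l1 := [:: 10; 11; 12; 13; 14; 15]) (l2 := [::]) hR).
Qed.

Lemma store_base_spec M R i o st J (Q : post) :
  R 2 = J -> R 6 = st -> st <= J -> J < H ->
  (forall t M' R', t <= 40 * (1 + (J - st)) -> eqR sregs R R' -> R' 2 = J -> eqF [:: 2] M M' ->
     (forall x, fld M' 2 x = if jmem M st J x then fld M 0 x else fld M 2 x) ->
     Q t M' R' i o) ->
  wp store_base M R i o Q.
Proof.
move=> h2 h6 hst hJ hQ.
sq; asg; first by move=> bM bR; apply: bR.
reg; rewrite h6.
pose I k t (M1 R1 : nat -> nat) (i1 o1 : seq nat) := i1 = i /\ o1 = o /\
  [/\ R1 15 = J - k, k <= J - st, eqF [:: 2] M M1 /\ eqR [:: 15] R R1,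
   forall x, fld M1 2 x = if jmem M st (J - k) x then fld M 0 x else fld M 2 x &
   t + 40 * k <= 40 * (J - st)].
apply: (wp_while H17 HB (I := I) (k0 := J - st)) => //.
- do 2!split => //; split => //; rewrite ?updE /=.
  + by rewrite subKn.
  + by split => //; apply: eqR_upd.
  + by move=> x; rewrite subKn // jmem0.
- move=> k t M1 R1 i1 o1 [-> [-> [r15 hk [hF hR] hb ht]]].
  rewrite /= r15 hR // h2 => hne.
  case: k r15 hk hb ht hne => [|k] r15 hk hb ht hne; first by rewrite subn0 ltnn in hne.
  have hr' : J - k = (J - k.+1).+1 by lia.
  sq; sto; first by move=> bM bR; apply: bM.
  asg; reg; rewrite r15; first by move=> _ _; lia.
  rewrite !fldE !hF //.
  exists k => //; do 2!split => //; split.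
  + by rewrite updE /= addn1 hr'.
  + by lia.
  + split; first by apply: eqF_store.
    by apply: eqR_upd.
  + move=> x; rewrite fld_same updE hb hr' jmemS; last by lia.
    by case: eqP => [->|_]; rewrite ?orbT ?orbF.
  + by lia.
- move=> k t M1 R1 i1 o1 [-> [-> [r15 hk [hF hR] hb ht]]].
  rewrite /= r15 hR // h2 => he.
  have k0 : k = 0 by move: he; case: (k) hk => // k' hk'; case: ltnP => //; lia.
  rewrite k0 subn0 in hb; apply: hQ => //; last by rewrite hR.
  + by lia.
  + by apply: (eqR_trans (l1 := [:: 15]) (l2 := [::]) hR).
Qed.

Lemma sync_spec g M R i o st J q (Q : post) : g <= size Es -> memG M g ->
  R 0 = n -> R 1 = q -> R 2 = J -> R 6 = st -> st <= J -> J + g < H ->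
  distOK g (fld M 0) (fld M 1) -> pq n (fld M 0) (fld M 4) pred0 ->
  (forall k, k < J -> fld M 9 k < n) ->
  (forall x, x < n -> ~~ jmem M st J x -> fld M 2 x = fld M 0 x) ->
  (forall t M' R' X J',
    t <= 1000 * Lam * (1 + (J' - st) + \sum_(x <- X) (size (out g x)).+1) ->
    eqR sregs R R' -> R' 2 = J' -> eqF [:: 0; 1; 2; 4; 9; 10] M M' ->
    distOK g (fld M' 0) (fld M' 1) -> pq n (fld M' 0) (fld M' 4) pred0 ->
    (forall x, x < n -> fld M' 2 x = fld M' 0 x) ->
    (forall x, leD (fld M' 0 x) (fld M 0 x)) ->
    uniq X -> (forall x, x \in X -> x < n) ->
    (forall x, x < n -> sigb q (jr M st J x) (fld M' 0 x) = (x \in X)) ->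
    (forall x e, x \in X -> e < g -> src e = x -> relaxed (fld M' 0) e) ->
    (forall p x, p <= J -> jr M' p J' x = jr M p J x) ->
    (forall k, k < J' -> fld M' 9 k < n) ->
    J <= J' <= J + \sum_(x <- X) size (out g x) -> Q t M' R' i o) ->
  wp sync M R i o Q.
Proof.
move=> hg hG h0 h1 h2 h6 hst hJH hD hpq hjv hbase hQ.
have hL := Lam_gt0.
have hJ : J < H by lia.
sq; apply: (load_base_spec h2 h6 hst hJ) => t1 M1 R1 ht1 r1 r12 m1 hb1.
have hbj x : x < n -> fld M1 2 x = jr M st J x.
  move=> hx; rewrite hb1 /jr.
  case: (boolP (jmem M st J x)) => hm.
    by apply: jfirst_in; case/jmemP: hm => k hk e; exists k => //; lia.
  have hno k : st <= k < st + (J - st) -> fld M 9 k != x.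
    by move=> hk; apply: contraNneq hm => e; apply/jmemP; exists k => //; lia.
  by rewrite !jfirst_notin // hbase.
have f0 : fld M1 0 = fld M 0 by rewrite m1.
have f9 : fld M1 9 = fld M 9 by rewrite m1.
have f10 : fld M1 10 = fld M 10 by rewrite m1.
sq; apply: (fill_spec (q := q) (st := st) (J := J)) => //.
- by rewrite r1.
- by rewrite r1.
- by rewrite r1.
- by rewrite f9.
- by rewrite f0 m1.
move=> t2 M2 R2 ht2 r2 r22 m2 hp2.
have g0 : fld M2 0 = fld M 0 by rewrite m2.
have g2 : fld M2 2 = fld M1 2 by rewrite m2.
have m02 : eqF [:: 2; 4] M M2 by apply: (eqF_trans m1 m2).
have r02 : eqR sregs R R2 by apply: (eqR_trans r1 r2).
have hG2 : memG M2 g.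
  by case: hG => hE hA; split=> [e he|]; rewrite !m02 //; apply: hE.
have hjr p x : jr M2 p J x = jr M p J x by rewrite /jr !m02.
have hSI : SI M2 J g q [::] (fun x => sigb q (fld M1 2 x) (fld M1 0 x) && jmem M1 st J x)
    [::] M2 J.
  split => //.
  - by rewrite g0 m02.
  - by move=> x; apply: leD_refl.
  - by rewrite g0 -f0.
  (* The queue misses no significant vertex: without a record in the block the estimate equals its
     base, and a positive number is not [q / (q + 1)] times itself. *)
  - move=> x hx; rewrite orbF g0 g2 f0.
    case: (boolP (jmem M1 st J x)) => hm; first by rewrite andbT.
    rewrite andbF hbj // /jr jfirst_notin.
      by rewrite /sigb; case: (fld M 0 x) => [|[|d]] //=; nia.
    move=> k hk; apply: contraNneq hm => e; apply/jmemP; exists k; first by lia.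
    by rewrite f9.
  - by move=> k hk; rewrite m02 //; apply: hjv.
  - by rewrite big_nil addn0.
sq; apply: (dijkstra_spec hg hG2 hSI hJH) => //.
- by rewrite r02.
- by rewrite r02.
move=> t3 M3 R3 X J3 S3 ht3 r3 r32 hI3 hS3.
have [hJ3 hJ3'] := si_J hI3.
have hs3 : J3 < H by have := sum_out g (si_uniq hI3); move: hJ3' => /=; lia.
have m23 := si_fr hI3.
apply: (store_base_spec (st := st) (J := J3)) => //.
- by rewrite r3 // r02.
- by lia.
move=> t4 M4 R4 ht4 r4 r42 m4 hb4.
have k0 : fld M4 0 = fld M3 0 by rewrite m4.
have k9 : fld M4 9 = fld M3 9 by rewrite m4.
have hjr4 p x : p <= J -> jr M4 p J3 x = jr M p J x.
  by move=> hp; rewrite -hjr -(si_jr hI3) // /jr !m4.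
apply: (hQ _ _ _ X J3) => //.
- set A := \sum_(_ <- _) _ in ht3 *.
  rewrite -!mulnA in ht2 ht3 *.
  have e1 : Lam * (1 + (J3 - st) + A) = Lam * (1 + (J3 - st)) + Lam * A by rewrite mulnDr.
  have e2 : Lam * (1 + A) = Lam + Lam * A by rewrite mulnDr muln1.
  have e3 : Lam * (1 + (J - st)) <= Lam * (1 + (J3 - st)) by rewrite leq_mul2l; lia.
  have e4 : 1 + (J3 - st) <= Lam * (1 + (J3 - st)) by rewrite leq_pmull.
  have e5 : Lam <= Lam * (1 + (J3 - st)) by rewrite leq_pmulr.
  by lia.
- by apply: (eqR_trans (eqR_trans r02 r3 _ _) r4).
- apply: (eqF_trans (l1 := [:: 0; 1; 2; 4; 9; 10]) _ m4) => //.
  by apply: (eqF_trans m02 m23).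
- by rewrite !m4 //; apply: si_dist hI3.
- rewrite k0 m4 //.
  move=> j /(si_pq hI3); rewrite /node.
  case: (fld M3 4 j) => [//|z [hz]]; by rewrite hS3.
(* Without a record in the extended block the base was not overwritten, and the rewound value is the
   current one. *)
- move=> x hx; rewrite hb4 k0; case: ifP => // /negbT hm.
  rewrite (m23 2) // g2 hbj // -hjr4 // /jr jfirst_notin ?k0 //.
  move=> k hk; apply: contraNneq hm => e; apply/jmemP; exists k; first by lia.
  by rewrite -k9.
- by move=> x; rewrite k0 -g0; apply: (si_mono hI3).
- exact: si_uniq hI3.
- by move=> x /(si_ltn hI3) [].
- by move=> x hx; rewrite -hbj // -g2 k0 (si_sig hI3) // hS3.
- by move=> x e hx he hse; rewrite k0; apply: (si_rel hI3 hx he hse).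
- by move=> k hk; rewrite k9; apply: (si_jv hI3).
- by move: hJ3' => /=; lia.
Qed.

End Sync.

(** * Insertions *)

(* At time [g] the rebuild period is [2 ^ kf g]; [reb g] tells whether time [g]
   is a rebuild, and [og g] is the last rebuild time. *)
Fixpoint kf g :=
  if g is g'.+1 then (if g == (2 ^ kf g') ^ 2 then (kf g').+1 else kf g') else 1.

Definition reb g := if g is g'.+1 then 2 ^ kf g' %| g else true.

Fixpoint og g := if g is g'.+1 then (if reb g then g else og g') else 0.

Lemma kfS g : kf g.+1 = if g.+1 == (2 ^ kf g) ^ 2 then (kf g).+1 else kf g.
Proof. by []. Qed.

Arguments kf : simpl never.

Lemma kf_gt0 g : 0 < kf g.
Proof. by elim: g => // g IH; rewrite kfS; case: ifP. Qed.

Lemma kf_leS g : kf g <= kf g.+1.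
Proof. by rewrite kfS; case: ifP. Qed.

Lemma kf_mono g h : g <= h -> kf g <= kf h.
Proof.
elim: h => [|h IH]; first by rewrite leqn0 => /eqP ->.
rewrite leq_eqVlt => /predU1P [->//|/IH hle]; exact: leq_trans hle (kf_leS h).
Qed.

(** With [kf_lb], the period lies between [sqrt g] and [2 * sqrt g] for positive [g]. *)
Lemma kf_ub g : g < (2 ^ kf g) ^ 2.
Proof.
elim: g => // g IH; rewrite kfS; case: eqP => [e|ne]; last by lia.
rewrite {1}e ltn_exp2r // ltn_exp2l //.
Qed.

Lemma kf_lb g : (2 ^ kf g) ^ 2 <= 4 * maxn g 1.
Proof.
elim: g => // g IH; rewrite kfS; case: eqP => [e|ne]; last first.
  by apply: leq_trans IH _; rewrite leq_mul2l; lia.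
by rewrite (expnS 2 (kf g)) expnMn -e leq_mul2l; lia.
Qed.

(** The period grows when the time is its square, a multiple of it, and hence at a rebuild. *)
Lemma kf_nonreb g : ~~ reb g.+1 -> kf g.+1 = kf g.
Proof. by rewrite /reb kfS; case: eqP => // ->; rewrite dvdn_exp. Qed.

Lemma og_le g : og g <= g.
Proof. by elim: g => // g IH; rewrite [og _]/=; case: ifP => // _; apply: leqW. Qed.

Lemma og_dvd g : 2 ^ kf g %| og g.
Proof.
elim: g => // g IH; rewrite [og _]/= -/(reb g.+1).
case: ifP => h; last by rewrite kf_nonreb ?h.
rewrite kfS; case: eqP => [->|_]; last by [].
(* The new period divides the square of the old one because [kf] starts at 1, so that
   [kf g + 1 <= 2 * kf g]. *)
rewrite -expnM dvdn_exp2l //; have := kf_gt0 g; lia.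
Qed.

Lemma og_reb g : reb g.+1 -> og g.+1 = g.+1.
Proof. by move=> h; rewrite [og _]/= -/(reb g.+1) h. Qed.

Lemma og_nonreb g : ~~ reb g.+1 -> og g.+1 = og g.
Proof. by move=> h; rewrite [og _]/= -/(reb g.+1) (negbTE h). Qed.

Lemma og_near g : g - og g < 2 ^ kf g.
Proof.
elim: g => [//|g IH]; case: (boolP (reb g.+1)) => h.
  by rewrite og_reb // subnn expn_gt0.
rewrite og_nonreb // kf_nonreb // subSn ?og_le // ltn_neqAle IH andbT.
apply: contra h => /eqP h; rewrite /reb.
have -> : g.+1 = og g + 2 ^ kf g by rewrite -h; have := og_le g; lia.
by rewrite dvdn_addl ?dvdnn ?og_dvd.
Qed.

Arguments og : simpl never.
Arguments reb : simpl never.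

(** The last rebuild time is an earlier multiple of [2 ^ v], so it cannot fall strictly inside the
    block; this is what permits emptying the journal at rebuilds. *)
Lemma lowbit g : ~~ reb g.+1 ->
  let v := logn 2 g.+1 in
  [/\ v < kf g, 2 ^ v %| g.+1, ~~ (2 ^ v.+1 %| g.+1) & og g <= g.+1 - 2 ^ v].
Proof.
move=> h v.
have hv : v < kf g by move: h; rewrite /reb pfactor_dvdn // -ltnNge.
have hd : 2 ^ v %| g.+1 by rewrite pfactor_dvdn.
split => //; first by rewrite pfactor_dvdn // ltnn.
have ho : 2 ^ v %| og g by apply: dvdn_trans (og_dvd g); rewrite dvdn_exp2l // ltnW.
have hlt : og g < g.+1 by rewrite ltnS og_le.
have : 2 ^ v %| g.+1 - og g by rewrite dvdn_sub.
by move/dvdn_leq; rewrite subn_gt0 hlt => /(_ isT); lia.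
Qed.

(** Removing the lowest set bit turns the odd cofactor of [2 ^ v] into an even one. *)
Lemma lowbit_sub g : 2 ^ (logn 2 g.+1).+1 %| g.+1 - 2 ^ logn 2 g.+1.
Proof.
set v := logn 2 g.+1.
have /dvdnP [k hk] : 2 ^ v %| g.+1 by rewrite pfactor_dvdn.
have hodd : odd k.
  apply: contraT; rewrite -dvdn2 => /dvdnP [k' hk'].
  have : 2 ^ v.+1 %| g.+1 by apply/dvdnP; exists k'; rewrite hk hk' expnS mulnA.
  by rewrite pfactor_dvdn // ltnn.
rewrite hk -{2}[2 ^ v]mul1n -mulnBl expnS; apply: dvdn_mul => //.
by rewrite dvdn2 oddB ?hodd //; case: (k) hodd.
Qed.

(** * The insertion procedure *)

Definition set_q : cmd :=
  Assign 17 (eMul (eMul (Cst 2) (Reg 4)) (Reg 5)) ;;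
  Assign 1 (eAdd (eDiv (eMul (Reg 17) (eAdd (Reg 19) (Reg 20))) (Reg 19))
              (eAdd (eMul (Cst 2) (Reg 17)) (Cst 1))).

Definition add_edge : cmd :=
  SArr 6 (Reg 3) (Reg 8) ;;
  SArr 7 (Reg 3) (Reg 9) ;;
  SArr 8 (Reg 3) (Arr 3 (Reg 7)) ;;
  SArr 3 (Reg 7) (eAdd (Reg 3) (Cst 1)) ;;
  Assign 3 (eAdd (Reg 3) (Cst 1)).

Definition relax_new : cmd :=
  Assign 17 (eAdd (Arr 0 (Reg 7)) (Reg 9)) ;;
  If (eMul (eLt (Cst 0) (Arr 0 (Reg 7))) eImp) improve Skip.

Definition incr_sync : cmd :=
  Assign 18 (Cst 1) ;;
  While (eEq (eMod (Reg 3) (eMul (Cst 2) (Reg 18))) (Cst 0))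
    (Assign 18 (eMul (Cst 2) (Reg 18))) ;;
  Assign 6 (Arr 11 (eSub (Reg 3) (Reg 18))) ;;
  sync.

(** Presents a rebuild to [sync] as a block in which every edge target came down from infinity,
    encoded by the old distance 0. Every finite target other than the source then counts as dropped
    and is explored. *)
Definition all_heads : cmd :=
  Assign 2 (Cst 0) ;;
  While (eLt (Reg 2) (Reg 3))
    (SArr 9 (Reg 2) (Arr 6 (Reg 2)) ;; SArr 10 (Reg 2) (Cst 0) ;;
     Assign 2 (eAdd (Reg 2) (Cst 1))).

Definition grow : cmd :=
  Assign 4 (eMul (Cst 2) (Reg 4)) ;; Assign 5 (eAdd (Reg 5) (Cst 1)) ;; set_q.

Definition rebuild : cmd :=
  all_heads ;;
  Assign 6 (Cst 0) ;;
  sync ;;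
  Assign 2 (Cst 0) ;;
  If (eEq (Reg 3) (eMul (Reg 4) (Reg 4))) grow Skip.

Definition insert_core : cmd :=
  add_edge ;; relax_new ;;
  If (eMod (Reg 3) (Reg 4)) incr_sync rebuild ;;
  SArr 11 (Reg 3) (Reg 2).

(** * Invariants and specification of one insertion *)

Section Insert.
Variables B H : nat.
Hypothesis H17 : 17 <= H.
Hypothesis HB : H ^ 8 <= B.
Variables n s W Lam a b : nat.
Hypothesis hs : s < n.
Hypothesis hLam : 2 * n <= 2 ^ Lam.
Hypothesis hnH : 2 * n < H.
Hypothesis hWH : 1 + W * n < H.
Variable Es : seq (nat * nat * nat).
Local Notation src := (src Es).
Local Notation dst := (dst Es).
Local Notation wgt := (wgt Es).
Local Notation out := (out Es).
Local Notation distOK := (distOK n s W Es).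
Local Notation relaxed := (relaxed Es).
Hypothesis hEs : forall e, e < size Es -> [/\ src e < n, dst e < n & 1 <= wgt e <= W].
Hypothesis hJH : 2 * (size Es + 2) ^ 2 < H.
(* [qN k] bounds the exponent in [mixed_bound] for paths with less than [2 ^ k]
   edges newer than the last rebuild. *)
Definition qN k := 2 * 2 ^ k * k.
(** The quotient is [qN k * (1 + 1 / eps)] and brings the stretch below [1 + eps]. The summand
    [2 * qN k + 1] keeps it below 2 for every [eps], which separates reachable vertices from the
    value [U]. *)
Definition qf k := qN k * (a + b) %/ a + (2 * qN k + 1).
Hypothesis hKH : forall g, g <= size Es -> qN (kf g) < H /\ qf (kf g) < H.
Local Notation wp := (wp B H).

Ltac asg := apply: (wp_asg H17 HB) => //.
Ltac sto := apply: (wp_store H17 HB) => //.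
Ltac sq := apply: wp_seq.
Ltac reg := rewrite /=; repeat (rewrite updE /=).

Lemma set_q_spec k M R i o (Q : post) : R 4 = 2 ^ k -> R 5 = k -> R 19 = a -> R 20 = b ->
  qN k < H -> qf k < H ->
  (forall t, t <= 60 -> Q t M (upd (upd R 17 (qN k)) 1 (qf k)) i o) ->
  wp set_q M R i o Q.
Proof.
move=> h4 h5 h19 h20 hN hq hQ.
sq; asg; reg; rewrite h4 h5; first by [].
asg; reg; rewrite h19 h20; first by [].
exact: hQ.
Qed.

Lemma add_edge_spec g M R i o (Q : post) : g < size Es ->
  R 3 = g -> R 7 = src g -> R 8 = dst g -> R 9 = wgt g -> memG n Es M g ->
  (forall t M', t <= 80 -> eqF [:: 3; 6; 7; 8] M M' -> memG n Es M' g.+1 ->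
    Q t M' (upd R 3 g.+1) i o) ->
  wp add_edge M R i o Q.
Proof.
move=> hg h3 h7 h8 h9 [hE hA] hQ.
have hgH : g.+1 < H by move: hJH; rewrite expnS expn1; nia.
sq; sto; first by move=> bM bR; apply: bR.
sq; sto; first by move=> bM bR; apply: bR.
sq; sto; first by move=> bM bR; apply: bM.
sq; sto; first by reg; rewrite h3 addn1.
asg; reg; rewrite h3 [g + 1]addn1; first by [].
rewrite !cell_neq // !fldE h7 h8 h9.
apply: hQ => //; first by do !apply: eqF_store.
split.
  move=> e; flds; rewrite !updE ltnS leq_eqVlt.
  by case: eqP => [->|_] //= he; have [-> ->] := hE e he.
by flds; apply: adjOK_add.
Qed.

Definition imp (M : nat -> nat) u v w :=
  (0 < fld M 0 u) && ((fld M 0 v == 0) || (fld M 0 u + w < fld M 0 v)).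

Lemma relax_new_spec g J M R i o (Q : post) : g <= size Es ->
  R 2 = J -> R 7 < n -> R 9 <= W -> J + 1 < H ->
  distOK g (fld M 0) (fld M 1) ->
  (imp M (R 7) (R 8) (R 9) -> forall t M' R', t <= 150 ->
     fld M' 0 = upd (fld M 0) (R 8) (fld M 0 (R 7) + R 9) ->
     fld M' 1 = upd (fld M 1) (R 8) (R 7) ->
     fld M' 9 = upd (fld M 9) J (R 8) -> fld M' 10 = upd (fld M 10) J (fld M 0 (R 8)) ->
     eqF [:: 0; 1; 9; 10] M M' -> eqR [:: 2; 17] R R' -> R' 2 = J.+1 -> Q t M' R' i o) ->
  (~~ imp M (R 7) (R 8) (R 9) -> forall t R', t <= 150 -> eqR [:: 2; 17] R R' -> R' 2 = J ->
     Q t M R' i o) ->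
  wp relax_new M R i o Q.
Proof.
move=> hg h2 h7 h9 hJ hD hQ1 hQ2.
have hDb := distOK_bound hD h7.
have hWn : W * n = W * (n - 1) + W by rewrite -mulnSr; congr (_ * _); lia.
sq; asg; reg; rewrite !fldE; first by move=> _ _; lia.
apply: (wp_ifb (b := imp M (R 7) (R 8) (R 9)) H17 HB) => // [|hi|hi].
- rewrite /imp /= !fldE; repeat (rewrite updE /=).
  by case: (0 < fld M 0 (R 7)); case: (fld M 0 (R 8) == 0); case: (_ < fld M 0 (R 8)).
- apply: (improve_spec H17 HB) => [|t M' ht]; first by rewrite updE /= h2.
  repeat (rewrite updE /=); rewrite ?fldE h2 => g0 g1 g9 g10 gF.
  apply: (hQ1 hi) => //; first by lia.
  by do !apply: eqR_upd.
- by apply: wp_skip; apply: (hQ2 hi) => //; apply: eqR_upd.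
Qed.

Lemma all_heads_spec g M R i o (Q : post) : R 3 = g -> g + 1 < H ->
  (forall t M' R', t <= 60 * g.+1 -> eqR [:: 2] R R' -> R' 2 = g -> eqF [:: 9; 10] M M' ->
     (forall k, k < g -> fld M' 9 k = fld M 6 k /\ fld M' 10 k = 0) -> Q t M' R' i o) ->
  wp all_heads M R i o Q.
Proof.
move=> h3 hg hQ.
sq; asg; first by move=> _ _ /=; lia.
pose I k t (M1 R1 : nat -> nat) (i1 o1 : seq nat) := i1 = i /\ o1 = o /\
  [/\ R1 2 = g - k, k <= g, eqF [:: 9; 10] M M1 /\ eqR [:: 2] R R1,
   forall j, j < g - k -> fld M1 9 j = fld M 6 j /\ fld M1 10 j = 0 &
   t + 60 * k <= 60 * g].
apply: (wp_while H17 HB (I := I) (k0 := g)) => //.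
- do 2!split => //; split => //; rewrite ?subnn //.
  by split => //; apply: eqR_upd.
- move=> k t M1 R1 i1 o1 [-> [-> [r2 hk [hF hR] hb ht]]].
  rewrite /= r2 hR // h3 => hne.
  case: k r2 hk hb ht hne => [|k] r2 hk hb ht hne; first by rewrite subn0 ltnn in hne.
  have hr' : g - k = (g - k.+1).+1 by lia.
  sq; sto; first by move=> bM bR; apply: bM.
  sq; sto; first by move=> _ _ /=; lia.
  asg; reg; rewrite r2; first by move=> _ _; lia.
  rewrite !fldE hF //.
  exists k => //; do 2!split => //; split.
  + by rewrite updE /= addn1 hr'.
  + by lia.
  + split; first by do !apply: eqF_store.
    by apply: eqR_upd.
  + move=> j; flds; rewrite !updE hr' ltnS leq_eqVlt.
    by case: eqP => [->|_] //=; apply: hb.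
  + by lia.
- move=> k t M1 R1 i1 o1 [-> [-> [r2 hk [hF hR] hb ht]]].
  rewrite /= r2 hR // h3 => he.
  have k0 : k = 0 by move: he; case: (k) hk => // k' hk'; case: ltnP => //; lia.
  rewrite k0 subn0 in hb r2; apply: hQ => //; by lia.
Qed.

Lemma lowbit_spec c M R i o (Q : post) g : R 3 = g.+1 -> 2 ^ logn 2 g.+1 < H ->
  (forall t R', t <= 40 * (logn 2 g.+1).+1 -> eqR [:: 18] R R' -> R' 18 = 2 ^ logn 2 g.+1 ->
     wp c M R' i o (fun t' => Q (t + t'))) ->
  wp (Assign 18 (Cst 1) ;;
      While (eEq (eMod (Reg 3) (eMul (Cst 2) (Reg 18))) (Cst 0))
        (Assign 18 (eMul (Cst 2) (Reg 18))) ;; c) M R i o Q.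
Proof.
set v := logn 2 g.+1 => h3 hv hQ.
sq; asg; first by move=> _ _ /=; lia.
sq.
pose I k t (M1 R1 : nat -> nat) (i1 o1 : seq nat) := i1 = i /\ o1 = o /\ M1 = M /\
  [/\ R1 18 = 2 ^ (v - k), k <= v, eqR [:: 18] R R1 & t + 20 * k <= 20 * v].
have hdiv j : (g.+1 %% (2 * 2 ^ j) == 0) = (j < v).
  by rewrite -expnS -/(dvdn _ _) pfactor_dvdn.
apply: (wp_while H17 HB (I := I) (k0 := v)) => //.
- do 3!split => //; split => //; rewrite ?updE ?subnn //.
  by apply: eqR_upd.
- move=> k t M1 R1 i1 o1 [-> [-> [-> [r18 hk hR ht]]]].
  rewrite /= r18 hR // h3 hdiv => hne.
  have k0 : 0 < k by move: hne; case: ltnP => //; lia.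
  have hk1 : v - k.-1 = (v - k).+1 by lia.
  asg; reg; rewrite r18 -expnS -hk1.
    by move=> _ _; apply: leq_ltn_trans hv; rewrite leq_exp2l //; lia.
  exists k.-1; first by lia.
  do 3!split => //; split.
  + by rewrite updE.
  + by lia.
  + by apply: eqR_upd.
  + by lia.
- move=> k t M1 R1 i1 o1 [-> [-> [-> [r18 hk hR ht]]]].
  rewrite /= r18 hR // h3 hdiv => he.
  have k0 : k = 0 by move: he; case: ltnP => //; lia.
  rewrite k0 subn0 in r18.
  by apply: wp_mono (hQ _ _ _ hR r18) _; [|move=> t' M' R' i' o' _ _; rewrite addnA; apply]; lia.
Qed.

Hypothesis hW : 0 < W.
Hypothesis ha : 0 < a.

Implicit Types (hist : nat -> nat -> nat) (X : nat -> seq nat).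

Local Notation U := (U n W).
Local Notation dec := (dec n W).

(** Work of the explorations at time [t]; the successor pays for extracting the vertex itself. *)
Definition Wk X t := \sum_(x <- X t) (size (out t x)).+1.

(** [i_pos] concerns the times since the last rebuild, whose journal positions are still meaningful.
    Its last clause bounds the records made since time [j] by the work since then, one unit per time
    being the relaxation of the new edge; this pays for reading a block. [i_J] is a crude bound
    against overflow. *)
Record Consistent hist X (M : nat -> nat) (J g : nat) : Prop := mkConsistent {
  i_mem : memG n Es M g;
  i_dist : distOK g (fld M 0) (fld M 1);
  i_pq : pq n (fld M 0) (fld M 4) pred0;
  i_base : forall x, x < n -> fld M 2 x = fld M 0 x;
  i_jv : forall k, k < J -> fld M 9 k < n;
  i_J : J <= g * g.+2;
  i_hist : forall x, x < n -> hist g x = dec (fld M 0 x);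
  i_U : forall j x, j <= g -> x < n -> hist j x <= U;
  i_pos : forall j, og g <= j <= g ->
    [/\ fld M 11 j <= J, forall x, x < n -> hist j x = dec (jr M (fld M 11 j) J x)
      & J <= fld M 11 j + \sum_(j <= t < g) (1 + Wk X t.+1)] }.

Definition dist_at hist g := exists D par, distOK g D par /\ forall x, x < n -> hist g x = dec (D x).

(* [hist g] are the estimates after [g] insertions, with [U] for infinity, and
   [X g] lists the vertices explored at time [g], none at a rebuild. *)
Record Step hist X g : Prop := mkStep {
  s_dist : dist_at hist g.+1;
  s_mono : forall x, x < n -> hist g.+1 x <= hist g x;
  s_new : hist g.+1 (dst g) <= hist g (src g) + wgt g;
  s_uniq : uniq (X g.+1);
  s_inc : ~~ reb g.+1 ->
    let q := qf (kf g) in let j := g.+1 - 2 ^ logn 2 g.+1 in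
    (forall x, x < n -> x != s -> (q + 1) * hist g.+1 x <= q * hist j x ->
       forall e, e < g.+1 -> src e = x -> hist g.+1 (dst e) <= hist g.+1 x + wgt e) /\
    (forall x, x \in X g.+1 -> [/\ x < n, x != s, exists2 e, e < g.+1 & dst e = x
       & (q + 1) * hist g.+1 x <= q * hist j x]);
  s_reb : reb g.+1 -> X g.+1 = [::] /\
    forall e, e < g.+1 -> src e != s -> hist g.+1 (dst e) <= hist g.+1 (src e) + wgt e }.

(** The state after the new edge is relaxed and before synchronisation. [m_base2] serves rebuilds,
    which overwrite the journal that [m_base] refers to. *)
Record Mid (M : nat -> nat) (J : nat) (M1 : nat -> nat) (J1 g : nat) : Prop := mkMid {
  m_mem : memG n Es M1 g.+1;
  m_dist : distOK g.+1 (fld M1 0) (fld M1 1);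
  m_pq : pq n (fld M1 0) (fld M1 4) pred0;
  m_base : forall st x, st <= J -> x < n -> ~~ jmem M1 st J1 x -> fld M1 2 x = fld M1 0 x;
  m_base2 : forall x, x < n -> x != dst g -> fld M1 2 x = fld M1 0 x;
  m_jv : forall k, k < J1 -> fld M1 9 k < n;
  m_J : J <= J1 <= J + 1;
  m_jr : forall p x, p <= J -> jr M1 p J1 x = jr M p J x;
  m_le : forall x, leD (fld M1 0 x) (fld M 0 x);
  m_new : 0 < fld M 0 (src g) -> 0 < fld M1 0 (dst g) <= fld M 0 (src g) + wgt g;
  m_fr : eqF [:: 0; 1; 3; 6; 7; 8; 9; 10] M M1 }.

Lemma pq0_ext D D' T : pq n D T pred0 -> pq n D' T pred0.
Proof. by move=> h; apply: pq_empty; apply: pq0_tree h. Qed.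

Lemma mid_spec c hist X M J g R i o (Q : post) : g < size Es -> Consistent hist X M J g ->
  R 2 = J -> R 3 = g -> R 7 = src g -> R 8 = dst g -> R 9 = wgt g ->
  (forall t M1 R1 J1, t <= 240 -> Mid M J M1 J1 g -> eqR [:: 2; 3; 17] R R1 ->
     R1 2 = J1 -> R1 3 = g.+1 -> wp c M1 R1 i o (fun t' => Q (t + t'))) ->
  wp (add_edge ;; relax_new ;; c) M R i o Q.
Proof.
move=> hg hI r2 r3 r7 r8 r9 hQ.
have [hsn hdn hw] := hEs hg.
have hJ : J + 2 < H by have := i_J hI; move: hJH; rewrite expnS expn1; nia.
sq; apply: (add_edge_spec hg r3 r7 r8 r9 (i_mem hI)) => t1 M1 ht1 m1 hG1.
have f0 : fld M1 0 = fld M 0 by rewrite m1.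
have f1 : fld M1 1 = fld M 1 by rewrite m1.
have f9 : fld M1 9 = fld M 9 by rewrite m1.
have f10 : fld M1 10 = fld M 10 by rewrite m1.
have hD1 : distOK g.+1 (fld M1 0) (fld M1 1).
  by rewrite f0 f1; apply: distOK_le (i_dist hI).
sq; apply: (relax_new_spec (g := g.+1) (J := J)) => //; rewrite ?updE /= ?r7 ?r8 ?r9 //.
- by case/andP: hw.
- by lia.
- move=> hi t2 M2 R2 ht2 g0 g1 g9 g10 m2 r22 r2J.
  have [hsrc himp] := andP hi.
  have [hds hD2 hle] := distOK_improve hs hEs hg hD1 (ltnSn g) hsrc (erefl _) himp.
  apply: (wp_mono (hQ (t1 + t2) M2 R2 J.+1 _ _ _ r2J _)) => //.
  + by lia.
  + split.
    * by case: hG1 => hE hA; split=> [e he|]; rewrite !m2 //; apply: hE.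
    * by rewrite g0 g1.
    * by rewrite (m2 4) // (m1 4) //; apply: pq0_ext (i_pq hI).
    * move=> st x hst hx hm; rewrite (m2 2) // (m1 2) // g0 updE.
      case: eqP => [ex|_]; last by rewrite (i_base hI) // f0.
      case/negP: hm; apply/jmemP; exists J; first by lia.
      by rewrite g9 updE eqxx.
    * by move=> x hx hne; rewrite (m2 2) // (m1 2) // g0 updE (negbTE hne) (i_base hI) // f0.
    * move=> k hk; rewrite g9 updE; case: eqP => // hkJ.
      by rewrite f9; apply: (i_jv hI); lia.
    * by lia.
    * move=> p x hp; rewrite (jr_improve (M := M1) _ hp g0 g9 g10).
      by rewrite /jr f9 f10 f0.
    * by move=> x; rewrite g0 -f0.
    * by rewrite g0 updE eqxx f0; lia.
    * by apply: (eqF_trans m1 m2).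
  + by apply: (eqR_trans (l1 := [:: 3]) _ r22) => //; apply: eqR_upd.
  + by rewrite r22.
  + by move=> t' M' R' i' o' _ _; rewrite -addnA.
- move=> hi t2 R2 ht2 r22 r2J.
  apply: (wp_mono (hQ (t1 + t2) M1 R2 J _ _ _ r2J _)) => //.
  + by lia.
  + split => //.
    * by rewrite f0 (m1 4) //; apply: (i_pq hI).
    * by move=> st x _ hx _; rewrite m1 // f0 (i_base hI).
    * by move=> x hx _; rewrite m1 // f0 (i_base hI).
    * by move=> k hk; rewrite f9; apply: (i_jv hI).
    * by lia.
    * by move=> p x hp; rewrite /jr f9 f10 f0.
    * by move=> x; rewrite f0; apply: leD_refl.
    * by move: hi; rewrite /imp f0 negb_and; lia.
    * by apply: (eqF_trans m1 (l2 := [::])).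
  + by apply: (eqR_trans (l1 := [:: 3]) _ r22) => //; apply: eqR_upd.
  + by rewrite r22.
  + by move=> t' M' R' i' o' _ _; rewrite -addnA.
Qed.

Record SP g q st J M M' Xn J' : Prop := mkSP {
  p_fr : eqF [:: 0; 1; 2; 4; 9; 10] M M';
  p_dist : distOK g (fld M' 0) (fld M' 1);
  p_pq : pq n (fld M' 0) (fld M' 4) pred0;
  p_base : forall x, x < n -> fld M' 2 x = fld M' 0 x;
  p_le : forall x, leD (fld M' 0 x) (fld M 0 x);
  p_uniq : uniq Xn;
  p_ltn : forall x, x \in Xn -> x < n;
  p_sig : forall x, x < n -> sigb q (jr M st J x) (fld M' 0 x) = (x \in Xn);
  p_rel : forall x e, x \in Xn -> e < g -> src e = x -> relaxed (fld M' 0) e;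
  p_jr : forall p x, p <= J -> jr M' p J' x = jr M p J x;
  p_jv : forall k, k < J' -> fld M' 9 k < n;
  p_J : J <= J' <= J + \sum_(x <- Xn) size (out g x) }.

Definition updh (T : Type) (f : nat -> T) g v := fun j => if j == g then v else f j.

Lemma dec_relaxed g D par e : distOK g D par -> e < size Es -> relaxed D e ->
  dec (D (dst e)) <= dec (D (src e)) + wgt e.
Proof.
move=> hD he /andP [h1 h2].
have [hsn hdn hw] := hEs he.
have hb := dec_leU hs (distOK_bound hD hdn).
rewrite (dec_pos n W h1) in hb *.
by rewrite /dec; case: eqP h2 => [->|_]; lia.
Qed.

Lemma qf_gt0 k : 0 < qf k.
Proof. by rewrite /qf addnA addn1. Qed.

Lemma Wk_upd X g Xn t : Wk (updh X g Xn) t =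
  if t == g then \sum_(x <- Xn) (size (out g x)).+1 else Wk X t.
Proof. by rewrite /Wk /updh; case: eqP => // ->. Qed.

Lemma sum_size_leS (Xn : seq nat) g : \sum_(x <- Xn) size (out g x) <= \sum_(x <- Xn) (size (out g x)).+1.
Proof. exact: leq_sum. Qed.

Lemma og_ltS g j : og g.+1 <= j <= g.+1 -> ~~ reb g.+1 -> j != g.+1 -> og g <= j <= g.
Proof. by move=> h /og_nonreb e hne; rewrite e in h; lia. Qed.

Lemma incr_step hist X M J M1 J1 g M' Xn J' M2 : g < size Es ->
  Consistent hist X M J g -> Mid M J M1 J1 g -> ~~ reb g.+1 ->
  SP g.+1 (qf (kf g)) (fld M 11 (g.+1 - 2 ^ logn 2 g.+1)) J1 M1 M' Xn J' ->
  eqF [:: 11] M' M2 -> fld M2 11 = upd (fld M' 11) g.+1 J' ->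
  let hist' := updh hist g.+1 (fun x => dec (fld M' 0 x)) in
  let X' := updh X g.+1 Xn in
  Consistent hist' X' M2 J' g.+1 /\ Step hist' X' g.
Proof.
move=> hg hI hM hr hP m2 m11 hist' X'.
have [hsn hdn hw] := hEs hg.
have [hv hvd hvn hog] := lowbit hr.
have hj0 : 0 < 2 ^ logn 2 g.+1 by rewrite expn_gt0.
set v := logn 2 g.+1 in hP hv hvd hvn hog hj0 *; set j0 := g.+1 - 2 ^ v in hP hog *.
have hj0g : j0 <= g by rewrite /j0; lia.
have hbd x : x < n -> fld M' 0 x <= 1 + W * (n - 1) := distOK_bound (p_dist hP).
have f0 : fld M2 0 = fld M' 0 by rewrite m2.
have f1 : fld M2 1 = fld M' 1 by rewrite m2.
have f9 : fld M2 9 = fld M' 9 by rewrite m2.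
have f10 : fld M2 10 = fld M' 10 by rewrite m2.
have f11 : fld M' 11 = fld M 11 by rewrite (p_fr hP) // (m_fr hM).
have hh j : j <= g -> hist' j = hist j by move=> hj; rewrite /hist' /updh ltn_eqF.
have hhg : hist' g.+1 = (fun x => dec (fld M' 0 x)) by rewrite /hist' /updh eqxx.
have hXg : X' g.+1 = Xn by rewrite /X' /updh eqxx.
have hJ1 := m_J hM; have hJ' := p_J hP.
have hjr p x : p <= J -> jr M2 p J' x = jr M p J x.
  move=> hp; rewrite -(m_jr hM) // -(p_jr hP); last by lia.
  by rewrite /jr f0 f9 f10.
have hpos0 := i_pos hI (j := j0); rewrite hog hj0g /= in hpos0.
have {hpos0} [hp1 hp2 _] := hpos0 isT.
(* The test made by the program, expressed in [hist]: rewinding to the journal position of time [j0]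
   yields [hist j0]. *)
have hsig x : x < n -> x != s ->
    ((qf (kf g) + 1) * hist' g.+1 x <= qf (kf g) * hist' j0 x) = (x \in Xn).
  move=> hx hxs; rewrite -(p_sig hP) // (sigb_dec hs hW (qf_gt0 _)); last first.
  - by rewrite (m_jr hM) // -hp2 //; apply: (i_U hI).
  - exact: hbd.
  - case: (posnP (fld M' 0 x)) => [->//|h].
    by have := distOK_gt1 hs hEs (p_dist hP) hg hx hxs; case: eqP => [->|_]; lia.
  by rewrite hhg hh // hp2 // (m_jr hM).
have hXs : s \notin Xn.
  by rewrite -(p_sig hP) // /sigb (d_src (p_dist hP)).
split.
- split.
  + case: (m_mem hM) => hE hA; split=> [e he|].
      by rewrite !m2 // !(p_fr hP) //; apply: hE.
    by rewrite !m2 // !(p_fr hP).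
  + by rewrite f0 f1; apply: (p_dist hP).
  + by rewrite f0 m2 //; apply: (p_pq hP).
  + by move=> x hx; rewrite f0 m2 //; apply: (p_base hP).
  + by move=> k hk; rewrite f9; apply: (p_jv hP).
  + have := sum_out Es g.+1 (p_uniq hP); have := i_J hI; nia.
  + by move=> x hx; rewrite hhg f0.
  + move=> j x; rewrite leq_eqVlt => /predU1P [->|hj] hx.
      by rewrite hhg; apply: (dec_leU hs); apply: hbd.
    by rewrite hh //; apply: (i_U hI).
  + move=> j hj; rewrite m11 updE.
    case: (eqVneq j g.+1) => [->|hne].
      split => //; last by rewrite big_geq ?addn0.
      by move=> x hx; rewrite hhg /jr subnn /= f0.
    have hj' := og_ltS hj hr hne.
    have [h1 h2 h3] := i_pos hI hj'; rewrite f11.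
    split; first by lia.
      by move=> x hx; rewrite hjr // hh ?h2 //; lia.
    rewrite big_nat_recr /=; last by lia.
    rewrite (eq_big_nat _ _ (F2 := fun t => 1 + Wk X t.+1)); last first.
      by move=> t ht; rewrite Wk_upd eqSS ltn_eqF //; lia.
    rewrite Wk_upd eqxx; have := sum_size_leS Xn g.+1.
    set A := \sum_(x <- Xn) _ in hJ' *; set B' := \sum_(x <- Xn) _; set C' := \sum_(j <= t < g) _ in h3 *.
    by lia.
- split.
  + by exists (fld M' 0), (fld M' 1); split; [apply: (p_dist hP) | move=> x hx; rewrite hhg].
  + move=> x hx; rewrite hhg hh // (i_hist hI) //; apply: (dec_leD hs); last exact: hbd.
    exact: leD_trans (p_le hP x) (m_le hM x).
  + rewrite hhg hh // (i_hist hI) //.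
    have le1 := dec_leD hs (p_le hP (dst g)) (hbd _ hdn).
    have bU := dec_leU hs (hbd _ hdn).
    case: (posnP (fld M 0 (src g))) => [->|h0]; first by rewrite dec0; lia.
    have h := m_new hM h0.
    by rewrite (dec_pos n W h0); move: le1; rewrite (@dec_pos n W (fld M1 0 (dst g))); lia.
  + by rewrite hXg; apply: (p_uniq hP).
  + move=> _ q j; split.
      move=> x hx hxs; rewrite hsig // => hxX e he hse.
      rewrite hhg -hse; apply: dec_relaxed (p_dist hP) _ _; first by lia.
      exact: (p_rel hP hxX he).
    move=> x; rewrite hXg => hxX.
    have hx := p_ltn hP hxX.
    have hxs : x != s by apply: contraNneq hXs => <-.
    split => //; last by rewrite hsig.
    have hD0 : fld M' 0 x != 0.
      by have := p_sig hP hx; rewrite hxX /sigb => /andP [h _]; lia.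
    by have [e [he1 he2 _ _ _]] := d_par (p_dist hP) hx hxs hD0; exists e.
  + by move=> h; rewrite h in hr.
Qed.

Lemma mem_dsts g x : x \in [seq dst e | e <- iota 0 g] <-> exists2 e, e < g & dst e = x.
Proof.
split => [/mapP [e he ->]|[e he <-]].
  by exists e => //; move: he; rewrite mem_iota.
by apply: map_f; rewrite mem_iota.
Qed.

(** The explorations of a rebuild need not follow a drop, so [X'] omits them and the last conclusion
    bounds them directly: each explored vertex is the target of an edge, hence there are at most
    [g.+1]. *)
Lemma reb_step hist X M J M1 J1 g q M2 M' Xn J' M3 : g < size Es ->
  Consistent hist X M J g -> Mid M J M1 J1 g -> reb g.+1 ->
  eqF [:: 9; 10] M1 M2 ->
  (forall k, k < g.+1 -> fld M2 9 k = fld M1 6 k /\ fld M2 10 k = 0) ->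
  SP g.+1 q 0 g.+1 M2 M' Xn J' ->
  eqF [:: 11] M' M3 -> fld M3 11 = upd (fld M' 11) g.+1 0 ->
  let hist' := updh hist g.+1 (fun x => dec (fld M' 0 x)) in
  let X' := updh X g.+1 [::] in
  [/\ Consistent hist' X' M3 0 g.+1, Step hist' X' g &
      J' + \sum_(x <- Xn) (size (out g.+1 x)).+1 <= 4 * g.+1].
Proof.
move=> hg hI hM hr m2 hj2 hP m3 m11 hist' X'.
have [hsn hdn hw] := hEs hg.
have hbd x : x < n -> fld M' 0 x <= 1 + W * (n - 1) := distOK_bound (p_dist hP).
have f0 : fld M3 0 = fld M' 0 by rewrite m3.
have f1 : fld M3 1 = fld M' 1 by rewrite m3.
have hh j : j <= g -> hist' j = hist j by move=> hj; rewrite /hist' /updh ltn_eqF.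
have hhg : hist' g.+1 = (fun x => dec (fld M' 0 x)) by rewrite /hist' /updh eqxx.
have hXg : X' g.+1 = [::] by rewrite /X' /updh eqxx.
have hJ' := p_J hP.
have hle x : leD (fld M' 0 x) (fld M1 0 x).
  by have := p_le hP x; rewrite (m2 0).
have [hE hA] := m_mem hM.
have hXd x : x \in Xn -> x \in [seq dst e | e <- iota 0 g.+1].
  move=> hx; have hxn := p_ltn hP hx.
  have := p_sig hP hxn; rewrite hx /sigb => /andP [hgt _].
  have hxs : x != s by apply/eqP => e; move: hgt; rewrite e (d_src (p_dist hP)).
  have hD0 : fld M' 0 x != 0 by lia.
  have [e [he1 he2 _ _ _]] := d_par (p_dist hP) hxn hxs hD0.
  by apply/mem_dsts; exists e.
split.
- split.
  + split=> [e he|]; first by rewrite !m3 // !(p_fr hP) // !m2 //; apply: hE.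
    by rewrite !m3 // !(p_fr hP) // !m2.
  + by rewrite f0 f1; apply: (p_dist hP).
  + by rewrite f0 m3 //; apply: (p_pq hP).
  + by move=> x hx; rewrite f0 m3 //; apply: (p_base hP).
  + by [].
  + by [].
  + by move=> x hx; rewrite hhg f0.
  + move=> j x; rewrite leq_eqVlt => /predU1P [->|hj] hx.
      by rewrite hhg; apply: (dec_leU hs); apply: hbd.
    by rewrite hh //; apply: (i_U hI).
  + move=> j; rewrite og_reb // => hj.
    have -> : j = g.+1 by lia.
    rewrite m11 updE eqxx; split => //.
    by move=> x hx; rewrite hhg /jr subnn /= f0.
- split.
  + by exists (fld M' 0), (fld M' 1); split; [apply: (p_dist hP) | move=> x hx; rewrite hhg].
  + move=> x hx; rewrite hhg hh // (i_hist hI) //; apply: (dec_leD hs); last exact: hbd.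
    exact: leD_trans (hle x) (m_le hM x).
  + rewrite hhg hh // (i_hist hI) //.
    have le1 := dec_leD hs (hle (dst g)) (hbd _ hdn).
    have bU := dec_leU hs (hbd _ hdn).
    case: (posnP (fld M 0 (src g))) => [->|h0]; first by rewrite dec0; lia.
    have h := m_new hM h0.
    by rewrite (dec_pos n W h0); move: le1; rewrite (@dec_pos n W (fld M1 0 (dst g))); lia.
  + by rewrite hXg.
  + by rewrite hr.
  + move=> _; split => // e he hse; rewrite hhg.
    have heE : e < size Es by lia.
    have [hsn' hdn' hw'] := hEs heE.
    case: (posnP (fld M' 0 (src e))) => [->|h0].
      by rewrite dec0; have := dec_leU hs (hbd _ hdn'); lia.
    apply: dec_relaxed (p_dist hP) heE _.
    have hgt := distOK_gt1 hs hEs (p_dist hP) hg hsn' hse.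
    rewrite -lt0n in hgt; have {}hgt := hgt h0.
    have [e' [he1 he2 _ _ _]] := d_par (p_dist hP) hsn' hse (lt0n_neq0 h0).
    apply: (p_rel hP (x := src e)) => //.
    (* The tail of [e] is finite and not the source, so some edge enters it; the artificial record
       of that edge rewinds it to infinity, and the test succeeds. *)
    rewrite -(p_sig hP) // /sigb hgt /jr (@jfirst_const _ _ _ _ _ _ 0) //.
      by move=> i hi; have [_ ->] := hj2 i ltac:(lia).
    exists e'; first by lia.
    by have [-> _] := hj2 e' he1; have [-> _] := hE _ he1.
- have h1 : size Xn <= g.+1.
    rewrite -[X in _ <= X](size_iota 0) -(size_map dst).
    by apply: uniq_leq_size (p_uniq hP) _ => x; apply: hXd.
  have h2 := sum_out Es g.+1 (p_uniq hP).
  have -> : \sum_(x <- Xn) (size (out g.+1 x)).+1 = \sum_(x <- Xn) size (out g.+1 x) + size Xn.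
    rewrite -[size Xn]mul1n -sum1_size big_distrr /= -big_split /=.
    by apply: eq_bigr => x _; rewrite muln1 addn1.
  by lia.
Qed.

(** Cost of an insertion up to the factor [Lam + kf g]. A rebuild handles all edges; otherwise the
    records of the block are read, and these are bounded by the work of its times. *)
Definition cost_at X g :=
  if reb g.+1 then g.+2
  else \sum_(g.+1 - 2 ^ logn 2 g.+1 <= t < g.+1) (1 + Wk X t.+1).

Definition iregs := [:: 1; 3; 4; 5; 6; 18] ++ sregs.

Lemma insert_core_spec hist X M J g R i o (Q : post) : g < size Es ->
  Consistent hist X M J g ->
  R 0 = n -> R 1 = qf (kf g) -> R 2 = J -> R 3 = g -> R 4 = 2 ^ kf g -> R 5 = kf g ->
  R 7 = src g -> R 8 = dst g -> R 9 = wgt g -> R 19 = a -> R 20 = b ->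
  (forall t M' R' J' d Xn,
     let hist' := updh hist g.+1 d in let X' := updh X g.+1 Xn in
     t <= (60 * 100) * (Lam + kf g) * cost_at X' g ->
     Consistent hist' X' M' J' g.+1 -> Step hist' X' g ->
     R' 1 = qf (kf g.+1) -> R' 2 = J' -> R' 3 = g.+1 -> R' 4 = 2 ^ kf g.+1 ->
     R' 5 = kf g.+1 -> eqR iregs R R' ->
     eqF [:: 0; 1; 2; 3; 4; 6; 7; 8; 9; 10; 11] M M' -> Q t M' R' i o) ->
  wp insert_core M R i o Q.
Proof.
move=> hg hI r0 r1 r2 r3 r4 r5 r7 r8 r9 r19 r20 hQ.
have hL : 0 < Lam by case: (Lam) hLam => //; lia.
have [hsn hdn hw] := hEs hg.
have hS : forall x, x <= size Es -> x * x.+2 + 3 * x + 5 < H.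
  by move: hJH; rewrite expnS expn1 => hH x hx; nia.
have hgS := hS _ hg.
have hJb := i_J hI.
apply: (mid_spec hg hI) => // t1 M1 R1 J1 ht1 hM r11 r12 r13.
have hJ1 := m_J hM.
have hD1 : distOK g.+1 (fld M1 0) (fld M1 1) := m_dist hM.
have hb : (vale M1 R1 (eMod (Reg 3) (Reg 4)) != 0) = ~~ reb g.+1.
  by rewrite /= r13 r11 // r4.
sq; apply: (wp_ifb H17 HB _ hb) => // hr.
- have [hv hvd hvn hog] := lowbit hr.
  have hvH : 2 ^ logn 2 g.+1 <= g.+1 by apply: dvdn_leq.
  apply: (lowbit_spec (g := g)) => //; first by apply: leq_ltn_trans hvH _; lia.
  move=> t2 R2 ht2 r21 r218.
  sq; asg; first by move=> bM bR; apply: bM.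
  rewrite /= fldE r218 r21 // r13.
  set j0 := g.+1 - _; set st := fld M1 11 j0.
  have hj0 : og g <= j0 <= g.
    have hpw : 0 < 2 ^ logn 2 g.+1 by rewrite expn_gt0.
    by rewrite hog /j0; lia.
  have [hp1 hp2 hp3] := i_pos hI hj0.
  have est : st = fld M 11 j0 by rewrite /st (m_fr hM).
  apply: (sync_spec H17 HB hs hLam hnH hWH hEs (g := g.+1) (st := st) (J := J1) (q := qf (kf g))) => //.
  + exact: (m_mem hM).
  + by rewrite updE /= r21 // r11.
  + by rewrite updE /= r21 // r11.
  + by rewrite updE /= r21.
  + by rewrite est; lia.
  + by lia.
  + exact: (m_pq hM).
  + exact: (m_jv hM).
  + by move=> x hx hm; apply: (m_base hM) hm => //; rewrite est.
  move=> t3 M3 R3 Xn J3 ht3 r33 r32 m3 q1 q2 q3 q4 q5 q6 q7 q8 q9 q10 q11.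
  have hP : SP g.+1 (qf (kf g)) (fld M 11 j0) J1 M1 M3 Xn J3 by rewrite -est; split.
  have r3R : eqR (6 :: 18 :: sregs) R1 R3.
    apply: (eqR_trans (l1 := [:: 6; 18]) _ r33) => //.
    by apply: eqR_upd => //; apply: (eqR_trans (l1 := [:: 18]) (l2 := [::]) r21).
  sto; first by move=> bM bR; apply: bR.
  rewrite /= r3R // r13 r32.
  set M4 := upd M3 _ _.
  have m4 : eqF [:: 11] M3 M4 by apply: eqF_store.
  have m411 : fld M4 11 = upd (fld M3 11) g.+1 J3 by rewrite /M4; flds.
  have [hI4 hS4] := incr_step hg hI hM hr hP m4 m411.
  apply: (hQ _ _ _ J3 _ Xn _ hI4 hS4) => //.
  + have [_ _ hc] := i_pos hI hj0.
    rewrite /cost_at (negbTE hr) -/j0 big_nat_recr /=; last by rewrite /j0; lia.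
    rewrite (eq_big_nat _ _ (F2 := fun t => 1 + Wk X t.+1)); last first.
      by move=> t ht; rewrite Wk_upd eqSS ltn_eqF //; lia.
    rewrite Wk_upd eqxx; have := sum_size_leS Xn g.+1.
    move: q11 hc ht3; rewrite est.
    set A := \sum_(x <- Xn) _; set B' := \sum_(x <- Xn) _; set C' := \sum_(j0 <= t < g) _.
    move=> q11 hc ht3 hAB.
    (* The block held at most [C'] records before the call; the new edge adds at most one and the
       exploration at most [B']. *)
    have hx : 1 + (J3 - fld M 11 j0) + B' <= 2 * (C' + (1 + B')) by lia.
    have {}ht3 : t3 <= 2000 * (Lam * (C' + (1 + B'))).
      by apply: leq_trans ht3 _; rewrite -mulnA; have := leq_mul (leqnn Lam) hx; lia.
    have h1 : kf g + Lam <= (Lam + kf g) * (C' + (1 + B')) by rewrite addnC leq_pmulr //; lia.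
    have h2 : Lam * (C' + (1 + B')) <= (Lam + kf g) * (C' + (1 + B')).
      by rewrite leq_mul2r leq_addr orbT.
    by rewrite -mulnA; move: ht1 ht2 ht3 h1 h2 hv hL; clear; lia.
  + by rewrite kf_nonreb // r3R // r11.
  + by rewrite r3R.
  + by rewrite kf_nonreb // r3R // r11.
  + by rewrite kf_nonreb // r3R // r11.
  + by apply: (eqR_trans r11 r3R).
  + apply: (eqF_trans (l1 := [:: 0; 1; 2; 3; 4; 6; 7; 8; 9; 10; 11]) _ m4) => //.
    exact: (eqF_trans (m_fr hM) m3).
- rewrite negbK in hr.
  sq; apply: (all_heads_spec (g := g.+1)) => //; first by lia.
  move=> t2 M2 R2 ht2 r21 r22 m2 hj2.
  sq; asg; first by move=> _ _ /=; lia.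
  have [hE1 hA1] := m_mem hM.
  have hmem e : e < g.+1 -> jmem M2 0 g.+1 (dst e).
    move=> he; apply/jmemP; exists e => //.
    by have [-> _] := hj2 e he; have [-> _] := hE1 e he.
  sq; apply: (sync_spec H17 HB hs hLam hnH hWH hEs (g := g.+1) (st := 0) (J := g.+1) (q := qf (kf g))) => //.
  + by split=> [e he|]; rewrite !m2 //; apply: hE1.
  + by rewrite updE /= r21 // r11.
  + by rewrite updE /= r21 // r11.
  + by lia.
  + by rewrite !m2.
  + by rewrite !m2 //; apply: (m_pq hM).
  + move=> k hk; have [-> _] := hj2 k hk; have [-> _] := hE1 k hk.
    by have [] := hEs (leq_trans hk hg).
  + move=> x hx hm; rewrite !m2 //; apply: (m_base2 hM) => //.
    by apply: contraNneq hm => ->; apply: hmem.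
  move=> t3 M3 R3 Xn J3 ht3 r33 r32 m3 q1 q2 q3 q4 q5 q6 q7 q8 q9 q10 q11.
  have hP : SP g.+1 (qf (kf g)) 0 g.+1 M2 M3 Xn J3 by split.
  have r3R : eqR (6 :: sregs) R1 R3.
    apply: (eqR_trans (l1 := [:: 2; 6]) _ r33) => //.
    by apply: eqR_upd => //; apply: (eqR_trans (l1 := [:: 2]) (l2 := [::]) r21).
  sq; asg; first by move=> _ _ /=; lia.
  rewrite /=.
  have fin (f : nat -> nat) M4 R4 :
      f (cost (addr 11 (Reg 3)) + cost (Reg 2)).+1 <= (60 * 100) * (Lam + kf g) * g.+2 ->
      R4 1 = qf (kf g.+1) -> R4 2 = 0 -> R4 3 = g.+1 -> R4 4 = 2 ^ kf g.+1 ->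
      R4 5 = kf g.+1 -> eqR iregs R R4 ->  M4 = M3 ->
      wp (SArr 11 (Reg 3) (Reg 2)) M4 R4 i o (fun t' => Q (f t')).
    move=> hf s1 s2 s3 s4 s5 sR ->.
    sto; first by move=> bM bR; apply: bR.
    rewrite /= s2 s3.
    set M5 := upd M3 _ _.
    have m5 : eqF [:: 11] M3 M5 by apply: eqF_store.
    have m511 : fld M5 11 = upd (fld M3 11) g.+1 0 by rewrite /M5; flds.
    have [hI4 hS4 _] := reb_step hg hI hM hr m2 hj2 hP m5 m511.
    apply: (hQ _ _ _ 0 _ [::] _ hI4 hS4) => //.
    + by rewrite /cost_at hr.
    + apply: (eqF_trans (l1 := [:: 0; 1; 2; 3; 4; 6; 7; 8; 9; 10; 11]) _ m5) => //.
      apply: (eqF_trans (l1 := [:: 0; 1; 2; 3; 4; 6; 7; 8; 9; 10; 11]) _ m3) => //.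
      exact: (eqF_trans (m_fr hM) m2).
  have m5 : eqF [:: 11] M3 (upd M3 (g.+1 * 16 + 11) 0) by apply: eqF_store.
  have m511 : fld (upd M3 (g.+1 * 16 + 11) 0) 11 = upd (fld M3 11) g.+1 0 by flds.
  have [_ _ hcost] := reb_step hg hI hM hr m2 hj2 hP m5 m511.
  have {ht3}ht3 : t3 <= (50 * 100) * (Lam * g.+2).
    apply: leq_trans ht3 _; rewrite subn0 -mulnA.
    have hx : 1 + J3 + \sum_(x <- Xn) (size (out g.+1 x)).+1 <= 5 * g.+2 by move: hcost; lia.
    by have := leq_mul (leqnn Lam) hx; lia.
  have h2 : Lam * g.+2 <= (Lam + kf g) * g.+2 by rewrite leq_mul2r leq_addr orbT.
  have h3 : g.+2 <= Lam * g.+2 by rewrite leq_pmull.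
  have [hN1 hq1] := hKH (ltnW hg).
  have [hN2 hq2] := hKH hg.
  apply: (wp_ifb (b := g.+1 == 2 ^ kf g * 2 ^ kf g) H17 HB) => // [|he|he].
  + by reg; rewrite !r3R // r13 r11 // r4; case: (g.+1 == _).
  + have hk : kf g.+1 = (kf g).+1.
      by rewrite kfS -mulnn he.
    have hK2 : 2 ^ kf g.+1 < H.
      apply: leq_ltn_trans hN2; rewrite /qN -mulnA mulnCA leq_pmulr //.
      by rewrite muln_gt0 kf_gt0.
    have hk1 : kf g.+1 < H by apply: ltn_trans (ltn_expl _ (ltnSn 1)) hK2.
    sq; asg; reg; rewrite !r3R // r11 // r4 -expnS -hk; first by [].
    sq; asg; reg; rewrite !r3R // r11 // r5 addn1 -hk; first by [].
    apply: (set_q_spec (k := kf g.+1)) => //; rewrite ?updE /=.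
    - by rewrite !r3R // r11.
    - by rewrite !r3R // r11.
    move=> t4 ht4.
    apply: (fin (fun t => _ (_ (_ t)))); rewrite ?updE //=.
    - by rewrite -mulnA; move: ht1 ht2 ht3 ht4 h2 h3; clear; lia.
    - by rewrite !r3R.
    - do !apply: eqR_upd => //.
      by apply: (eqR_trans r11 r3R).
  + have hk : kf g.+1 = kf g.
      by rewrite kfS -mulnn (negbTE he).
    apply: wp_skip.
    apply: (fin (fun t => _ (_ (_ t)))); rewrite ?updE //= ?r3R // ?r11 // ?hk //.
    - by rewrite -mulnA; move: ht1 ht2 ht3 h2 h3; clear; lia.
    - apply: eqR_upd => //; exact: (eqR_trans r11 r3R).
Qed.

End Insert.

(** * Approximation *)

Section Approx.
Variables n s W a b : nat.
Hypothesis hs : s < n.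
Variable Es : seq (nat * nat * nat).
Local Notation src := (src Es).
Local Notation dst := (dst Es).
Local Notation wgt := (wgt Es).
Hypothesis hEs : forall e, e < size Es -> [/\ src e < n, dst e < n & 1 <= wgt e <= W].
Hypothesis hW : 0 < W.
Hypothesis ha : 0 < a.
Local Notation U := (U n W).
Local Notation dec := (dec n W).
Local Notation Step := (Step n s W a b Es).
Local Notation qf := (qf a b).

Definition Good hist X m := (forall x, x < n -> hist 0 x = dec (x == s)) /\
  forall g, g < m -> Step hist X g.

(** Edges are named by their insertion numbers, so that [e < g] says that [e] exists at time [g]. *)
Fixpoint ewalk x es t := if es is e :: es' then src e = x /\ ewalk (dst e) es' t else x = t.

Lemma ewalk_rcons x es e t : ewalk x es (src e) -> t = dst e -> ewalk x (rcons es e) t.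
Proof.
move=> + ->; elim: es x => [|e' es IH] x /=; first by move=> ->.
by case=> -> /IH h.
Qed.

Variables (hist : nat -> nat -> nat) (X : nat -> seq nat) (m : nat).
Hypothesis hm : m <= size Es.
Hypothesis hG : Good hist X m.

Lemma dist0 : distOK n s W Es 0 (fun x => x == s) (fun=> 0).
Proof.
split; first by rewrite eqxx.
- by move=> x _ /negbTE ->.
- move=> x _; case: eqP => _ //=; exact: leq_addr.
Qed.

Lemma good_dist g : g <= m -> dist_at n s W Es hist g.
Proof.
case: g => [_|g hg]; last by apply: (s_dist (@proj2 _ _ hG _ hg)).
by exists (fun x => (x == s) : nat), (fun=> 0); split; [apply: dist0 | apply: proj1 hG].
Qed.

Lemma good_U g x : g <= m -> x < n -> hist g x <= U.
Proof.
move=> /good_dist [D [par [hD h]]] hx; rewrite h //; apply: (dec_leU hs).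
exact: distOK_bound hD hx.
Qed.

Lemma good_s g : g <= m -> hist g s = 0.
Proof. by move=> /good_dist [D [par [hD h]]]; rewrite h // (d_src hD). Qed.

Lemma good_mono j g x : j <= g <= m -> x < n -> hist g x <= hist j x.
Proof.
move=> /andP [hj hg] hx; elim: g hj hg => [|g IH] hj hg.
  by move: hj; rewrite leqn0 => /eqP ->.
move: hj; rewrite leq_eqVlt => /predU1P [->//|hj].
exact: leq_trans (s_mono (@proj2 _ _ hG _ hg) hx) (IH hj (ltnW hg)).
Qed.

(** The source had estimate 0 when [e] was inserted and relaxed, and estimates never increase. *)
Lemma good_src g e : e < g <= m -> src e = s -> hist g (dst e) <= wgt e.
Proof.
move=> /andP [he hg] hse.
have [_ hd _] := hEs (leq_trans (leq_trans he hg) hm).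
have hle : hist g (dst e) <= hist e.+1 (dst e) by apply: good_mono; rewrite ?he ?hg.
apply: leq_trans hle _; have hem : e < m := leq_trans he hg.
by have := s_new (@proj2 _ _ hG _ hem); rewrite hse good_s // ltnW.
Qed.

(** The hypothesis is [x <= (q / p) ^ A * y] without division; a larger exponent is weaker as
    [p <= q]. *)
Lemma pow_mono p q A A' x y : A <= A' -> p <= q -> x * p ^ A <= q ^ A * y ->
  x * p ^ A' <= q ^ A' * y.
Proof.
move=> hA hpq h; rewrite -(subnKC hA) !expnD mulnA [X in _ <= X]mulnAC.
by apply: leq_mul => //; case: (A' - A) => // k; rewrite leq_exp2r.
Qed.

Lemma pow_mono0 p q A x : p <= q -> x * p ^ A <= q ^ A * x.
Proof. by move=> h; apply: (@pow_mono _ _ 0) => //; rewrite muln1 mul1n. Qed.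

Definition len es := \sum_(e <- es) wgt e.

(** Edges newer than [o] are treated one at a time, because they may not exist yet at the earlier
    time to which the argument steps back; walks of older edges are available at all these times. *)
Definition Bnd j k o q := forall v, v <= k -> 2 ^ v %| j ->
  (forall x es t, x < n -> t < n -> all (fun e => e < o) es -> ewalk x es t ->
     hist j t * q ^ (k - v) <= (q + 1) ^ (k - v) * (hist j x + len es)) /\
  (forall e, o <= e < j ->
     hist j (dst e) * q ^ (k - v) <= (q + 1) ^ (k - v) * (hist j (src e) + wgt e)).

Lemma bnd_all g : g <= m -> forall j, og g <= j <= g -> Bnd j (kf g) (og g) (qf (kf g)).
Proof.
elim: g => [_ j|g IH hg j].
  rewrite /= => hj; have -> : j = 0 by lia.
  move=> v hv _; split => [x es t hx ht hall hw|e]; last by lia.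
  case: es hall hw => [_ /= ->|e es /=]; last by [].
  by rewrite /len big_nil addn0; apply: pow_mono0; apply: leq_addr.
have St := @proj2 _ _ hG _ hg.
have gm : g.+1 <= size Es := leq_trans hg hm.
case: (boolP (reb g.+1)) => hr.
  rewrite og_reb // => hj; have -> : j = g.+1 by lia.
  have [_ hrel] := s_reb St hr.
  have hrel' e : e < g.+1 -> hist g.+1 (dst e) <= hist g.+1 (src e) + wgt e.
    move=> he; case: (eqVneq (src e) s) => [e0|/(hrel e he)//].
    apply: leq_trans (leq_addl _ _); apply: good_src => //; by rewrite he hg.
  move=> v hv hvd; split => [x es t hx ht hall hw|e]; last by lia.
  apply: (@pow_mono _ _ 0) => //; first by apply: leq_addr.
  rewrite muln1 mul1n.
  elim: es x hx hall hw => [|e es IHe] x hx /=; first by move=> _ ->; apply: leq_addr.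
  case/andP => he hall [<- hw].
  have [_ hd _] := hEs (leq_trans he gm).
  rewrite /len big_cons addnA.
  apply: leq_trans (IHe _ hd hall hw) _; by rewrite leq_add2r hrel'.
rewrite (og_nonreb hr) (kf_nonreb hr) => hj.
case: (eqVneq j g.+1) => [->|hne]; last by apply: IH; [exact: ltnW|lia].
have [hv0 hv0d _ hog] := lowbit hr.
have hlow := lowbit_sub g.
have [hsig _] := s_inc St hr.
move: hv0 hv0d hog hlow hsig; set v0 := logn 2 g.+1; set j0 := g.+1 - 2 ^ v0.
set q := qf (kf g); set k := kf g => hv0 hv0d hog hlow hsig.
have hj0 : j0 <= g by rewrite /j0; have : 0 < 2 ^ v0 := expn_gt0 2 v0; lia.
have hjj : og g <= j0 <= g by rewrite hog.
have {IH}IH := IH (ltnW hg) j0 hjj v0.+1 hv0 hlow.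
have [IHw IHe] := IH.
have hkv : k - v0 = (k - v0.+1).+1 by lia.
have htight x e : x < n -> e < g.+1 -> src e = x ->
    (x == s) || ((q + 1) * hist g.+1 x <= q * hist j0 x) ->
    hist g.+1 (dst e) <= hist g.+1 x + wgt e.
  move=> hx he hse; case: eqP => [e0 _|/eqP hxs /= hsg]; last exact: hsig.
  by apply: leq_trans (leq_addl _ _); apply: good_src; rewrite ?he ?hse.
have hmn x : x < n -> hist g.+1 x <= hist j0 x.
  by move=> hx; apply: good_mono => //; lia.
(* It suffices to treat the exact valuation [v0] of [g.+1]: a smaller [v] only allows a larger
   exponent. *)
suff [Cw Ce] : (forall x es t, x < n -> t < n -> all (fun e => e < og g) es -> ewalk x es t ->
     hist g.+1 t * q ^ (k - v0) <= (q + 1) ^ (k - v0) * (hist g.+1 x + len es)) /\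
  (forall e, og g <= e < g.+1 ->
     hist g.+1 (dst e) * q ^ (k - v0) <= (q + 1) ^ (k - v0) * (hist g.+1 (src e) + wgt e)).
  move=> v hv; rewrite pfactor_dvdn // -/v0 => hvv.
  split => [x es t hx ht hall hw|e he].
    by apply: (@pow_mono _ _ (k - v0)); [lia|lia|apply: Cw].
  by apply: (@pow_mono _ _ (k - v0)); [lia|lia|apply: Ce].
have hgo := og_le g.
split.
- move=> x es t hx ht; elim: es x hx => [|e es IHe'] x hx.
    by move=> _ /= ->; rewrite /len big_nil addn0; apply: pow_mono0; apply: leq_addr.
  move=> hall hw; have /= /andP [he hall'] := hall; have /= [hse hw'] := hw.
  have heg : e < g.+1 by lia.
  have [_ hd _] := hEs (leq_trans heg gm).
  case: (boolP ((x == s) || ((q + 1) * hist g.+1 x <= q * hist j0 x))) => [h|].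
    apply: leq_trans (IHe' _ hd hall' hw') _.
    rewrite leq_mul2l /len big_cons addnA leq_add2r (htight x) ?orbT //.
  rewrite negb_or -ltnNge => /andP [_ hlt].
  have h1 := IHw x (e :: es) t hx ht hall hw.
  rewrite hkv !expnS.
  have h2 : hist g.+1 t * (q * q ^ (k - v0.+1)) <= q * (hist j0 t * q ^ (k - v0.+1)).
    by rewrite mulnCA leq_mul2l leq_mul2r hmn // !orbT.
  apply: leq_trans h2 _.
  apply: (@leq_trans (q * ((q + 1) ^ (k - v0.+1) * (hist j0 x + len (e :: es))))).
    by rewrite leq_mul2l h1 orbT.
  rewrite mulnCA -mulnA [X in _ <= X]mulnCA leq_mul2l; apply/orP; right.
  rewrite !mulnDr; apply: leq_add; first exact: ltnW.
  by rewrite leq_mul2r leq_addr orbT.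
- move=> e /andP [he1 he2].
  have [hsn hd _] := hEs (leq_trans he2 gm).
  case: (boolP ((src e == s) || ((q + 1) * hist g.+1 (src e) <= q * hist j0 (src e)))) => [h|].
    apply: (@pow_mono _ _ 0) => //; first by apply: leq_addr.
    by rewrite muln1 mul1n (htight _ e).
  rewrite negb_or -ltnNge => /andP [_ hlt].
  case: (ltnP e j0) => hej.
    have h1 := IHe e ltac:(lia).
    rewrite hkv !expnS.
    apply: (@leq_trans (q * (hist j0 (dst e) * q ^ (k - v0.+1)))).
      by rewrite mulnCA leq_mul2l leq_mul2r hmn // !orbT.
    apply: (@leq_trans (q * ((q + 1) ^ (k - v0.+1) * (hist j0 (src e) + wgt e)))).
      by rewrite leq_mul2l h1 orbT.
    rewrite mulnCA -mulnA [X in _ <= X]mulnCA leq_mul2l; apply/orP; right.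
    rewrite !mulnDr; apply: leq_add; first exact: ltnW.
    by rewrite leq_mul2r leq_addr orbT.
  (* Here [e] was inserted inside the block. Its relaxation at insertion replaces the induction
     hypothesis, and the single factor pays for comparing its tail with time [j0]. *)
  apply: (@pow_mono _ _ 1) => //; [by lia | by apply: leq_addr |].
  rewrite !expn1.
  have h1 : hist g.+1 (dst e) <= hist e.+1 (dst e) by apply: good_mono => //; lia.
  have h2 := s_new (@proj2 _ _ hG _ (leq_trans he2 hg)).
  have h3 : hist e (src e) <= hist j0 (src e) by apply: good_mono => //; lia.
  apply: (@leq_trans (q * (hist j0 (src e) + wgt e))).
    by rewrite mulnC leq_mul2l; apply/orP; right; lia.
  rewrite !mulnDr; apply: leq_add; first exact: ltnW.
  by rewrite leq_mul2r leq_addr orbT.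
Qed.

Lemma ewalk_ltn x es t o : o <= size Es -> all (fun e => e < o) es -> x < n ->
  ewalk x es t -> t < n.
Proof.
move=> ho; elim: es x => [|e es IH] x /= hall hx; first by move=> <-.
case/andP: hall => he hall [_ hw]; apply: IH hw => //.
by have [] := hEs (leq_trans he ho).
Qed.

(** [es1] collects pending older edges. A newer edge closes that walk and spends [k] factors on it
    and [k] on itself; the final older walk spends [k] more. *)
Lemma mixed_bound g x es1 y es t : g <= m -> x < n ->
  all (fun e => e < og g) es1 -> ewalk x es1 y ->
  all (fun e => e < g) es -> ewalk y es t ->
  let k := kf g in let q := qf k in
  let E := k * (2 * count (fun e => og g <= e) es + 1) in
  hist g t * q ^ E <= (q + 1) ^ E * (hist g x + (len es1 + len es)).
Proof.
move=> hg hx h1 w1 h2 w2; cbv zeta; set k := kf g; set q := qf k; move: h1 w1 h2 w2.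
have hgE : g <= size Es := leq_trans hg hm.
have hgo := og_le g.
have hgg : og g <= g <= g by rewrite hgo leqnn.
have [Bw Be] := bnd_all hg hgg (leq0n _) (dvd1n _).
rewrite subn0 -/q -/k in Bw Be.
elim: es x hx es1 y => [|e es IH] x hx es1 y h1 w1 /=.
  move=> _ yt; rewrite yt in w1; rewrite muln1 /len big_nil addn0.
  by apply: Bw => //; apply: ewalk_ltn (leq_trans hgo hgE) h1 hx w1.
case/andP => he hes [hse hw].
have [hsn hdn _] := hEs (leq_trans he hgE).
rewrite /len big_cons -/(len es) -/(len es1).
case: (leqP (og g) e) => heo /=.
  have hy : hist g y * q ^ k <= (q + 1) ^ k * (hist g x + len es1).
    by apply: Bw => //; rewrite -hse.
  have hd := Be e; rewrite heo he hse in hd; have {}hd := hd isT.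
  have := IH (dst e) hdn [::] (dst e) isT erefl hes hw.
  set h := count _ es; set E := k * (2 * h + 1).
  rewrite {1}/len big_nil add0n => ht.
  have -> : k * (2 * (1 + h) + 1) = E + (k + k) by rewrite /E; nia.
  rewrite !expnD mulnA.
  apply: (@leq_trans ((q + 1) ^ E * (hist g (dst e) + len es) * (q ^ k * q ^ k))).
    by rewrite leq_mul2r ht orbT.
  rewrite -!mulnA leq_mul2l; apply/orP; right.
  rewrite mulnDl.
  set P := q ^ k in hy hd *; set Q := (q + 1) ^ k in hy hd *.
  have hPQ : P <= Q.
    by rewrite /P /Q; case: (k) => // k'; rewrite leq_exp2r //; lia.
  have a1 : hist g (dst e) * (P * P) <= Q * (Q * (hist g x + len es1) + wgt e * P).
    apply: (@leq_trans (Q * (hist g y + wgt e) * P)).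
      by rewrite mulnA leq_mul2r hd orbT.
    by rewrite -mulnA leq_mul2l mulnDl leq_add2r hy orbT.
  have a2 : wgt e * P <= Q * wgt e by rewrite mulnC leq_mul2r hPQ orbT.
  have a3 : len es * (P * P) <= Q * (Q * len es).
    by rewrite mulnC mulnA; do 2!apply: leq_mul => //.
  apply: leq_trans (leq_add a1 a3) _.
  rewrite -mulnDr leq_mul2l; apply/orP; right.
  by rewrite !mulnDr; lia.
have := IH x hx (rcons es1 e) (dst e).
rewrite all_rcons heo h1 => /(_ isT).
move=> /(_ (ewalk_rcons _ erefl)); rewrite hse => /(_ w1 hes hw).
by rewrite {1}/len -cats1 big_cat big_seq1 /= -!addnA.
Qed.

(** Bernoulli's inequality [(1 - 1 / (q + 1)) ^ N >= 1 - N / (q + 1)], cleared of denominators. *)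
Lemma bernoulli N q : N <= q -> (q + 1) ^ N * (q + 1 - N) <= q ^ N * (q + 1).
Proof.
elim: N => [|N IH] hN; first by rewrite subn0 !expn0.
have := IH (ltnW hN); set P := (q + 1) ^ N; set Q := q ^ N => h.
rewrite !expnS -/P -/Q.
have e1 : (q + 1) * (q + 1 - N.+1) <= q * (q + 1 - N).
  have [d ->] : exists d, q = N + 1 + d by exists (q - N.+1); lia.
  have -> : N + 1 + d + 1 - N.+1 = d + 1 by lia.
  have -> : N + 1 + d + 1 - N = d + 2 by lia.
  nia.
have e2 : P * ((q + 1) * (q + 1 - N.+1)) <= P * (q * (q + 1 - N)) by rewrite leq_mul2l e1 orbT.
have e3 : q * (P * (q + 1 - N)) <= q * (Q * (q + 1)) by rewrite leq_mul2l h orbT.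
apply: (@leq_trans (q * (P * (q + 1 - N)))).
  by rewrite -mulnA mulnCA [X in _ <= X]mulnCA.
by rewrite -[X in _ <= X]mulnA.
Qed.

(** The second bound is independent of the accuracy and serves to show that a reachable vertex has a
    value below [U]. *)
Lemma approx_bound g es t : g <= m -> uniq es -> all (fun e => e < g) es ->
  ewalk s es t -> 0 < len es ->
  hist g t * b < (a + b) * len es /\ hist g t < 2 * len es.
Proof.
move=> hg hu hall hw hl.
have := mixed_bound hg hs (es1 := [::]) isT erefl hall hw.
set k := kf g; set h := count _ es; set q := qf k => /=.
rewrite good_s // {1}/len big_nil !add0n => hB.
(* The newer edges have distinct numbers in [[og g, g)], an interval shorter than the period. *)
have hh : h <= 2 ^ k - 1.
  have h1 : h <= g - og g.
    rewrite /h -size_filter -(size_iota (og g) (g - og g)).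
    apply: uniq_leq_size; first exact: filter_uniq.
    move=> e; rewrite mem_filter mem_iota => /andP [h1 h2].
    have := allP hall e h2; have := og_le g; lia.
  by have := og_near g; rewrite -/k; lia.
set N := qN k.
have hN : k * (2 * h + 1) <= N.
  rewrite /N /qN -mulnA [2 ^ k * k]mulnC mulnCA leq_mul2l; apply/orP; right.
  have : 0 < 2 ^ k by rewrite expn_gt0.
  lia.
have hqN : 2 * N < q + 1 by rewrite /q /qf -/N; set A := _ %/ a; lia.
have hqa : N * (a + b) < (q + 1) * a.
  have h1 := ltn_ceil (N * (a + b)) ha; apply: leq_trans h1 _.
  rewrite leq_mul2r; apply/orP; right; rewrite /q /qf -/N.
  by set A := _ %/ a; lia.
have hB2 : hist g t * q ^ N <= (q + 1) ^ N * len es.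
  by apply: (pow_mono hN _ hB); apply: leq_addr.
have hbr := bernoulli (N := N) (q := q) ltac:(lia).
have hfin : hist g t * (q + 1 - N) <= len es * (q + 1).
  have hp : 0 < (q + 1) ^ N by rewrite expn_gt0; lia.
  rewrite -(leq_pmul2l hp).
  apply: (@leq_trans (hist g t * (q ^ N * (q + 1)))).
    by rewrite mulnCA leq_mul2l hbr orbT.
  rewrite !mulnA leq_mul2r [_ * len es]mulnC [len es * _]mulnC hB2 orbT //.
case: (posnP (hist g t)) => [->|ht].
  by rewrite mul0n muln_gt0 muln_gt0 hl !andbT; split => //; lia.
have [d hd] : exists d, q + 1 = N + d by exists (q + 1 - N); lia.
have hd2 : q + 1 - N = d by lia.
rewrite hd2 hd in hfin hqa hqN.
split.
- have h1 : hist g t * d * (a + b) <= len es * (N + d) * (a + b) by rewrite leq_mul2r hfin orbT.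
  have h2 : (N + d) * b < d * (a + b) by nia.
  have h3 : hist g t * ((N + d) * b) < hist g t * (d * (a + b)) by rewrite ltn_pmul2l.
  have h4 : (N + d) * (hist g t * b) < (N + d) * ((a + b) * len es) by nia.
  by rewrite ltn_pmul2l in h4; lia.
- have h1 : hist g t * (N + d) < hist g t * (2 * d) by rewrite ltn_pmul2l //; lia.
  have h2 : (N + d) * hist g t < (N + d) * (2 * len es) by nia.
  by rewrite ltn_pmul2l in h2; lia.
Qed.

End Approx.

(** * Running time *)

Section Cost.
Variables n s W a b : nat.
Hypothesis hs : s < n.
Variable Es : seq (nat * nat * nat).
Local Notation src := (src Es).
Local Notation dst := (dst Es).
Local Notation wgt := (wgt Es).
Local Notation out := (out Es).
Hypothesis hEs : forall e, e < size Es -> [/\ src e < n, dst e < n & 1 <= wgt e <= W].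
Hypothesis hW : 0 < W.
Hypothesis ha : 0 < a.
Variables (hist : nat -> nat -> nat) (X : nat -> seq nat) (m : nat).
Hypothesis hm : m <= size Es.
Hypothesis hG : Good n s W a b Es hist X m.
Local Notation U := (U n W).
Local Notation qf := (qf a b).
Local Notation Wk := (Wk Es).
Local Notation L := (trunc_log 2 m).+1.

(** The claim is strengthened to be inductive. A rebuild moves [og] forward by at least the period;
    when the period doubles, the left side doubles too while the square on the right quadruples. *)
Lemma sum_reb : \sum_(0 <= g < m) (reb g.+1 : nat) <= 2 * 2 ^ kf m.
Proof.
suff h : (\sum_(0 <= g < m) (reb g.+1 : nat)) * 2 ^ kf m <= og m + (2 ^ kf m) ^ 2.
  have hK : 0 < 2 ^ kf m by rewrite expn_gt0.
  rewrite -(leq_pmul2r hK); apply: leq_trans h _.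
  by have := kf_ub m; have := og_le m; rewrite expnS expn1; lia.
elim: (m) => [|g IH]; first by rewrite big_geq // mul0n.
rewrite big_nat_recr //=.
case: (boolP (reb g.+1)) => hr; last by rewrite og_nonreb // kf_nonreb // addn0.
rewrite og_reb //.
have hK : 0 < 2 ^ kf g by rewrite expn_gt0.
have hog : og g + 2 ^ kf g <= g.+1.
  have : 2 ^ kf g %| g.+1 - og g by rewrite dvdn_sub // og_dvd.
  by move/dvdn_leq; rewrite subn_gt0 ltnS og_le => /(_ isT); lia.
move: IH; set S := \sum_(0 <= i < g) _ => IH.
rewrite kfS; case: eqP => [e|_]; last by rewrite mulnDl mul1n; lia.
rewrite (expnS 2 (kf g)) expnMn -e mulnCA.
move: IH hog e; set K := 2 ^ kf g => IH hog; rewrite expnS expn1 => e.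
by rewrite expnS expn1 in IH; rewrite mulnDl mul1n; lia.
Qed.

Lemma lowbit_inj v i j t : 2 ^ v %| i -> 2 ^ v %| j ->
  i - 2 ^ v <= t < i -> j - 2 ^ v <= t < j -> i = j.
Proof.
wlog hij : i j / i <= j => [hw|].
  by move=> h1 h2 h3 h4; case: (leqP i j) => [|/ltnW] h; [apply: hw|symmetry; apply: hw].
move=> h1 h2 h3 h4; have : 2 ^ v %| j - i by rewrite dvdn_sub.
case: (posnP (j - i)) => [|hp]; first by lia.
by move/(dvdn_leq hp); lia.
Qed.

(** Valuations of times up to [m] are below [L], and the hypothesis admits one time for each. *)
Lemma count_le (P : pred nat) :
  (forall i j, i < m -> j < m -> P i -> P j -> logn 2 i.+1 = logn 2 j.+1 -> i = j) ->
  \sum_(0 <= g < m) (P g : nat) <= L.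
Proof.
move=> hinj.
have -> : \sum_(0 <= g < m) (P g : nat) = size [seq g <- iota 0 m | P g].
  rewrite size_filter -sum1_count /index_iota subn0 [RHS]big_mkcond /=.
  by apply: eq_bigr => i _; case: (P i).
rewrite -(size_map (fun g => logn 2 g.+1)) -[X in _ <= X](size_iota 0).
apply: uniq_leq_size.
  rewrite map_inj_in_uniq ?filter_uniq ?iota_uniq // => i j.
  rewrite !mem_filter !mem_iota => /andP [hi /andP [_ him]] /andP [hj /andP [_ hjm]].
  by apply: hinj.
move=> v /mapP [g]; rewrite mem_filter mem_iota => /andP [_ hg] ->.
rewrite mem_iota add0n leq0n ltnS /=; apply: trunc_log_max => //.
have h1 : 2 ^ logn 2 g.+1 <= g.+1 by apply: dvdn_leq => //; rewrite pfactor_dvdn.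
by apply: leq_trans h1 _; lia.
Qed.

(** Blocks of equal valuation are aligned, hence disjoint, so [t] lies in at most one per
    valuation. *)
Lemma count_blocks t :
  \sum_(0 <= g < m) (g.+1 - 2 ^ logn 2 g.+1 <= t < g.+1 : nat) <= L.
Proof.
apply: (@count_le (fun g => g.+1 - 2 ^ logn 2 g.+1 <= t < g.+1)) => i j _ _ hi hj e.
have [] // : i.+1 = j.+1.
apply: (@lowbit_inj (logn 2 i.+1) _ _ t) => //.
- by rewrite pfactor_dvdn.
- by rewrite pfactor_dvdn // e.
- by rewrite e.
Qed.

Definition inX t x := x \in X t.+1.

(** Exchanging the sums charges the work of a time once for each block that contains it. *)
Lemma sum_nonreb :
  \sum_(0 <= g < m) (if reb g.+1 then 0
     else \sum_(g.+1 - 2 ^ logn 2 g.+1 <= t < g.+1) (1 + Wk X t.+1)) <=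
  L * \sum_(0 <= t < m) (1 + Wk X t.+1).
Proof.
apply: (@leq_trans (\sum_(0 <= g < m) \sum_(0 <= t < m)
    (1 + Wk X t.+1) * (g.+1 - 2 ^ logn 2 g.+1 <= t < g.+1))).
  rewrite big_nat_cond [X in _ <= X]big_nat_cond; apply: leq_sum => g /andP [/andP [_ hg] _].
  case: ifP => _ //.
  rewrite (big_nat_widen _ _ m) // (big_nat_widenl _ 0) //=.
  rewrite big_mkcond /=; apply: leq_sum => t _.
  by rewrite andbC; case: ifP => h; rewrite ?muln0 ?muln1 //; case: (_ && _) h.
rewrite exchange_big /= big_distrr /=; apply: leq_sum => t _.
by rewrite -big_distrr /= mulnC leq_mul2r count_blocks orbT.
Qed.

Lemma X_reb t : t < m -> reb t.+1 -> X t.+1 = [::].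
Proof. by move=> ht hr; have [] := s_reb (@proj2 _ _ hG _ ht) hr. Qed.

Lemma X_prop t x : t < m -> x \in X t.+1 ->
  [/\ x < n, x != s, exists2 e, e < t.+1 & dst e = x
   & (qf (kf t) + 1) * hist t.+1 x <= qf (kf t) * hist (t.+1 - 2 ^ logn 2 t.+1) x].
Proof.
move=> ht hx; have St := @proj2 _ _ hG _ ht.
case: (boolP (reb t.+1)) => hr; first by move: hx; rewrite X_reb.
by have [_ h] := s_inc St hr; apply: h.
Qed.

Lemma qf_mono k l : k <= l -> qf k <= qf l.
Proof.
move=> h; have hN : qN k <= qN l.
  by rewrite /qN; apply: leq_mul => //; apply: leq_mul => //; rewrite leq_exp2l.
rewrite /qf; apply: leq_add; last by rewrite leq_add2r leq_mul2l hN orbT.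
by apply: leq_div2r; rewrite leq_mul2r hN orbT.
Qed.

Lemma hist_gt0 g x : g <= m -> x < n -> x != s -> 0 < hist g x.
Proof.
move=> hg hx hxs; have [D [par [hD ->]]] // := good_dist hG hg.
case: (posnP (D x)) => [->|h].
  by rewrite dec0 /U !muln_gt0 /= hW andbT; lia.
rewrite dec_pos //; have := distOK_gt1 hs hEs hD (leq_trans hg hm) hx hxs (lt0n_neq0 h); lia.
Qed.

Definition vcount v x g := \sum_(0 <= t < g) ((logn 2 t.+1 == v) && inX t x : nat).

(** An exploration at valuation [v] certifies a drop since the start of its block, and no other time
    of valuation [v] lies inside that block. The induction jumps to its start, so no drop is counted
    twice. *)
Lemma vcount_bound v x g : g <= m -> x < n -> x != s ->
  let Q := qf (kf m) in (Q + 1) ^ vcount v x g * hist g x <= Q ^ vcount v x g * U.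
Proof.
move=> hg hx hxs; cbv zeta; set Q := qf (kf m).
elim/ltn_ind: g hg => [[|g] IH] hg.
  rewrite /vcount big_geq // !mul1n.
  exact: (good_U hs hG hg hx).
have hrec : vcount v x g.+1 = vcount v x g + ((logn 2 g.+1 == v) && inX g x).
  by rewrite /vcount big_nat_recr.
case: (boolP ((logn 2 g.+1 == v) && inX g x)) hrec => [/andP [/eqP hv hin]|_] hrec; last first.
  rewrite hrec addn0; apply: leq_trans (IH g _ (ltnW hg)) => //.
  by rewrite leq_mul2l (good_mono hG) ?orbT //; lia.
have [_ _ _ hdec] := X_prop hg hin.
rewrite hv in hdec; set g0 := g.+1 - 2 ^ v in hdec.
have hpw : 0 < 2 ^ v by rewrite expn_gt0.
have hg0 : vcount v x g0 = vcount v x g.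
  rewrite /vcount [RHS](big_cat_nat (n := g0)) //=; last by rewrite /g0; lia.
  rewrite [X in _ = _ + X]big_nat_cond [X in _ = _ + X]big1 ?addn0 // => t.
  rewrite andbT => ht; case: eqP => //= ev.
  have : 2 ^ v %| g.+1 - t.+1 by rewrite dvdn_sub // pfactor_dvdn // ?hv ?ev.
  have hp : 0 < g.+1 - t.+1 by lia.
  by move/(dvdn_leq hp); rewrite /g0 in ht; lia.
(* [q] grows with the period, and the factor for the final [Q] is the weakest, so it holds at every
   time. *)
have hq : qf (kf g) <= Q by apply: qf_mono; apply: kf_mono; exact: ltnW.
have hdec2 : (Q + 1) * hist g.+1 x <= Q * hist g0 x.
  have hq0 : 0 < qf (kf g) := qf_gt0 a b _.
  move: hdec hq hq0; set q := qf _; set h1 := hist _ _; set h2 := hist _ _ => hdec hq hq0.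
  rewrite -(leq_pmul2l hq0); apply: (@leq_trans (Q * ((q + 1) * h1))); first by nia.
  by rewrite [X in _ <= X]mulnCA leq_mul2l hdec orbT.
rewrite hrec [_ + true]addn1 !expnS.
have := IH g0 ltac:(rewrite /g0; lia) ltac:(rewrite /g0; lia); rewrite hg0.
set c := vcount v x g => IHg.
apply: (@leq_trans ((Q + 1) ^ c * (Q * hist g0 x))).
  by rewrite -mulnA mulnCA leq_mul2l hdec2 orbT.
by rewrite mulnCA -mulnA leq_mul2l IHg orbT.
Qed.

(** How many factors [(Q + 1) / Q] fit between 1 and [U]. It stays abstract here and becomes a
    logarithm in [total_bound]. *)
Variable cmax : nat.
Hypothesis hcmax : forall c, (qf (kf m) + 1) ^ c <= qf (kf m) ^ c * U -> c <= cmax.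

(** Each valuation has its own budget of [cmax] explorations, since the estimate of [x] starts at
    most at [U] and never falls below 1. *)
Lemma count_X x : x < n -> x != s -> \sum_(0 <= t < m) (inX t x : nat) <= L * cmax.
Proof.
move=> hx hxs.
apply: (@leq_trans (\sum_(0 <= v < L) \sum_(0 <= t < m)
    ((logn 2 t.+1 == v) && inX t x : nat))).
  rewrite [X in _ <= X]exchange_big.
  rewrite big_nat_cond.
  rewrite [X in _ <= X]big_nat_cond.
  apply: leq_sum => t /andP [/andP [_ ht] _].
  case: (inX t x); last by [].
  rewrite (bigD1_seq (logn 2 t.+1)) ?iota_uniq //= ?eqxx //.
  rewrite mem_index_iota ltnS /=; apply: trunc_log_max => //.
  have h1 : 2 ^ logn 2 t.+1 <= t.+1 by apply: dvdn_leq => //; rewrite pfactor_dvdn.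
  by apply: leq_trans h1 _.
rewrite -[X in _ <= X * _]subn0 -sum_nat_const_nat; apply: leq_sum => v _.
rewrite -/(vcount v x m); apply: hcmax; have := vcount_bound v (leqnn m) hx hxs; cbv zeta.
have := hist_gt0 (leqnn m) hx hxs.
by move=> h0; apply: leq_trans; rewrite leq_pmulr.
Qed.

(** Explored vertices have an incoming edge. Counting only such vertices makes the units charged per
    extraction sum to [m] instead of [n]. *)
Definition head x := has (fun e => dst e == x) (iota 0 m).

Lemma sum_heads : \sum_(0 <= x < n) (head x : nat) * (size (out m x)).+1 <= 2 * m.
Proof.
rewrite (eq_bigr (fun x => (head x : nat) * size (out m x) + (head x : nat))); last first.
  by move=> x _; rewrite mulnS addnC.
rewrite big_split /= mul2n -addnn; apply: leq_add.
  apply: (@leq_trans (\sum_(0 <= x < n) size (out m x))).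
    by apply: leq_sum => x _; case: (head x); rewrite ?mul1n.
  exact: sum_out (iota_uniq _ _).
have -> : \sum_(0 <= x < n) (head x : nat) = size [seq x <- iota 0 n | head x].
  rewrite size_filter -sum1_count /index_iota subn0 [RHS]big_mkcond /=.
  by apply: eq_bigr => i _; case: (head i).
rewrite -[X in _ <= X](size_iota 0) -(size_map dst).
apply: uniq_leq_size; first by rewrite filter_uniq ?iota_uniq.
move=> x; rewrite mem_filter => /andP [/hasP [e he /eqP <-] _].
exact: map_f.
Qed.

Lemma sum_Wk : \sum_(0 <= t < m) Wk X t.+1 <= 2 * m * (L * cmax).
Proof.
apply: (@leq_trans (\sum_(0 <= t < m) \sum_(0 <= x < n)
    (head x : nat) * (size (out m x)).+1 * (inX t x && (x != s)))).
  rewrite big_nat_cond [X in _ <= X]big_nat_cond; apply: leq_sum => t /andP [/andP [_ ht] _].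
  have hu := s_uniq (@proj2 _ _ hG _ ht).
  have -> : \sum_(0 <= x < n) (head x : nat) * (size (out m x)).+1 * (inX t x && (x != s)) =
      \sum_(x <- iota 0 n | x \in X t.+1) (head x : nat) * (size (out m x)).+1 * (x != s).
    rewrite [RHS]big_mkcond /= /index_iota subn0; apply: eq_bigr => x _.
    by rewrite /inX; case: (x \in _); rewrite ?muln0.
  have hperm : perm_eq (X t.+1) [seq x <- iota 0 n | x \in X t.+1].
    apply: uniq_perm => //; first by rewrite filter_uniq ?iota_uniq.
    move=> x; rewrite mem_filter mem_iota; case: (boolP (x \in X t.+1)) => //= hx.
    by have [-> _ _ _] := X_prop ht hx.
  rewrite -big_filter -(perm_big _ hperm) /= /Wk !big_seq.
  apply: leq_sum => x hx; have [hxn hxs [e he hd] _] := X_prop ht hx.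
  have -> : head x by apply/hasP; exists e; rewrite ?hd // mem_iota; lia.
  rewrite hxs mul1n muln1 ltnS.
  apply: (@uniq_leq_size _ (out t.+1 x) (out m x)) => [|e']; first exact: out_uniq.
  by rewrite !mem_out => /andP [h1 ->]; rewrite andbT; lia.
rewrite exchange_big /=.
apply: (@leq_trans (\sum_(0 <= x < n) (head x : nat) * (size (out m x)).+1 * (L * cmax))).
  rewrite big_nat_cond [X in _ <= X]big_nat_cond; apply: leq_sum => x /andP [/andP [_ hx] _].
  rewrite -big_distrr /= leq_mul2l; apply/orP; right.
  case: (eqVneq x s) => [_|hxs]; first by rewrite big1 // => t _; rewrite andbF.
  by apply: leq_trans (count_X hx hxs); apply: leq_sum => t _; rewrite andbT.
by rewrite -big_distrl /= leq_mul2r sum_heads orbT.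
Qed.

Lemma sum_cost : \sum_(0 <= g < m) cost_at Es X g <=
  (m + 1) * (2 * 2 ^ kf m) + L * (m + 2 * m * (L * cmax)).
Proof.
apply: (@leq_trans (\sum_(0 <= g < m) ((m + 1) * (reb g.+1 : nat) +
   (if reb g.+1 then 0
     else \sum_(g.+1 - 2 ^ logn 2 g.+1 <= t < g.+1) (1 + Wk X t.+1))))).
  rewrite big_nat_cond [X in _ <= X]big_nat_cond; apply: leq_sum => g /andP [/andP [_ hg] _].
  by rewrite /cost_at; case: (reb g.+1) => /=; lia.
rewrite big_split /=; apply: leq_add.
  by rewrite -big_distrr /= leq_mul2l sum_reb orbT.
apply: leq_trans sum_nonreb _; rewrite leq_mul2l; apply/orP; right.
rewrite big_split /= sum_nat_const_nat muln1 subn0 leq_add2l; exact: sum_Wk.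
Qed.

End Cost.

(** * Procedures *)

(** Registers are cleared between calls, so these are kept in the cells of field 12. *)
Definition saved := [:: 0; 1; 2; 3; 4; 5; 19; 20].

Fixpoint save_regs (rs : seq nat) (k : nat) : cmd :=
  if rs is r :: rs' then SArr 12 (Cst k) (Reg r) ;; save_regs rs' k.+1 else Skip.

Fixpoint load_regs (rs : seq nat) (k : nat) : cmd :=
  if rs is r :: rs' then Assign r (Arr 12 (Cst k)) ;; load_regs rs' k.+1 else Skip.

Definition read_insert : cmd := Read 7 ;; Read 8 ;; Read 9 ;; insert_core.

Definition insert_prog : cmd :=
  load_regs saved 0 ;; read_insert ;; save_regs saved 0.

(** Cleared memory already encodes the empty graph, apart from the estimate of the source. The
    initial edges are then inserted one by one, so they obey the same analysis. *)
Definition init_prog : cmd :=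
  Read 0 ;; Read 10 ;; Read 11 ;; Read 19 ;; Read 20 ;; Read 21 ;;
  SArr 0 (Reg 10) (Cst 1) ;;
  SArr 2 (Reg 10) (Cst 1) ;;
  Assign 4 (Cst 2) ;; Assign 5 (Cst 1) ;; set_q ;;
  While (Reg 21)
    (read_insert ;; Assign 21 (eSub (Reg 21) (Cst 1))) ;;
  save_regs saved 0.

Definition dist_prog : cmd :=
  Read 7 ;;
  If (Arr 0 (Reg 7))
    (Write (eSub (Arr 0 (Reg 7)) (Cst 1)) ;; Write (Cst 1))
    (Write (Cst 0) ;; Write (Cst 0)).

(** Parents lead from the target to the source, recognised by its stored value 1; field 5 serves as
    a stack to reverse the order. *)
Definition path_prog : cmd :=
  Read 7 ;;
  If (Arr 0 (Reg 7))
    (Assign 8 (Cst 0) ;;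
     While (eLt (Cst 1) (Arr 0 (Reg 7)))
       (SArr 5 (Reg 8) (Reg 7) ;; Assign 8 (eAdd (Reg 8) (Cst 1)) ;; Assign 7 (Arr 1 (Reg 7))) ;;
     Write (Reg 7) ;;
     While (Reg 8) (Assign 8 (eSub (Reg 8) (Cst 1)) ;; Write (Arr 5 (Reg 8))))
    Skip.

Definition alg := Algorithm init_prog insert_prog dist_prog path_prog.

Arguments save_regs : simpl never.
Arguments load_regs : simpl never.

(** * Extending histories in time, and paths read off the parents *)

Section Ext.
Variables (n s W a b Lam : nat) (Es : seq (nat * nat * nat)).
Local Notation Step := (Step n s W a b Es).
Local Notation Good := (Good n s W a b Es).
Local Notation cost_at := (cost_at Es).
Implicit Types (hist : nat -> nat -> nat) (X : nat -> seq nat).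

(** Each insertion redefines [hist] and [X] at one new time; what was proved about earlier times has
    to survive this. *)
Lemma Step_ext hist X hist' X' g : (forall j, j <= g.+1 -> hist' j = hist j) ->
  X' g.+1 = X g.+1 -> Step hist X g -> Step hist' X' g.
Proof.
move=> hh hX [h1 h2 h3 h4 h5 h6].
have e1 := hh g.+1 (leqnn _); have e2 := hh g (leqnSn _).
split; rewrite ?hX ?e1 ?e2 //.
- case: h1 => D [par [hD h]]; exists D, par; split => //.
  by move=> x hx; rewrite e1 h.
- by move=> hr; have := h5 hr; cbv zeta; rewrite hh //; lia.
Qed.

Lemma Good_ext hist X hist' X' g : (forall j, j <= g -> hist' j = hist j) ->
  (forall j, j <= g -> X' j = X j) -> Good hist X g -> Good hist' X' g.
Proof.
move=> hh hX [h1 h2]; split; first by move=> x hx; rewrite hh // h1.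
move=> g' hg'; apply: Step_ext (h2 _ hg'); last exact: hX.
by move=> j hj; apply: hh; lia.
Qed.

Lemma cost_at_gt0 X g : 0 < cost_at X g.
Proof.
rewrite /cost_at; case: ifP => // _; rewrite big_nat_recr /=; first by lia.
have : 0 < 2 ^ logn 2 g.+1 by rewrite expn_gt0.
lia.
Qed.

(** The excess over the [60 * 100] of [insert_core_spec] absorbs constant overhead such as reading
    the edge. *)
Definition icost X g := (61 * 100) * (Lam + kf g) * cost_at X g.

Lemma cost_at_ext X X' g : (forall j, j <= g.+1 -> X' j = X j) -> cost_at X' g = cost_at X g.
Proof.
move=> h; rewrite /cost_at; case: ifP => // _.
rewrite big_nat_cond [RHS]big_nat_cond; apply: eq_bigr => t; rewrite andbT => ht.
by rewrite /Wk h //; lia.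
Qed.

Local Notation src := (src Es).
Local Notation dst := (dst Es).
Local Notation wgt := (wgt Es).
Local Notation len := (len Es).

Lemma ewalk_last x es t : ewalk Es x es t -> last x [seq dst e | e <- es] = t.
Proof. by elim: es x => //= e es IH x [_ /IH]. Qed.

Hypothesis hEs : forall e, e < size Es -> [/\ src e < n, dst e < n & 1 <= wgt e <= W].

(** Positive weights make the estimate fall strictly from a vertex to its parent, which gives
    termination and a simple path. The length bound is strict because stored estimates are shifted
    by one. *)
Lemma par_path g D par v : distOK n s W Es g D par -> g <= size Es -> v < n -> D v != 0 ->
  exists es, [/\ ewalk Es s es v, all (fun e => e < g) es,
    all (fun e => par (dst e) == src e) es,
    path (fun x y => D x < D y) s [seq dst e | e <- es] & len es < D v].
Proof.
move=> hD hg; move: {2}(D v) (erefl (D v)) => d; elim/ltn_ind: d v => d IH v hd hv hne.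
case: (eqVneq v s) => [->|hvs].
  by exists [::]; split; rewrite //= /len big_nil (d_src hD).
have [e [he hde hse h0 hle]] := d_par hD hv hvs hne.
have [hsn hdn hw] := hEs (leq_trans he hg).
have hlt : D (src e) < d by rewrite -hd; lia.
have [es [k1 k2 k3 k4 k5]] := IH _ hlt (src e) erefl hsn (lt0n_neq0 h0).
exists (rcons es e); split.
- by apply: ewalk_rcons k1 _.
- by rewrite all_rcons he.
- by rewrite all_rcons hde hse eqxx.
- by rewrite map_rcons rcons_path k4 (ewalk_last k1) /= hde hd.
- by rewrite /len -cats1 big_cat big_seq1 /= -/(len es); lia.
Qed.

Hypothesis hs : s < n.

Lemma good_path hist X m g v : m <= size Es -> Good hist X m -> g <= m -> v < n ->
  hist g v != U n W -> exists es, [/\ ewalk Es s es v, all (fun e => e < g) es,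
    uniq (s :: [seq dst e | e <- es]) & len es <= hist g v].
Proof.
move=> hm hG hg hv; have [D [par [hD ->]]] // := good_dist hG hg.
case: (eqVneq (D v) 0) => [->|h0 _]; first by rewrite eqxx.
have [es [k1 k2 _ k4 k5]] := par_path hD (leq_trans hg hm) hv h0.
exists es; split => //; last by rewrite dec_pos; lia.
apply: (@sorted_uniq _ (fun x y => D x < D y)) => //.
- by move=> x y z; apply: ltn_trans.
- by move=> x; apply: ltnn.
Qed.

End Ext.

Lemma icost_slack c c' t y z : c + 63 <= c' -> 0 < y -> 0 < z ->
  t <= c * y * z -> t + 63 <= c' * y * z.
Proof.
move=> hc hy hz h; apply: (@leq_trans ((c + 63) * y * z)).
  rewrite 2!mulnDl; apply: leq_add h _.
  by rewrite -mulnA leq_pmulr // muln_gt0 hy.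
by rewrite !leq_mul2r hc !orbT.
Qed.

Section Procs.
Variables B H : nat.
Hypothesis H17 : 17 <= H.
Hypothesis HB : H ^ 8 <= B.
Variables n s W Lam a b : nat.
Hypothesis hs : s < n.
Hypothesis hLam : 2 * n <= 2 ^ Lam.
Hypothesis hnH : 2 * n < H.
Hypothesis hWH : 1 + W * n < H.
Hypothesis habH : a + b + W < H.
Variable Es : seq (nat * nat * nat).
Local Notation src := (src Es).
Local Notation dst := (dst Es).
Local Notation wgt := (wgt Es).
Local Notation dec := (dec n W).
Local Notation U := (U n W).
Local Notation len := (len Es).
Hypothesis hEs : forall e, e < size Es -> [/\ src e < n, dst e < n & 1 <= wgt e <= W].
Hypothesis hJH : 2 * (size Es + 2) ^ 2 < H.
Local Notation qf := (qf a b).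
Hypothesis hKH : forall g, g <= size Es -> qN (kf g) < H /\ qf (kf g) < H.
Hypothesis hW : 0 < W.
Hypothesis ha : 0 < a.
Local Notation wp := (wp B H).
Local Notation Consistent := (Consistent n s W Es).
Local Notation Good := (Good n s W a b Es).
Local Notation cost_at := (cost_at Es).
Local Notation icost := (icost Lam Es).
Implicit Types (hist : nat -> nat -> nat) (X : nat -> seq nat).

Ltac asg := apply: (wp_asg H17 HB) => //.
Ltac sto := apply: (wp_store H17 HB) => //.
Ltac sq := apply: wp_seq.
Ltac rd := apply: (wp_read H17 HB).
Ltac wr := apply: (wp_write H17 HB) => //.
Ltac reg := rewrite /=; repeat (rewrite updE /=).

Definition rvals J g := [:: n; qf (kf g); J; g; 2 ^ kf g; kf g; a; b].
Definition regsOK (R : nat -> nat) J g := [seq R r | r <- saved] = rvals J g.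

Lemma regsOK_E R J g : regsOK R J g <->
  [/\ [/\ R 0 = n, R 1 = qf (kf g) & R 2 = J],
      [/\ R 3 = g, R 4 = 2 ^ kf g & R 5 = kf g], R 19 = a & R 20 = b].
Proof.
rewrite /regsOK /rvals /saved /=; split.
  by case=> -> -> -> -> -> -> -> ->.
by case=> [[-> -> ->] [-> -> ->] -> ->].
Qed.

Record PInv hist X (M : nat -> nat) (g : nat) : Prop := mkPInv {
  pi_bd : bd H M;
  pi_inv : exists2 J, Consistent hist X M J g & [seq fld M 12 k | k <- iota 0 8] = rvals J g;
  pi_good : Good hist X g }.

Lemma save_spec (rs : seq nat) k M R i o (Q : post) : k + size rs <= 16 ->
  (forall t M', t <= 20 * (size rs).+1 -> eqF [:: 12] M M' ->
    (forall j, j < k -> fld M' 12 j = fld M 12 j) ->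
    [seq fld M' 12 j | j <- iota k (size rs)] = [seq R r | r <- rs] -> Q t M' R i o) ->
  wp (save_regs rs k) M R i o Q.
Proof.
elim: rs k M Q => [|r rs IH] k M Q hk hQ; first by apply: wp_skip; apply: hQ.
sq; sto; rewrite /= in hk *.
- by lia.
- by move=> bM bR; apply: bR.
apply: IH; first by lia.
move=> t M' ht hF hold hnew.
apply: hQ.
- by rewrite /=; lia.
- by apply: (eqF_trans (l1 := [:: 12]) _ hF) => //; apply: eqF_store.
- by move=> j hj; rewrite hold; [flds; rewrite updE ltn_eqF | lia].
- by rewrite /= hnew hold //; flds; rewrite updE eqxx.
Qed.

Lemma load_spec (rs : seq nat) k M R i o (Q : post) : k + size rs <= 16 -> uniq rs ->
  (forall t R', t <= 20 * (size rs).+1 -> eqR rs R R' ->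
    [seq R' r | r <- rs] = [seq fld M 12 j | j <- iota k (size rs)] -> Q t M R' i o) ->
  wp (load_regs rs k) M R i o Q.
Proof.
elim: rs k R Q => [|r rs IH] k R Q hk hu hQ; first by apply: wp_skip; apply: hQ.
sq; asg; rewrite /= in hk hu *.
- by lia.
- by move=> bM bR; apply: bM.
case/andP: hu => hr hu.
apply: IH => //; first by lia.
move=> t R' ht hF hnew.
apply: hQ.
- by rewrite /=; lia.
- move=> r' hr'; rewrite inE negb_or in hr'; case/andP: hr' => h1 h2.
  by rewrite hF // updE (negbTE h1).
- by rewrite /= hnew hF // updE eqxx.
Qed.

Lemma insert_edge_spec hist X M J g R i o (Q : post) : g < size Es ->
  Consistent hist X M J g -> Good hist X g -> regsOK R J g ->
  (forall t M' R' J' hist' X',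
    t + 60 <= icost X' g -> Consistent hist' X' M' J' g.+1 -> Good hist' X' g.+1 ->
    (forall j, j <= g -> hist' j = hist j) -> (forall j, j <= g -> X' j = X j) ->
    regsOK R' J' g.+1 -> eqF [:: 0; 1; 2; 3; 4; 6; 7; 8; 9; 10; 11] M M' -> R' 21 = R 21 ->
    Q t M' R' i o) ->
  wp read_insert M R (src g :: dst g :: wgt g :: i) o Q.
Proof.
move=> hg hI hGd /regsOK_E [[r0 r1 r2] [r3 r4 r5] r19 r20] hQ.
have [h1 h2 h3] := hEs hg.
have hL : 0 < Lam by case: (Lam) hLam => //; lia.
sq; rd; first by lia.
sq; rd; first by lia.
sq; rd; first by lia.
apply: (insert_core_spec H17 HB hs hLam hnH hWH hEs hJH hKH hW ha hg hI); rewrite ?updE //=.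
move=> t M' R' J' d Xn ht hI' hS' q1 q2 q3 q4 q5 hR hF.
have hh j : j <= g -> updh hist g.+1 d j = hist j by move=> hj; rewrite /updh ltn_eqF.
have hX j : j <= g -> updh X g.+1 Xn j = X j by move=> hj; rewrite /updh ltn_eqF.
apply: (hQ _ _ _ J' _ _ _ hI').
- rewrite !addnA addnAC [_ + t]addnC -addnA.
  apply: (@icost_slack (60 * 100) (61 * 100) _ _ _ _ _ _ ht) => //; last exact: cost_at_gt0.
  exact: leq_trans hL (leq_addr _ _).
- case: (Good_ext hh hX hGd) => k1 k2; split => // g'; rewrite ltnS leq_eqVlt.
  by case/predU1P => [->//|]; apply: k2.
- exact: hh.
- exact: hX.
- by apply/regsOK_E; rewrite q1 q2 q3 q4 q5 !hR // !updE.
- exact: hF.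
- by rewrite hR // !updE.
Qed.

Lemma Consistent_frame hist X M M' J g : (forall f, f < 12 -> f != 5 -> fld M' f = fld M f) ->
  Consistent hist X M J g -> Consistent hist X M' J g.
Proof.
move=> hF [[h1 h2] h3 h4 h5 h6 h7 h8 h9 h10].
split; rewrite ?hF //; first by split; rewrite ?hF.
by move=> j hj; have := h10 j hj; rewrite /jr !hF.
Qed.

Lemma save_PInv hist X M M' R J g : bd H M' -> eqF [:: 12] M M' -> Consistent hist X M J g -> Good hist X g ->
  [seq fld M' 12 j | j <- iota 0 8] = [seq R r | r <- saved] -> regsOK R J g ->
  PInv hist X M' g.
Proof.
move=> hb hF hI hGd h12 hr; split => //; exists J; last by rewrite h12.
by apply: Consistent_frame hI => f hf _; apply: hF; [lia | rewrite inE ltn_eqF].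
Qed.

Lemma wp_call c M i (Q : nat -> (nat -> nat) -> seq nat -> Prop) : bd H M ->
  wp c M (fun=> 0) i [::] (fun t M' _ _ o' => bd H M' -> Q t M' o') ->
  exists t M' o', call B c M i t M' o' /\ Q t M' o'.
Proof.
move=> hb hw; have h0 : bd H (fun=> 0) by move=> x; lia.
have [t [M' [R' [i' [ o' [ex bM _ hQ]]]]]] := hw hb h0.
exists t, M', o'; split; last exact: hQ.
by exists (State M' R' i' o').
Qed.

Lemma insert_prog_spec hist X M g : g < size Es -> PInv hist X M g ->
  exists t M' o' hist' X', [/\ call B insert_prog M [:: src g; dst g; wgt g] t M' o',
    PInv hist' X' M' g.+1,
    (forall j, j <= g -> hist' j = hist j), (forall j, j <= g -> X' j = X j) &
    t <= 10 * icost X' g].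
Proof.
move=> hg [hbd [J hI h12] hGd].
pose Q t M' (o' : seq nat) := exists hist' X', [/\ PInv hist' X' M' g.+1,
    (forall j, j <= g -> hist' j = hist j), (forall j, j <= g -> X' j = X j) &
    t <= 10 * icost X' g].
suff hw : wp insert_prog M (fun=> 0) [:: src g; dst g; wgt g] [::]
    (fun t M' _ _ o' => bd H M' -> Q t M' o').
  have [t [M' [ o' [hc [hist' [X' [h1 h2 h3 h4]]]]]]] := wp_call hbd hw.
  by exists t, M', o', hist', X'.
sq; apply: load_spec => // t1 R1 ht1 _ hR1.
have hro : regsOK R1 J g by rewrite /regsOK hR1 h12.
sq; apply: (insert_edge_spec hg hI hGd hro).
move=> t2 M2 R2 J2 hist' X' ht2 hI2 hG2 hh hX hro2 _ _.
apply: save_spec => // t3 M3 ht3 hF3 _ h123 hb3.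
exists hist', X'; split => //; first exact: save_PInv hF3 hI2 hG2 h123 hro2.
by rewrite /= in ht1 ht3; lia.
Qed.

Definition edge_input g k := flatten [seq [:: src e; dst e; wgt e] | e <- iota g k].

Lemma init_prog_spec g0 : g0 <= size Es ->
  exists t M' o' hist X, [/\ call B init_prog (fun=> 0) ([:: n; s; W; a; b; g0] ++ edge_input 0 g0) t M' o',
    PInv hist X M' g0 & t <= 10 * \sum_(0 <= g < g0) icost X g + 500].
Proof.
move=> hg0.
have h2H : 2 * (size Es + 2) < H by apply: leq_ltn_trans hJH; rewrite expnS expn1; nia.
pose Q t M' (o' : seq nat) := exists hist X,
  PInv hist X M' g0 /\ t <= 10 * \sum_(0 <= g < g0) icost X g + 500.
have hb0 : bd H (fun=> 0) by move=> x; lia.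
suff hw : wp init_prog (fun=> 0) (fun=> 0) ([:: n; s; W; a; b; g0] ++ edge_input 0 g0) [::]
    (fun t M' _ _ o' => bd H M' -> Q t M' o').
  have [t [M' [ o' [hc [hist' [X' [h1 h2]]]]]]] := wp_call hb0 hw.
  by exists t, M', o', hist', X'.
sq; rd; first by lia.
sq; rd; first by lia.
sq; rd; first by lia.
sq; rd; first by lia.
sq; rd; first by lia.
sq; rd; first by lia.
sq; sto; first by move=> _ _ /=; lia.
sq; sto; first by move=> _ _ /=; lia.
sq; asg; first by move=> _ _ /=; lia.
sq; asg; first by move=> _ _ /=; lia.
have [hN hq] := hKH (leq0n _).
sq; apply: (set_q_spec H17 HB (a := a) (b := b) (k := 1)); rewrite ?updE //=.
move=> t1 ht1.
repeat (rewrite updE /=).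
set M0 := upd _ _ 1; set R0 := upd _ 1 _.
pose hist0 (j x : nat) := dec (x == s); pose X0 (j : nat) : seq nat := [::].
have f0 : fld M0 0 = fun x => (x == s) : nat.
  by rewrite /M0; flds; apply: funext => x; rewrite updE; case: eqP.
have f2 : fld M0 2 = fun x => (x == s) : nat.
  by rewrite /M0; flds; apply: funext => x; rewrite updE; case: eqP.
have ff f : f < 16 -> f != 0 -> f != 2 -> fld M0 f = fun=> 0.
  by move=> h1 h2 h3; rewrite /M0 !fld_other.
have hI0 : Consistent hist0 X0 M0 0 0.
  split => //.
  - by split => //; rewrite !ff.
  - by rewrite f0 ff //; apply: dist0.
  - by apply: pq_empty => i hi; rewrite ff.
  - by move=> x hx; rewrite f0 f2.
  - by move=> x hx; rewrite f0.
  - move=> j x _ hx; apply: (dec_leU hs); case: (x == s) => //=; lia.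
  - move=> j hj; rewrite ff //; split => //; move=> x hx; rewrite /jr /= f0 //.
have hG0 : Good hist0 X0 0 by split.
pose I k t (M1 R1 : nat -> nat) (i1 o1 : seq nat) := k <= g0 /\
  exists hist X J, [/\ Consistent hist X M1 J (g0 - k), Good hist X (g0 - k), regsOK R1 J (g0 - k),
    R1 21 = k /\ i1 = edge_input (g0 - k) k &
    t <= 10 * \sum_(0 <= g < g0 - k) icost X g].
sq; apply: (wp_while H17 HB (I := I) (k0 := g0)) => //.
- split => //; exists hist0, X0, 0; rewrite subnn; split => //.
- move=> k t M1 R1 i1 o1 [hk [hist [X [J [hI hGd hro [h21 hi1] ht]]]]].
  rewrite /= h21 => hne.
  case: k hk hI hGd hro h21 hi1 ht hne => // k hk hI hGd hro h21 hi1 ht _.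
  have hlt : g0 - k.+1 < size Es by lia.
  have e1 : (g0 - k.+1).+1 = g0 - k by lia.
  rewrite hi1 /edge_input /=.
  sq; apply: (insert_edge_spec hlt hI hGd hro).
  move=> t2 M2 R2 J2 hist' X' ht2 hI2 hG2 hh hX hro2 _ hR21.
  asg; reg; rewrite hR21 h21 subn1 /=; first by move=> _ _; lia.
  exists k => //; split; first by lia.
  rewrite e1 in hI2 hG2 hro2 *.
  exists hist', X', J2; split => //.
  rewrite -e1 big_nat_recr //= mulnDr.
  have -> : \sum_(0 <= g < g0 - k.+1) icost X' g = \sum_(0 <= g < g0 - k.+1) icost X g.
    rewrite big_nat_cond [RHS]big_nat_cond; apply: eq_bigr => g; rewrite andbT => hg.
    by rewrite /icost; congr (_ * _); apply: cost_at_ext => j hj; apply: hX; lia.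
  by lia.
- move=> k t M1 R1 i1 o1 [hk [hist [X [J [hI hGd hro [h21 hi1] ht]]]]].
  move=> k0; have {}k0 : k = 0 by rewrite -k0 -h21.
  rewrite k0 subn0 in hI hGd hro ht.
  apply: save_spec => // t3 M3 ht3 hF3 _ h123 hb3.
  exists hist, X; split; first exact: save_PInv hF3 hI hGd h123 hro.
  move: ht ht1 ht3; set A := \sum_(0 <= g < g0) _; rewrite [cost _]/= [size _]/=; clear.
  by lia.
Qed.

Lemma hist_U hist X M J g v : Consistent hist X M J g -> v < n ->
  (hist g v == U) = (fld M 0 v == 0) /\ (fld M 0 v != 0 -> hist g v = fld M 0 v - 1).
Proof.
move=> hI hv; rewrite (i_hist hI) //.
have hb := bound_U hs (distOK_bound (i_dist hI) hv).
have U0 : 0 < U by rewrite /U !muln_gt0 /= hW andbT; lia.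
case: (posnP (fld M 0 v)) => [->|h0]; first by rewrite dec0 eqxx.
by rewrite dec_pos // subn1; split => //; rewrite ltn_eqF //; lia.
Qed.

Lemma PInv_frame hist X M M' g : (forall f, f < 16 -> f != 5 -> fld M' f = fld M f) ->
  bd H M' -> PInv hist X M g -> PInv hist X M' g.
Proof.
move=> hF hb [_ [J hI h12] hGd]; split => //; exists J; last by rewrite hF.
by apply: Consistent_frame hI => f hf h5; apply: hF => //; lia.
Qed.

Lemma dist_prog_spec hist X M g v : PInv hist X M g -> v < n ->
  exists t M' o, [/\ call B dist_prog M [:: v] t M' o, PInv hist X M' g, t <= 60
    & o = if hist g v == U then [:: 0; 0] else [:: hist g v; 1]].
Proof.
move=> hP hv; have [hbd [J hI h12] hGd] := hP.
have [e1 e2] := hist_U hI hv.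
pose Q t M' (o : seq nat) := [/\ M' = M, t <= 60
  & o = if hist g v == U then [:: 0; 0] else [:: hist g v; 1]].
suff hw : wp dist_prog M (fun=> 0) [:: v] [::] (fun t M' _ _ o' => bd H M' -> Q t M' o').
  have [t [M' [ o' [hc [hM ht ho]]]]] := wp_call hbd hw.
  by exists t, M', o'; split => //; rewrite hM.
sq; rd; first by lia.
apply: (wp_ifb (b := fld M 0 v != 0) H17 HB) => // h.
- sq; wr; wr; reg => _; rewrite /Q e1 (negbTE h); split => //.
  by rewrite !fldE e2.
- by sq; wr; wr; reg => _; rewrite /Q e1 (negbNE h).
Qed.

Lemma path_prog_spec hist X M g v : PInv hist X M g -> g <= size Es -> v < n ->
  exists t M' o, [/\ call B path_prog M [:: v] t M' o, PInv hist X M' g,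
    hist g v = U -> t <= 60 /\ o = [::] &
    hist g v <> U -> exists es, [/\ ewalk Es s es v, all (fun e => e < g) es,
      uniq (s :: [seq dst e | e <- es]), o = s :: [seq dst e | e <- es] &
      len es <= hist g v /\ t <= 200 * maxn (size es) 1]].
Proof.
move=> hP hg hv; have [hbd [J hI h12] hGd] := hP.
have [e1 e2] := hist_U hI hv.
pose Q t M' (o : seq nat) := (forall f, f < 16 -> f != 5 -> fld M' f = fld M f) /\
  [/\ bd H M', hist g v = U -> t <= 60 /\ o = [::] &
    hist g v <> U -> exists es, [/\ ewalk Es s es v, all (fun e => e < g) es,
      uniq (s :: [seq dst e | e <- es]), o = s :: [seq dst e | e <- es] &
      len es <= hist g v /\ t <= 200 * maxn (size es) 1]].
suff hw : wp path_prog M (fun=> 0) [:: v] [::] (fun t M' _ _ o' => bd H M' -> Q t M' o').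
  have [t [M' [ o' [hc [hF [hb h1 h2]]]]]] := wp_call hbd hw.
  by exists t, M', o'; split => //; apply: PInv_frame hP.
have hD := i_dist hI.
sq; rd; first by lia.
apply: (wp_ifb (b := fld M 0 v != 0) H17 HB) => // h; last first.
  apply: wp_skip => hb; split => //; split => //.
  by move=> hne; case: hne; apply/eqP; rewrite e1; apply: negbNE.
have [es [k1 k2 k3 k4 k5]] := par_path hEs hD hg hv h.
have hu : uniq (s :: [seq dst e | e <- es]).
  apply: (@sorted_uniq _ (fun x y => fld M 0 x < fld M 0 y)) => //.
  - by move=> x y z; apply: ltn_trans.
  - by move=> x; apply: ltnn.
have hdsn es' : all (fun e => e < g) es' -> all (fun x => x < n) [seq dst e | e <- es'].
  rewrite all_map => /allP hh; apply/allP => e /hh /= he.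
  by have [] := hEs (leq_trans he hg).
have hsz : size es < n.
  have := uniq_leq_size hu (s2 := iota 0 n); rewrite /= size_map size_iota; apply.
  move=> x; rewrite inE mem_iota add0n => /orP [/eqP ->|hx] //.
  exact: (allP (hdsn _ k2)).
have hlen : len es <= hist g v by rewrite e2 //; lia.
set p := [seq dst e | e <- es] in hu k4.
have hp : size p = size es by rewrite size_map.
sq; asg; first by move=> _ _ /=; lia.
sq.
(* [k] edges of the path are still to be climbed; stack cell [j] holds the vertex [j] places before
   the end of the path. *)
pose I k t (M1 R1 : nat -> nat) (i1 o1 : seq nat) := o1 = [::] /\
  k <= size es /\ R1 8 = size es - k /\ t <= 60 * (size es - k) /\
  R1 7 = last s (take k p) /\
  (forall f, f < 16 -> f != 5 -> fld M1 f = fld M f) /\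
  (forall j, j < size es - k -> fld M1 5 j = nth 0 p (size es - j.+1)).
have hD0 k x : k < size es -> x = last s (take k.+1 p) ->
    [/\ 1 < fld M 0 x, fld M 1 x = last s (take k p), x = nth 0 p k & x < n].
  move=> hk; rewrite (take_nth 0) ?hp // last_rcons => ->.
  have hxn : nth 0 p k < n by apply: (allP (hdsn _ k2)); rewrite mem_nth ?hp.
  have heq : nth 0 p k = dst (nth 0 es k) by rewrite /p (nth_map 0).
  split => //.
  - have hall : all (fun x => fld M 0 s < fld M 0 x) p.
      by apply: order_path_min k4 => y1 y2 y3; apply: ltn_trans.
    by have := allP hall _ (mem_nth 0 (s := p) (n := k) ltac:(by rewrite hp)); rewrite (d_src hD).
  - have /eqP := allP k3 _ (mem_nth 0 hk); rewrite -heq => ->.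
    have hk1 := k1; rewrite -(cat_take_drop k es) (drop_nth 0) // in hk1.
    move: hk1; rewrite /p -map_take; move: (take k es) => l1; move: (drop _ _) => l2.
    by elim: l1 (s) => [|e l1 IHl] y1 /= [q1 q2]; [exact: q1 | exact: IHl q2].
apply: (wp_while H17 HB (I := I) (k0 := size es)) => //.
- split => //; rewrite subnn; do 3!split => //; split; last by split.
  by rewrite -hp take_size (ewalk_last k1) updE.
- move=> k t M1 R1 i1 o1 [-> [hk [r8 [ht [r7 [hF hsc]]]]]].
  rewrite /= fldE hF // r7 => hne.
  case: k hk r8 ht r7 hsc hne => [|k] hk r8 ht r7 hsc hne.
    by move: hne; rewrite take0 /= (d_src hD).
  have [d1 d2 d3 d4] := hD0 k _ hk erefl.
  have hkk : size es - k = (size es - k.+1).+1 by lia.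
  sq; sto; first by move=> bM bR; apply: bR.
  sq; asg; reg; rewrite r8; first by move=> _ _; lia.
  asg; first by move=> bM bR; apply: bM.
  reg; rewrite r7 cell_neq // fldE hF // d2.
  exists k => //; split => //; split; first by lia.
  split; first by rewrite updE /= updE /= addn1 hkk.
  split; first by lia.
  split; first by rewrite updE.
  split; first by move=> f hf h5; rewrite fld_other // hF.
  move=> j hj; flds; rewrite updE; case: eqP => [->|hne2].
    by rewrite d3; congr (nth _ _ _); lia.
  by apply: hsc; lia.
- move=> k t M1 R1 i1 o1 [-> [hk [r8 [ht [r7 [hF hsc]]]]]].
  rewrite /= fldE hF // r7 => he.
  have k0 : k = 0.
    by case: k hk he {r7 ht hsc r8} => // k hk; have [-> _ _ _] := hD0 k _ hk erefl.
  rewrite k0 subn0 take0 /= in r7 r8 ht hsc.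
  sq; wr; rewrite /= r7.
  pose I2 k t' (M2 R2 : nat -> nat) (i2 o2 : seq nat) := M2 = M1 /\ k <= size es /\
    R2 8 = k /\ t' <= 60 * (size es - k) /\ o2 = s :: take (size es - k) p.
  apply: (wp_while H17 HB (I := I2) (k0 := size es)) => //.
  + by do 3!split => //; rewrite subnn take0.
  + move=> k' t' M2 R2 i2 o2 [-> [hk' [q8 [ht' ->]]]].
    rewrite /= q8 => hne; case: k' hk' q8 ht' hne => // k' hk' q8 ht' _.
    sq; asg; reg; rewrite q8 subn1 /=; first by move=> _ _; lia.
    wr; reg; rewrite fldE hsc //.
    exists k' => //; split => //; split; first by lia.
    split => //; split; first by lia.
    have -> : size es - k' = (size es - k'.+1).+1 by lia.
    by rewrite (take_nth 0) ?hp -?rcons_cons //; lia.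
  + move=> k' t' M2 R2 i2 o2 [-> [hk' [q8 [ht' ->]]]].
    rewrite /= q8 => k0' hb; rewrite k0' subn0 in ht' *.
    split => //; split => //.
      by move=> hU; move: h; rewrite -e1 hU eqxx.
    move=> _; exists es; split => //; first by rewrite -hp take_size.
    split => //; lia.
Qed.

End Procs.

(** * Logarithmic estimates of the running time *)

Section RealBound.
Local Open Scope ring_scope.
Variable R : realType.

(** This is [ln (1 + x) <= x] at [x = - 1 / 2]. *)
Lemma ln2_ge : (2^-1 : R) <= ln 2.
Proof.
have h : ln (2^-1 : R) <= - 2^-1.
  have := @le_ln1Dx R (- 2^-1) ltac:(lra).
  by rewrite (_ : 1 + - 2^-1 = 2^-1 :> R) //; lra.
by rewrite lnV ?posrE // in h; lra.
Qed.

Lemma ln2_le1 : ln 2 <= (1 : R).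
Proof. by have := @le_ln1Dx R 1 ltac:(lra); rewrite (_ : 1 + 1 = 2 :> R) //; lra. Qed.

Lemma exp2_ln (k x : nat) : (0 < x)%N -> (2 ^ k <= x)%N -> (k%:R : R) <= 2 * ln x%:R.
Proof.
move=> hx h.
have h1 : ln ((2 ^ k)%N%:R : R) <= ln x%:R.
  by rewrite ler_ln ?posrE ?ltr0n ?expn_gt0 // ler_nat.
rewrite natrX lnXn // in h1.
have := ln2_ge; have k0 : (0 : R) <= k%:R by apply: ler0n.
rewrite -[ln _ *+ _]mulr_natr in h1; move=> h2.
have : k%:R * 2^-1 <= ln 2 * k%:R :> R by rewrite mulrC ler_wpM2r.
by move=> h3; lra.
Qed.

(** The hypothesis says [c * ln (1 + 1 / Q) <= ln U], and [ln (1 + 1 / Q) >= 1 / (Q + 1)] is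
    [ln (1 + x) <= x] at [x = - 1 / (Q + 1)]. *)
Lemma count_ln (Q U c : nat) : (0 < Q)%N -> (0 < U)%N ->
  ((Q + 1) ^ c <= Q ^ c * U)%N -> (c%:R : R) <= (Q + 1)%:R * ln U%:R.
Proof.
move=> hQ hU h.
have Q0 : (0 : R) < Q%:R by rewrite ltr0n.
have Q1 : (0 : R) < (Q + 1)%:R by rewrite ltr0n addn1.
have h1 : ln (((Q + 1) ^ c)%N%:R : R) <= ln (Q ^ c * U)%N%:R.
  by rewrite ler_ln ?posrE ?ltr0n ?muln_gt0 ?expn_gt0 ?hQ ?hU ?addn1 // ler_nat -addn1.
rewrite natrM !natrX lnM ?posrE ?exprn_gt0 ?ltr0n // !lnXn // in h1.
have h2 : (Q + 1)%:R^-1 <= ln (Q + 1)%:R - ln Q%:R :> R.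
  have := @le_ln1Dx R (- (Q + 1)%:R^-1).
  have i1 : (Q + 1)%:R^-1 < 1 :> R.
    by rewrite invf_lt1 // natrD; lra.
  move=> /(_ ltac:(lra)).
  have -> : 1 - (Q + 1)%:R^-1 = Q%:R / (Q + 1)%:R :> R.
    by rewrite natrD; field; rewrite lt0r_neq0 //; lra.
  by rewrite lnM ?posrE ?invr_gt0 // lnV ?posrE //; lra.
rewrite -![ln _ *+ _]mulr_natl in h1.
have c0 : (0 : R) <= c%:R by apply: ler0n.
have h3 : c%:R * (Q + 1)%:R^-1 <= ln U%:R :> R.
  by apply: le_trans (ler_wpM2l c0 h2) _; rewrite mulrBr; lra.
by rewrite mulrC -ler_pdivrMr.
Qed.

(** With [e = min 1 eps], both 1 and [1 / eps] are at most [1 / e], so the quotient in [qf] costs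
    [2 * N / e] and the rest at most [(2 * N + 2) / e]. *)
Lemma qf_le (a b k : nat) : (0 < a)%N -> (0 < b)%N ->
  (qf a b k + 1)%:R <= (4 * (qN k)%:R + 2) / Num.min 1 (a%:R / b%:R) :> R.
Proof.
move=> ha hb.
have a0 : (0 : R) < a%:R by rewrite ltr0n.
have b0 : (0 : R) < b%:R by rewrite ltr0n.
set e := Num.min _ _.
have e0 : 0 < e by rewrite lt_min ltr01 divr_gt0.
have e1 : e <= 1 by rewrite ge_min lexx.
have e2 : e <= a%:R / b%:R by rewrite ge_min lexx orbT.
have N0 : (0 : R) <= (qN k)%:R by apply: ler0n.
rewrite ler_pdivlMr // /qf.
set N := qN k in N0 *; set d := (_ %/ a)%N.
have hd : d%:R * a%:R <= N%:R * (a%:R + b%:R) :> R.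
  by rewrite -natrD -!natrM ler_nat leq_divM.
have hde : d%:R * e <= 2 * N%:R.
  have i1 : d%:R <= N%:R * (a%:R + b%:R) / a%:R :> R by rewrite ler_pdivlMr.
  apply: le_trans (ler_wpM2r (ltW e0) i1) _.
  have -> : N%:R * (a%:R + b%:R) / a%:R * e = N%:R * e + N%:R * (e * (b%:R / a%:R)) :> R.
    by field; rewrite lt0r_neq0.
  have i2 : e * (b%:R / a%:R) <= 1.
    apply: le_trans (ler_wpM2r (ltW (divr_gt0 b0 a0)) e2) _.
    by rewrite (_ : _ * _ = 1) //; field; rewrite !lt0r_neq0.
  have := ler_wpM2l N0 e1; have := ler_wpM2l N0 i2; lra.
have -> : (d + (2 * N + 1) + 1)%:R = d%:R + 2 * N%:R + 2 :> R.
  by rewrite 3!natrD (natrM _ 2 N); lra.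
have := ler_wpM2l N0 e1.
by move=> h; nra.
Qed.

(** The five logarithmic factors: one from the height of the tournament tree and [kf], two from the
    two occurrences of [trunc_log 2 m], one from [kf] inside [q], and one from [ln U]. The constant
    is [10 * 6100 * 4 * 1100 + 500]. *)
Lemma total_bound (n m W a b T C : nat) : (0 < n)%N -> (0 < W)%N -> (0 < a)%N -> (0 < b)%N ->
  (m <= n * n)%N ->
  (61 * 100 * 10 * 44 * 100 + 500 <= C%:R :> R) ->
  (forall cmax, (forall c, (qf a b (kf m) + 1) ^ c <= qf a b (kf m) ^ c * U n W -> c <= cmax)%N ->
     (T <= 10 * ((61 * 100) * ((trunc_log 2 n).+2 + kf m) *
        ((m + 1) * (2 * 2 ^ kf m) + (trunc_log 2 m).+1 * (m + 2 * m * ((trunc_log 2 m).+1 * cmax))))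
        + 500)%N) ->
  T%:R <= C%:R * (1 + ln n%:R) ^+ 5 * ((maxn m 1)%:R `^ (3%:R / 2%:R))
           * (1 + ln W%:R) / Num.min 1 (a%:R / b%:R) :> R.
Proof.
move=> hn hW ha hb hm hC hT.
set Q := qf a b (kf m) in hT.
have hQ0 : (0 < Q)%N := qf_gt0 a b _.
have hU0 : (0 < U n W)%N by rewrite /U !muln_gt0 hn hW.
have nn0 : (0 < n * n)%N by rewrite muln_gt0 hn.
have n1 : (1 : R) <= n%:R by rewrite ler1n.
have lnn : (0 : R) <= ln n%:R by apply: ln_ge0.
have lnW : (0 : R) <= ln W%:R by apply: ln_ge0; rewrite ler1n.
pose cm := Num.truncn ((Q + 1)%:R * ln (U n W)%:R : R).
have hcm0 : (0 : R) <= (Q + 1)%:R * ln (U n W)%:R.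
  by rewrite mulr_ge0 // ln_ge0 // ler1n.
have hcm c : ((Q + 1) ^ c <= Q ^ c * U n W)%N -> (c <= cm)%N.
  by move=> h; rewrite truncn_ge_nat //; apply: count_ln.
have {}hT := hT cm hcm; move: hT hC.
have hcmR : cm%:R <= (Q + 1)%:R * ln (U n W)%:R :> R by rewrite truncn_le.
set l : R := 1 + ln n%:R; set w : R := 1 + ln W%:R.
have l1 : 1 <= l by rewrite /l; lra.
have w1 : 1 <= w by rewrite /w; lra.
set e := Num.min _ _.
have e0 : 0 < e by rewrite lt_min ltr01 divr_gt0 // ltr0n.
have e1 : e <= 1 by rewrite ge_min lexx.
have hU : ln (U n W)%:R <= l * w.
  rewrite /U natrM lnM ?posrE ?ltr0n ?muln_gt0 // natrM lnM ?posrE ?ltr0n //.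
  have := ln2_le1; have := mulr_ge0 lnn lnW.
  by rewrite /l /w mulrDl !mulrDr !mul1r; lra.
set m1 : R := (maxn m 1)%:R.
have m11 : 1 <= m1 by rewrite /m1 ler1n leq_maxr.
have m10 : 0 <= m1 by lra.
set r := Num.sqrt m1.
have rr : r * r = m1 by rewrite -expr2 sqr_sqrtr.
have r0 : 0 <= r by apply: sqrtr_ge0.
have r1 : 1 <= r by nra.
have -> : m1 `^ (3%:R / 2%:R) = m1 * r.
  have -> : 3%:R / 2%:R = 1 + 2^-1 :> R by lra.
  rewrite powRD ?powRr1 ?powR12_sqrt //.
  by apply/implyP => _; rewrite lt0r_neq0 //; lra.
have mm1 : m%:R <= m1 by rewrite /m1 ler_nat leq_maxl.
have hmm : (maxn m 1 <= n * n)%N by rewrite geq_max hm.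
have hK : (2 ^ kf m)%N%:R <= 2 * r.
  have h : (2 ^ kf m)%N%:R * (2 ^ kf m)%N%:R <= (2 * r) * (2 * r) :> R.
    rewrite mulrACA rr -natrM -natrM -natrM ler_nat mulnn; exact: kf_lb.
  by rewrite -ler_sqr ?nnegrE ?mulr_ge0 // !expr2.
have hKn : (2 ^ kf m <= 2 * n)%N.
  rewrite -leq_sqr; apply: leq_trans (kf_lb m) _.
  by rewrite expnMn leq_mul2l -mulnn hmm.
have hkf : (kf m)%:R <= 2 * l.
  have := exp2_ln _ hKn; rewrite muln_gt0 hn => /(_ isT).
  rewrite natrM lnM ?posrE ?ltr0n // /l.
  by have := ln2_le1; lra.
have htl : (trunc_log 2 n)%:R <= 2 * ln n%:R :> R.
  by apply: exp2_ln => //; apply: trunc_logP.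
have hL : (trunc_log 2 m).+1%:R <= 4 * l.
  case: (posnP m) => [->|m0].
    by rewrite (_ : trunc_log 2 0 = 0)%N //; lra.
  have h : (trunc_log 2 m)%:R <= 2 * ln (n * n)%:R :> R.
    by apply: exp2_ln => //; apply: leq_trans hm; apply: trunc_logP.
  rewrite natrM lnM ?posrE ?ltr0n // in h.
  by rewrite -addn1 natrD /l; lra.
have hN : (qN (kf m))%:R <= 8 * (r * l).
  rewrite /qN !natrM.
  have := ler_pM (ler0n R _) (ler0n R _) hK hkf; lra.
have hQ : (Q + 1)%:R <= 34 * (r * l) / e.
  apply: le_trans (qf_le _ ha hb) _; rewrite -/e ler_wpM2r ?invr_ge0 ?(ltW e0) //.
  have : 1 <= r * l by nra.
  by move=> ?; lra.
have rl1 : 1 <= r * l by nra.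
have hcmB : cm%:R <= 34 * (r * (l * l)) * w / e.
  apply: le_trans hcmR _.
  have := ler_pM (ler0n R _) (ln_ge0 _) hQ hU.
  rewrite ler1n hU0 => /(_ isT) h; apply: le_trans h _.
  by rewrite (_ : 34 * (r * l) / e * (l * w) = 34 * (r * (l * l)) * w / e) //; ring.
set c : R := cm%:R in hcmB.
have c0 : 0 <= c by apply: ler0n.
set L : R := (trunc_log 2 m).+1%:R in hL.
have L0 : 0 <= L by apply: ler0n.
set K : R := (2 ^ kf m)%N%:R in hK.
have K0 : 0 <= K by apply: ler0n.
(* The size of the exploration term [b3]. The terms [b1] and [b2] are absorbed because [r], [l], [w]
   and [1 / e] are at least 1. *)
set F : R := m1 * r * (l * l * l * l) * w / e.
have ei1 : 1 <= e^-1 by rewrite invf_ge1.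
have F0 : m1 * r * (l * l * l * l) * w <= F by rewrite /F ler_peMr // ?mulr_ge0 // (le_trans ler01).
have m1r : 1 <= m1 * r by apply: mulr_ege1.
have F1 : m1 * r <= F.
  apply: le_trans F0.
  have lw : 1 <= l * l * l * l * w by do ![apply: mulr_ege1 => //].
  have m1r0 : 0 <= m1 * r by lra.
  have := ler_wpM2l m1r0 lw; rewrite mulr1 => h; apply: le_trans h _.
  by rewrite le_eqVlt; apply/orP; left; apply/eqP; ring.
have F2 : m1 * l <= F.
  apply: le_trans F0.
  have lw : 1 <= r * (l * l * l * w) by do ![apply: mulr_ege1 => //].
  have m1l : 0 <= m1 * l by apply: mulr_ge0; lra.
  have := ler_wpM2l m1l lw; rewrite mulr1 => h; apply: le_trans h _.
  by rewrite le_eqVlt; apply/orP; left; apply/eqP; ring.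
have mR0 : (0 : R) <= m%:R by apply: ler0n.
have b1 : (m%:R + 1) * (2 * K) <= 8 * F.
  have : (m%:R + 1) * (2 * K) <= (2 * m1) * (2 * (2 * r)) by clear -mm1 m11 mR0 K0 hK; apply: ler_pM; lra.
  by lra.
have b2 : L * m%:R <= 4 * F.
  have : L * m%:R <= (4 * l) * m1 by clear -L0 mR0 hL mm1; apply: ler_pM; lra.
  by lra.
have b3 : L * (2 * m%:R * (L * c)) <= 1088 * F.
  have i1 : L * c <= 4 * l * (34 * (r * (l * l)) * w / e) by apply: ler_pM.
  have i2 : 2 * m%:R * (L * c) <= 2 * m1 * (4 * l * (34 * (r * (l * l)) * w / e)).
    by apply: ler_pM; [apply: mulr_ge0|apply: mulr_ge0|lra|].
  have i3 : L * (2 * m%:R * (L * c)) <= 4 * l * (2 * m1 * (4 * l * (34 * (r * (l * l)) * w / e))).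
    by apply: ler_pM => //; do ![apply: mulr_ge0 => //].
  apply: le_trans i3 _; rewrite le_eqVlt; apply/orP; left; apply/eqP.
  by rewrite /F; ring.
have hS : ((trunc_log 2 n).+2 + kf m)%N%:R <= 4 * l.
  by rewrite natrD -addn2 natrD /l; rewrite /l in hkf; lra.
have F00 : 0 <= F by clear -F1 m1r; lra.
move=> hT hC.
have hX : ((m + 1) * (2 * 2 ^ kf m) + (trunc_log 2 m).+1 *
    (m + 2 * m * ((trunc_log 2 m).+1 * cm)))%N%:R <= 1100 * F :> R.
  have -> : ((m + 1) * (2 * 2 ^ kf m) + (trunc_log 2 m).+1 *
      (m + 2 * m * ((trunc_log 2 m).+1 * cm)))%N%:R =
      (m%:R + 1) * (2 * K) + (L * m%:R + L * (2 * m%:R * (L * c))) :> R.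
    by rewrite /K /L /c; ring.
  by clear -b1 b2 b3; lra.
have hTR : T%:R <= 10 * (61 * 100 * (4 * l) * (1100 * F)) + 500.
  have h : T%:R <= (10 * ((61 * 100) * ((trunc_log 2 n).+2 + kf m) *
        ((m + 1) * (2 * 2 ^ kf m) + (trunc_log 2 m).+1 * (m + 2 * m * ((trunc_log 2 m).+1 * cm))))
        + 500)%N%:R :> R by rewrite ler_nat.
  apply: le_trans h _.
  have p1 := ler_pM (ler0n R _) (ler0n R _) hS hX.
  move: p1; set x1 := (_ + kf m)%N; set x2 := (_ + _ * (m + _))%N => p1.
  have -> : (10 * (61 * 100 * x1 * x2) + 500)%N%:R = 10 * (61 * 100 * (x1%:R * x2%:R)) + 500 :> R.
    by rewrite natrD natrM [(_ * x2)%:R]natrM [(_ * x1)%:R]natrM [(61 * 100)%:R]natrM; ring.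
  by clear -p1; lra.
apply: le_trans hTR _.
have -> : C%:R * l ^+ 5 * (m1 * r) * w / e = C%:R * (l * F) by rewrite /F; ring.
have lF : 1 <= l * F by clear -l1 F1 m1r; nra.
have h1 := ler_wpM2r (ltW (lt_le_trans ltr01 lF)) hC.
by clear -h1 lF; lra.
Qed.

End RealBound.

(** * Incremental shortest paths *)

Section Convert.
Variables (n : nat) (s : 'I_n) (w : 'I_n -> 'I_n -> nat).
Implicit Types (E : seq ('I_n * 'I_n)) (p : seq 'I_n) (v : 'I_n).

Definition triples E := [seq (nat_of_ord e.1, nat_of_ord e.2, w e.1 e.2) | e <- E].

Lemma triplesE E e : e < size E ->
  let uv := nth (s, s) E e in
  [/\ src (triples E) e = uv.1, dst (triples E) e = uv.2 & wgt (triples E) e = w uv.1 uv.2].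
Proof. by move=> he; rewrite /src /dst /wgt /triples (nth_map (s, s)). Qed.

Definition heads E es : seq 'I_n := [seq (nth (s, s) E e).2 | e <- es].

Lemma ewalk_path E g x es v : g <= size E -> all (fun e => e < g) es ->
  ewalk (triples E) (nat_of_ord x) es v ->
  [/\ path (fun y z => (y, z) \in take g E) x (heads E es),
      nat_of_ord (last x (heads E es)) = v &
      path_length w x (heads E es) = len (triples E) es].
Proof.
move=> hg; elim: es x => [|e es IH] x /=.
  by move=> _ ->; split => //; rewrite /path_length /len !big_nil.
case/andP => he hall; have heE := leq_trans he hg.
have [h1 h2 h3] := triplesE heE.
rewrite h1 h2 => [[hx hw]].
have [k1 k2 k3] := IH _ hall hw.
have ex : x = (nth (s, s) E e).1 by apply: val_inj.
split => //.
- rewrite k1 andbT ex -surjective_pairing -(nth_take (s, s) he).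
  by apply: mem_nth; rewrite size_takel.
- by rewrite /path_length /len !big_cons /= h3 -ex; congr (_ + _).
Qed.

Lemma heads_val E g es : g <= size E -> all (fun e => e < g) es ->
  [seq dst (triples E) e | e <- es] = [seq nat_of_ord x | x <- heads E es].
Proof.
move=> hg /allP hall; rewrite /heads -map_comp; apply/eq_in_map => e /hall he /=.
by have [_ -> _] := triplesE (leq_trans he hg).
Qed.

(** Without duplicates, the index of an edge in [E] is its insertion number, so edges of [take g E]
    get numbers below [g]. *)
Lemma path_ewalk E g x p : g <= size E -> uniq E ->
  path (fun y z => (y, z) \in take g E) x p ->
  let es := [seq index e E | e <- zip (x :: p) p] in
  [/\ all (fun e => e < g) es, ewalk (triples E) x es (last x p)
    & path_length w x p = len (triples E) es].
Proof.
move=> hg hu; elim: p x => [|y p IH] x /=.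
  by move=> _; split => //; rewrite /path_length /len !big_nil.
case/andP => hxy hp; have [h1 h2 h3] := IH _ hp.
have hE : (x, y) \in E by apply: mem_take hxy.
have hi : index (x, y) E < size E by rewrite index_mem.
have [k1 k2 k3] := triplesE hi.
rewrite nth_index //= in k1 k2 k3.
split.
- rewrite h1 andbT; have := hxy; rewrite -index_mem size_takel // => hlt.
  have -> : index (x, y) E = index (x, y) (take g E) by rewrite -{1}(cat_take_drop g E) index_cat hxy.
  by [].
- by rewrite k1 k2.
- by rewrite /path_length /len !big_cons /= k3; congr (_ + _).
Qed.

(** Edges of a simple path have distinct heads. *)
Lemma uniq_pairs E x p : uniq E -> all (mem E) (zip (x :: p) p) -> uniq p ->
  uniq [seq index e E | e <- zip (x :: p) p].
Proof.
move=> hu /allP hall hp.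
rewrite map_inj_in_uniq.
  apply: (@map_uniq _ _ snd).
  rewrite -/(unzip2 _) (_ : unzip2 _ = p) // unzip2_zip //=.
by move=> e f /hall he /hall hf hi; rewrite -(nth_index (s, s) he) hi nth_index.
Qed.

Lemma path_pairs E g x p : path (fun y z => (y, z) \in take g E) x p ->
  all (mem E) (zip (x :: p) p).
Proof.
elim: p x => //= y p IH x /andP [h1 h2].
by rewrite IH // andbT; apply: mem_take h1.
Qed.

Lemma path_length_gt0 E x p : (forall e, e \in E -> 1 <= w e.1 e.2) ->
  path (fun y z => (y, z) \in E) x p -> (0 < path_length w x p) = (0 < size p).
Proof.
move=> hw; case: p => [|y p] /=; first by rewrite /path_length big_nil.
by case/andP => h1 _; rewrite /path_length big_cons addn_gt0 /= (hw _ h1).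
Qed.

Lemma path_length_le E W x p : (forall e, e \in E -> w e.1 e.2 <= W) ->
  path (fun y z => (y, z) \in E) x p -> path_length w x p <= W * size p.
Proof.
move=> hw; elim: p x => [|y p IH] x /=; first by rewrite /path_length big_nil.
case/andP => h1 /IH h2; rewrite /path_length big_cons /= mulnS.
by apply: leq_add => //; apply: (hw (x, y)).
Qed.

End Convert.

(** * Running the program on a given instance *)

Section Main.
Variables (n : nat) (s : 'I_n) (w : 'I_n -> 'I_n -> nat) (W a b : nat).
Variables (E0 : seq ('I_n * 'I_n)) (rs0 : seq (request n)).
Local Notation E := (E0 ++ inserted rs0).
Hypothesis ha : 0 < a.
Hypothesis hb : 0 < b.
Hypothesis hu : uniq E.
Hypothesis hw : forall e, e \in E -> 1 <= w e.1 e.2 <= W.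
Hypothesis hW : 1 <= W.
Local Notation Es := (triples w E).
Local Notation m := (size E).
Definition Zb := n + W + a + b + 2.
(** The bounds below need powers of [Zb] up to the seventh, which leaves room in [Hb]; [Bb] is the
    eighth power of [Hb], as required for intermediate results. *)
Definition Hb := Zb ^ 10.
Definition Bb := Zb ^ 80.
Definition Lm := (trunc_log 2 n).+2.

Lemma n_gt0 : 0 < n. Proof. exact: leq_ltn_trans (leq0n _) (ltn_ord s). Qed.

Lemma size_Es : size Es = m. Proof. by rewrite size_map. Qed.

Lemma size_le_sq : m <= n * n.
Proof. by rewrite -(card_uniqP hu) (leq_trans (max_card _)) // card_prod card_ord. Qed.

Lemma Zb6 : 6 <= Zb. Proof. by have := n_gt0; rewrite /Zb; lia. Qed.

Lemma pow_le_H x k : x <= Zb ^ k -> k <= 9 -> x < Hb.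
Proof.
move=> h hk; apply: leq_ltn_trans h _; rewrite /Hb ltn_exp2l //.
by have := Zb6; lia.
Qed.

Lemma B_H : Hb ^ 8 <= Bb. Proof. by rewrite /Hb /Bb -expnM. Qed.

Lemma H17 : 17 <= Hb.
Proof.
apply: (@pow_le_H 16 2) => //; have := Zb6; rewrite expnS expn1 => h.
by have := leq_mul h h; lia.
Qed.

Lemma hLm : 2 * n <= 2 ^ Lm.
Proof.
rewrite /Lm expnS leq_mul2l /=; exact: ltnW (trunc_log_ltn n (isT : 1 < 2)).
Qed.

Lemma H_n : 2 * n < Hb.
Proof.
apply: (@pow_le_H _ 2) => //; rewrite expnS expn1; apply: leq_mul; last by rewrite /Zb; lia.
by have := Zb6; lia.
Qed.

Lemma H_Wn : 1 + W * n < Hb.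
Proof.
apply: (@pow_le_H _ 3) => //.
have h : W * n <= Zb ^ 2 by rewrite expnS expn1; apply: leq_mul; rewrite /Zb; lia.
have h6 := Zb6; rewrite expnS.
have : 6 * Zb ^ 2 <= Zb * Zb ^ 2 by rewrite leq_mul2r h6 orbT.
have : 0 < Zb ^ 2 by rewrite expn_gt0; lia.
lia.
Qed.

Lemma H_ab : a + b + W < Hb.
Proof. by apply: (@pow_le_H _ 1) => //; rewrite expn1 /Zb; lia. Qed.

Lemma nn_Z : n * n <= Zb ^ 2.
Proof. by rewrite expnS expn1; apply: leq_mul; rewrite /Zb; lia. Qed.

Lemma H_m : 2 * (size Es + 2) ^ 2 < Hb.
Proof.
rewrite size_Es; apply: (@pow_le_H _ 7) => //.
have h : m + 2 <= Zb ^ 3.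
  have h6 := Zb6; have h1 := leq_trans size_le_sq nn_Z; rewrite expnS.
  have : 6 * Zb ^ 2 <= Zb * Zb ^ 2 by rewrite leq_mul2r h6 orbT.
  have : 0 < Zb ^ 2 by rewrite expn_gt0; lia.
  lia.
rewrite (expnS Zb 6); apply: leq_mul; first by have := Zb6; lia.
by rewrite (expnM Zb 3 2) leq_sqr.
Qed.

Lemma H_K g : g <= size Es -> qN (kf g) < Hb /\ qf a b (kf g) < Hb.
Proof.
rewrite size_Es => hg.
have hK : 2 ^ kf g <= 2 * n.
  rewrite -leq_sqr; apply: leq_trans (kf_lb g) _.
  rewrite expnMn leq_mul2l -mulnn geq_max (leq_trans hg size_le_sq) /=.
  by rewrite muln_gt0 n_gt0.
have hk : kf g <= 2 * n := leq_trans (ltnW (ltn_expl _ (isT : 1 < 2))) hK.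
have hZn : 2 * n <= Zb ^ 2.
  by rewrite expnS expn1; apply: leq_mul; have := Zb6; rewrite /Zb; lia.
have hN : qN (kf g) <= Zb ^ 5.
  rewrite /qN (_ : 5 = 1 + 2 + 2) // !expnD expn1; apply: leq_mul; first apply: leq_mul.
  - by have := Zb6; lia.
  - exact: leq_trans hK hZn.
  - exact: leq_trans hk hZn.
split; first by apply: (@pow_le_H _ 5).
apply: (@pow_le_H _ 7) => //; rewrite /qf.
have h1 : qN (kf g) * (a + b) %/ a <= Zb ^ 5 * Zb.
  by apply: leq_trans (leq_div _ _) _; apply: leq_mul => //; rewrite /Zb; lia.
have h6 := Zb6.
have hp : 0 < Zb ^ 5 by rewrite expn_gt0; lia.
have e : Zb ^ 7 = Zb * (Zb ^ 5 * Zb) by rewrite [RHS]mulnA -expnS -expnSr.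
have : 6 * (Zb ^ 5 * Zb) <= Zb ^ 7 by rewrite e leq_mul2r h6 orbT.
have : Zb ^ 5 * 6 <= Zb ^ 5 * Zb by rewrite leq_mul2l h6 orbT.
move: h1 hN; set A := _ %/ a; lia.
Qed.

Lemma Es_ok e : e < size Es -> [/\ src Es e < n, dst Es e < n & 1 <= wgt Es e <= W].
Proof.
rewrite size_Es => he; have [-> -> ->] := triplesE s w he.
by split; rewrite ?ltn_ord //; apply: hw; apply: mem_nth.
Qed.

Local Notation PInv := (PInv Hb n s W a b Es).
Local Notation Good := (Good n s W a b Es).
Local Notation U := (U n W).
Local Notation icost := (icost Lm Es).
Local Notation len := (len Es).
Implicit Types (hist : nat -> nat -> nat) (X : nat -> seq nat).

Definition G i := size E0 + i.

Definition entry_ok hist (x : entry n) : Prop :=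
  let g := G (stage x) in
  match req x with
  | Insert _ _ => True
  | QueryDist v => time x <= 60 /\
      answer x = if hist g v == U then [:: 0; 0] else [:: hist g v; 1]
  | QueryPath v => [/\ g <= m, hist g v = U -> time x <= 60 /\ answer x = [::] &
      hist g v <> U -> exists es, [/\ ewalk Es s es v, all (fun e => e < g) es,
      uniq (nat_of_ord s :: [seq dst Es e | e <- es]),
      answer x = nat_of_ord s :: [seq dst Es e | e <- es] &
      len es <= hist g v /\ time x <= 200 * maxn (size es) 1]]
  end.

(** The returned [hist'] covers the whole future and agrees with [hist] on the past, so that all log
    entries refer to one and the same function. *)
Lemma session_ok rs i M hist X : drop (G i) E = inserted rs -> G i <= m ->
  PInv hist X M (G i) ->
  exists log hist' X', [/\ session Bb alg w i M rs log,
    (forall j, j <= G i -> hist' j = hist j) /\ (forall j, j <= G i -> X' j = X j),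
    Good hist' X' m,
    \sum_(x <- log | is_insert (req x)) time x <= \sum_(G i <= g < m) 10 * icost X' g &
    forall x, List.In x log -> i <= stage x /\ entry_ok hist' x].
Proof.
elim: rs i M hist X => [|r rs IH] i M hist X hdrop hi hP.
  have hm : m = G i.
    by apply/eqP; rewrite eqn_leq hi andbT -subn_eq0 -size_drop hdrop.
  exists [::], hist, X; split => //; first exact: SessionNil.
  - by rewrite hm; apply: (pi_good hP).
  - by rewrite big_nil.
have hvn := ltn_ord.
case: r hdrop => [u v|v|v] hdrop.
- have hlt : G i < m.
    by rewrite ltnNge; apply/negP => h; move: hdrop; rewrite drop_oversize.
  have [hnth hdrop'] : nth (s, s) E (G i) = (u, v) /\ drop (G i.+1) E = inserted rs.
    move: hdrop; rewrite (drop_nth (s, s)) // /inserted /= => [[-> h]].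
    by split => //; rewrite /G addnS.
  have hG1 : G i.+1 = (G i).+1 by rewrite /G addnS.
  have hlt0 := hlt.
  have hltE : G i < size Es by rewrite size_Es.
  have [t [M' [ o' [hist1 [X1 [hc hP1 hh hX ht]]]]]] :=
    insert_prog_spec H17 B_H (ltn_ord s) hLm H_n H_Wn H_ab Es_ok H_m H_K hW ha hltE hP.
  rewrite -hG1 in hP1 hlt *.
  have [log [hist2 [X2 [hs2 [hh2 hX2] hG2 hc2 hall]]]] := IH i.+1 M' hist1 X1 hdrop' hlt hP1.
  exists (Entry i (Insert u v) t o' :: log), hist2, X2; split => //.
  + apply: (@SessionCons _ _ _ _ i M (Insert u v) rs t M' o' log).
      have [e1 e2 e3] := triplesE s w hlt0.
      by move: hc; rewrite e1 e2 e3 hnth.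
    by rewrite /= addn1.
  + split => j hj; first by rewrite hh2 ?hh // hG1 ltnW.
    by rewrite hX2 ?hX // hG1 ltnW.
  + rewrite big_cons /= [X in _ <= X]big_ltn; last by rewrite -hG1.
    rewrite -hG1; apply: leq_add => //.
    apply: leq_trans ht _; rewrite leq_mul2l /=.
    rewrite /icost (@cost_at_ext _ X1 X2) //.
    by move=> j hj; rewrite hX2 // hG1.
  + move=> x /= [<-|hx] //.
    by have [h1 h2] := hall x hx; split => //; apply: ltnW.
- have [t [M' [ o' [hc hP1 ht ho]]]] :=
    dist_prog_spec H17 B_H (ltn_ord s) hLm H_n H_Wn H_ab H_m hW ha hP (ltn_ord v).
  have [log [hist2 [X2 [hs2 [hh2 hX2] hG2 hc2 hall]]]] := IH i M' hist X hdrop hi hP1.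
  exists (Entry i (QueryDist v) t o' :: log), hist2, X2; split => //.
  + by apply: (@SessionCons _ _ _ _ i M (QueryDist v) rs t M' o' log) => //=; rewrite addn0.
  + by rewrite big_cons.
  + move=> x /= [<-|hx]; last exact: hall.
    by split => //; rewrite /entry_ok /= hh2.
- have hiE : G i <= size Es by rewrite size_Es.
  have [t [M' [ o' [hc hP1 h1 h2]]]] :=
    path_prog_spec H17 B_H (ltn_ord s) hLm H_n H_Wn H_ab Es_ok H_m hW ha hP hiE (ltn_ord v).
  have [log [hist2 [X2 [hs2 [hh2 hX2] hG2 hc2 hall]]]] := IH i M' hist X hdrop hi hP1.
  exists (Entry i (QueryPath v) t o' :: log), hist2, X2; split => //.
  + by apply: (@SessionCons _ _ _ _ i M (QueryPath v) rs t M' o' log) => //=; rewrite addn0.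
  + by rewrite big_cons.
  + move=> x /= [<-|hx]; last exact: hall.
    by split => //; rewrite /entry_ok /= hh2.
Qed.

Lemma init_inputE : [:: n; nat_of_ord s; W; a; b; size E0] ++ edge_input Es 0 (size E0) =
  init_input w s W a b E0.
Proof.
rewrite /init_input /edge_input; congr (_ ++ _); congr flatten.
apply: (@eq_from_nth _ [::]); rewrite !size_map size_iota // => i hi.
rewrite (nth_map 0) ?size_iota // nth_iota // add0n (nth_map (s, s)) //.
have hiE : i < m by rewrite size_cat ltn_addr.
have [-> -> ->] := triplesE s w hiE.
by rewrite nth_cat hi.
Qed.

Lemma run_ok : exists t0 M0 o0 log hist X,
  [/\ call Bb (init_proc alg) (fun=> 0) (init_input w s W a b E0) t0 M0 o0,
      session Bb alg w 0 M0 rs0 log, Good hist X m,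
      update_time t0 log <= 10 * \sum_(0 <= g < m) icost X g + 500 &
      forall x, List.In x log -> entry_ok hist x].
Proof.
have h0 : size E0 <= size Es by rewrite size_Es size_cat leq_addr.
have [t0 [M0 [ o0 [hist [X [hc hP ht]]]]]] :=
  init_prog_spec H17 B_H (ltn_ord s) hLm H_n H_Wn H_ab Es_ok H_m H_K hW ha h0.
have hd : drop (G 0) E = inserted rs0 by rewrite /G addn0 drop_size_cat.
have hG0 : G 0 <= m by rewrite -size_Es /G addn0.
have hP0 : PInv hist X M0 (G 0) by rewrite /G addn0.
have [log [hist2 [X2 [hs2 [hh2 hX2] hG2 hc2 hall]]]] := session_ok hd hG0 hP0.
exists t0, M0, o0, log, hist2, X2; split => //.
- by rewrite -init_inputE.
- rewrite /update_time (big_cat_nat (n := G 0)) //= mulnDr.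
  have -> : \sum_(0 <= g < G 0) icost X2 g = \sum_(0 <= g < size E0) icost X g.
    rewrite /G addn0 big_nat_cond [RHS]big_nat_cond; apply: eq_bigr => g; rewrite andbT => hg.
    rewrite /icost (@cost_at_ext _ X X2) //.
    by move=> j hj; apply: hX2; rewrite /G addn0; lia.
  rewrite -big_distrr /= in hc2.
  by lia.
- by move=> x /hall [].
Qed.

End Main.

Lemma leq_mul_mid c x y z : x <= y -> c * x * z <= c * y * z.
Proof. by move=> h; rewrite leq_mul2r leq_mul2l h !orbT. Qed.

Lemma sum_le_mul (F F' : nat -> nat) c m : (forall g, g < m -> F g <= c * F' g) ->
  \sum_(0 <= g < m) F g <= c * \sum_(0 <= g < m) F' g.
Proof.
elim: m => [|m IH] h; first by rewrite big_geq.
rewrite !big_nat_recr //= mulnDr leq_add ?h // IH // => g hg; exact: h (ltnW _).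
Qed.

(** * From recorded estimates to distances, reported paths and the time bound *)

Section Estimate.
Variables (n : nat) (s : 'I_n) (w : 'I_n -> 'I_n -> nat) (W a b : nat).
Variables (E0 : seq ('I_n * 'I_n)) (rs0 : seq (request n)).
Local Notation E := (E0 ++ inserted rs0).
Hypothesis ha : 0 < a.
Hypothesis hb : 0 < b.
Hypothesis hu : uniq E.
Hypothesis hw : forall e, e \in E -> 1 <= w e.1 e.2 <= W.
Hypothesis hW : 1 <= W.
Local Notation Es := (triples w E).
Local Notation m := (size E).
Local Notation G := (G E0).
Local Notation U := (U n W).
Variables (hist : nat -> nat -> nat) (X : nat -> seq nat).
Hypothesis hG : Good n s W a b Es hist X m.
Local Notation Ei i := (E0 ++ take i (inserted rs0)).

Lemma EiE i : Ei i = take (G i) E.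
Proof. by rewrite take_cat /G ltnNge leq_addr /= addKn. Qed.

Lemma path_of_ewalk g es v : g <= m -> all (fun e => e < g) es -> ewalk Es s es (nat_of_ord v) ->
  uniq (nat_of_ord s :: [seq dst Es e | e <- es]) ->
  let p := heads s E es in
  [/\ is_path (take g E) s p v, nat_of_ord s :: [seq dst Es e | e <- es] = [seq nat_of_ord x | x <- s :: p],
      path_length w s p = len Es es & size p = size es].
Proof.
move=> hg hall hwk hun p; have [h1 h2 h3] := @ewalk_path n s w E g s es v hg hall hwk.
have e := @heads_val n s w E g es hg hall; rewrite e in hun.
split => //; last by rewrite size_map.
  have hun2 : uniq (s :: heads s E es) by rewrite -(map_inj_uniq val_inj).
  by rewrite /is_path h1 hun2 andbT; apply/eqP/val_inj.
by rewrite e.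
Qed.

Lemma path_bound g v p : g <= m -> is_path (take g E) s p v ->
  [/\ hist g v != U, hist g v * b <= (a + b) * path_length w s p &
      0 < path_length w s p -> hist g v * b < (a + b) * path_length w s p].
Proof.
move=> hg /and3P [hp /eqP hl hun].
have hsE : m <= size Es by rewrite size_Es.
have hEs := Es_ok s hw.
have [h1 h2 h3] := path_ewalk s w hg hu hp; rewrite hl in h2.
have hU := uniq_pairs s hu (path_pairs hp) (proj2 (andP hun)).
have sub x : x \in take g E -> x \in E by apply: mem_take.
have hle : path_length w s p <= W * size p.
  by apply: path_length_le hp => e /sub /hw /andP [].
have hsz : size p < n.
  by have := max_card (mem (s :: p)); rewrite card_ord (card_uniqP hun).
have U0 : 0 < U by rewrite /U !muln_gt0 (n_gt0 s) hW.
case: (posnP (path_length w s p)) => hl0.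
  have hs0 : size p = 0.
    apply/eqP; rewrite -leqn0 leqNgt -(@path_length_gt0 n w _ s p _ hp) ?hl0 //.
    by move=> e /sub /hw /andP [].
  have hv : v = s by rewrite -hl (size0nil hs0).
  have h0 : hist g v = 0 by rewrite hv; apply: (good_s (ltn_ord s) hG hg).
  by rewrite h0; split => //; rewrite eq_sym -lt0n.
rewrite h3 in hl0.
have [k1 k2] := approx_bound (ltn_ord s) hEs hW ha hsE hG hg hU h1 h2 hl0.
rewrite -h3 in k1 k2; split => //; last by apply: ltnW.
(* A simple path has at most [n - 1] edges, so the stretch below 2 keeps the estimate below
   [2 * W * (n - 1) <= U]. *)
have hx : W * size p <= W * (n - 1) by rewrite leq_mul2l; apply/orP; right; lia.
have hy : W * (n - 1) <= W * n by rewrite leq_mul2l; apply/orP; right; lia.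
by rewrite /U -mulnA [n * W]mulnC; lia.
Qed.

Lemma hist_path g v : g <= m -> hist g (nat_of_ord v) != U ->
  exists p, is_path (take g E) s p v /\ path_length w s p <= hist g v.
Proof.
move=> hg hv; have hsE : m <= size Es by rewrite size_Es.
have [es [k1 k2 k3 k4]] := good_path (Es_ok s hw) (ltn_ord s) hsE hG hg (ltn_ord v) hv.
have [h1 _ h3 _] := path_of_ewalk hg k2 k1 k3.
by exists (heads s E es); rewrite h3.
Qed.

Variable R : realType.

Definition dh i (v : 'I_n) : \bar R :=
  if hist (G i) v == U then +oo%E else (hist (G i) v)%:R%:E.

Lemma dh_approx i v : i <= size (inserted rs0) ->
  approximates (a%:R / b%:R)%R (dist R w (Ei i) s v) (dh i v).
Proof.
move=> hi; have hg : G i <= m by rewrite /G size_cat leq_add2l.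
rewrite EiE /dh; set g := G i in hg *.
have b0 : (0 < b%:R :> R)%R by rewrite ltr0n.
have a0 : (0 < a%:R :> R)%R by rewrite ltr0n.
have e0 : (0 < 1 + a%:R / b%:R :> R)%R by rewrite addr_gt0 // divr_gt0.
case: ifPn => hU.
  have -> : dist R w (take g E) s v = +oo%E.
    rewrite /dist (_ : [set p | is_path (take g E) s p v]%classic = set0) ?image_set0 ?ereal_inf0 //.
    apply/seteqP; split => // p /= hp.
    by have [] := path_bound hg hp; rewrite hU.
  by split; rewrite ?gt0_muley ?lte_fin ?ltxx.
(* Lengths are naturals, so the infimum defining the distance is attained by a shortest path, to
   which [path_bound] applies. *)
pose P l := `[< exists p, is_path (take g E) s p v /\ path_length w s p = l >].
have hP : exists l, P l.
  have [p [hp _]] := hist_path hg hU.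
  by exists (path_length w s p); apply/asboolP; exists p.
case: (ex_minnP hP) => l /asboolP [p [hp hpl]] hmin.
have -> : dist R w (take g E) s v = l%:R%:E.
  apply/eqP; rewrite eq_le; apply/andP; split.
    by apply: ereal_inf_lbound; exists p => //=; rewrite hpl.
  apply/ereal_infP => _ [p' /= hp' <-]; rewrite lee_fin ler_nat.
  by apply: hmin; apply/asboolP; exists p'.
have [_ h1 h2] := path_bound hg hp; rewrite hpl in h1 h2.
have [p' [hp' hle]] := hist_path hg hU.
have hE : ((1 + a%:R / b%:R) * l%:R = ((a + b) * l)%N%:R / b%:R :> R)%R.
  by rewrite natrM natrD; field; rewrite lt0r_neq0.
split.
- by rewrite lee_fin ler_nat; apply: leq_trans (hmin _ _) hle; apply/asboolP; exists p'.
- by rewrite -EFinM lee_fin hE ler_pdivlMr // -natrM ler_nat.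
- rewrite -EFinM !lte_fin ltr0n => hl _.
  by rewrite hE ltr_pdivlMr // -natrM ltr_nat h2.
Qed.

Lemma dist_entry (C i : nat) v t o : 200 <= C ->
  entry_ok s w W E0 rs0 hist (Entry i (QueryDist v) t o) ->
  t <= C /\ exists x y, o = [:: x; y] /\ estimate R x y = dh i v.
Proof.
move=> hC [/= ht ->]; split; first exact: leq_trans ht (leq_trans _ hC).
rewrite /dh; case: ifP => _; first by exists 0, 0.
by exists (hist (G i) v), 1; split => //; rewrite /estimate divr1.
Qed.

Lemma path_entry (C i : nat) v t o : 200 <= C ->
  entry_ok s w W E0 rs0 hist (Entry i (QueryPath v) t o) ->
  (dh i v = +oo%E -> t <= C /\ o = [::]) /\
  ((dh i v < +oo)%E -> exists p : seq 'I_n,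
     [/\ is_path (Ei i) s p v, o = [seq nat_of_ord x | x <- s :: p],
         ((path_length w s p)%:R%:E <= dh i v)%E & t <= C * maxn (size p) 1]).
Proof.
move=> hC [/= hg h1 h2]; rewrite EiE /dh; case: eqP => [e|ne]; split => //.
- by move=> _; have [ht ->] := h1 e; split => //; exact: leq_trans ht (leq_trans _ hC).
- move=> _; have [es [k1 k2 k3 -> [k5 k6]]] := h2 ne.
  have [j1 j2 j3 j4] := path_of_ewalk hg k2 k1 k3.
  exists (heads s E es); split; rewrite // ?j3 ?lee_fin ?ler_nat //.
  by rewrite j4; apply: leq_trans k6 _; rewrite leq_mul2r hC orbT.
Qed.

Lemma update_time_bound (C T : nat) : (61 * 100 * 10 * 44 * 100 + 500 <= C%:R :> R)%R ->
  T <= 10 * \sum_(0 <= g < m) icost (Lm n) Es X g + 500 ->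
  (T%:R <= C%:R * (1 + ln n%:R) ^+ 5 * ((maxn m 1)%:R `^ (3%:R / 2%:R))
           * (1 + ln W%:R) / Num.min 1 (a%:R / b%:R) :> R)%R.
Proof.
move=> hC hT; apply: total_bound => //; first exact: (n_gt0 s).
  exact: size_le_sq.
move=> cmax hc; apply: leq_trans hT _; rewrite leq_add2r leq_mul2l /=.
have hsE : m <= size Es by rewrite size_Es.
have := sum_cost (ltn_ord s) (Es_ok s hw) hW ha hsE hG hc.
move=> hS; apply: leq_trans (leq_mul (leqnn _) hS).
apply: sum_le_mul => g /ltnW hg; apply: leq_mul_mid.
by rewrite leq_add2l kf_mono.
Qed.

End Estimate.

(* Instances: source s, weights w bounded by W, accuracy a / b, initial edges
   E0, any sequence rs of insertions and queries.  The algorithm A and the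
   constants C (time), k (polylog exponent), c (word size) are uniform. *)
Theorem theorem1 (R : realType) :
  exists (A : algorithm) (C k c : nat),
  forall (n : nat) (s : 'I_n) (w : 'I_n -> 'I_n -> nat) (W a b : nat)
         (E0 : seq ('I_n * 'I_n)) (rs : seq (request n)),
    let E := E0 ++ inserted rs in
    let m := size E in
    let eps : R := (a%:R / b%:R)%R in
    let B := ((n + W + a + b + 2) ^ c)%N in
    (0 < a)%N -> (0 < b)%N ->
    uniq E ->
    (forall e, e \in E -> (1 <= w e.1 e.2 <= W)%N) ->
    (1 <= W)%N ->
  exists (t0 : nat) (M0 : nat -> nat) (o0 : seq nat) (log : seq (entry n)),
    [/\ call B (init_proc A) (fun=> 0%N) (init_input w s W a b E0) t0 M0 o0,
        session B A w 0 M0 rs log,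
        ((update_time t0 log)%:R <=
           C%:R * (1 + ln n%:R) ^+ k * ((maxn m 1)%:R `^ (3%:R / 2%:R))
           * (1 + ln W%:R) / Num.min 1 eps)%R
      & exists dh : nat -> 'I_n -> \bar R,
        [/\ forall (i : nat) (v : 'I_n), (i <= size (inserted rs))%N ->
              approximates eps (dist R w (E0 ++ take i (inserted rs)) s v) (dh i v),
            forall (i : nat) (v : 'I_n) (t : nat) (o : seq nat),
              List.In (Entry i (QueryDist v) t o) log ->
              (t <= C)%N /\
              exists x y : nat, o = [:: x; y] /\ estimate R x y = dh i v
          & forall (i : nat) (v : 'I_n) (t : nat) (o : seq nat),
              List.In (Entry i (QueryPath v) t o) log ->
              (dh i v = +oo%E -> (t <= C)%N /\ o = [::]) /\
              ((dh i v < +oo)%E ->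
                 exists p : seq 'I_n,
                   [/\ is_path (E0 ++ take i (inserted rs)) s p v,
                       o = [seq nat_of_ord x | x <- s :: p],
                       ((path_length w s p)%:R%:E <= dh i v)%E
                     & (t <= C * maxn (size p) 1)%N])]].
Proof.
(* The constant of [total_bound], which also exceeds the 200 needed for queries. *)
have [C hC hCR] : exists2 C : nat, 200 <= C &
    (61 * 100 * 10 * 44 * 100 + 500 <= C%:R :> R)%R.
  exists (61 * 100 * 10 * 44 * 100 + 500); first exact: leq_trans (leq_addl _ 500).
  by rewrite natrD !natrM.
(* The exponent 5 counts the logarithmic factors of [total_bound]; 80 is the exponent in [Bb]. *)
exists alg, C, 5, 80 => n s w W a b E0 rs E m eps B ha hb hu hw hW.
have [t0 [M0 [ o0 [log [hist [X [h1 h2 h3 h4 h5]]]]]]] := run_ok s ha hb hu hw hW.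
exists t0, M0, o0, log; split => //; first exact: (update_time_bound ha hb hu hw hW h3 hCR h4).
exists (dh W E0 hist R); split.
- by move=> i v; apply: (dh_approx ha hb hu hw hW h3).
- by move=> i v t o hx; apply: dist_entry (h5 _ hx).
- by move=> i v t o hx; apply: path_entry (h5 _ hx).
Qed.
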